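(* Let $G$ be a semigroupoid, let $\Psi$ be a collection of test functions for $G$, let $\mathfrak B=C_b(\Psi)$ and let $E:G\to\mathfrak B$ be the evaluation $E(x)(\psi)=\psi(x)$. Let $\varphi:G\to\mathbb C$. Then the following are equivalent: (i) $\varphi\in H^\infty(\mathcal K_\Psi)$ and $\|\varphi\|_{H^\infty(\mathcal K_\Psi)}\le 1$; (iiF) for each finite lower set $F\subset G$ there exists a positive kernel $\Gamma:F\times F\to\mathfrak B^*$ such that for all $x,y\in F$ $$([1]-\varphi\varphi^* )(x,y)=(\Gamma\,\hat\star\,([1]-EE^* ))(x,y);$$ (iiG) there exists a positive kernel $\Gamma:G\times G\to\mathfrak B^*$ such that for all $x,y\in G$ $$([1]-\varphi\varphi^* )(x,y)=(\Gamma\,\hat\star\,([1]-EE^* ))(x,y);$$ (iii) there is a $\mathfrak B$-unitary colligation $\Sigma$ such that $\varphi=W_\Sigma$.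
   Context: **Semigroupoids.** Let $G$ be a set with a partial multiplication, i.e. a map $X\to G$, $(x,y)\mapsto xy$, with $X\subset G\times G$; ''$xy$ is defined'' means $(x,y)\in X$. An element $e\in G$ is idempotent if $ex=x$ whenever $ex$ is defined and $ye=y$ whenever $ye$ is defined. $G$ is a semigroupoid if: (1) if either $(ab)c$ or $a(bc)$ is defined then so is the other and they are equal; and if $ab$ and $bc$ are defined then so is $(ab)c$; (2) for each $a\in G$ there exist idempotents $e,f\in G$ with $ea=a=af$, and any $e\in G$ with $e^2=e$ is idempotent; (3) if $ab=e$ with $e$ idempotent then $a=b=e$; (4) for each $a\in G$ the set of triples $(z,b,w)$ with $zbw=a$ is finite, and there is $N<\infty$ with $\mathrm{card}\{b\in G: cb=a\}\le N$ for all $a,c\in G$. $G_e$ denotes the set of idempotents. Write $b\le a$ if $a=zbw$ for some $z,w\in G$; this is a partial order. $F\subset G$ is lower if $a\in F$, $b\le a$ imply $b\in F$; $F_e=F\cap G_e$. **Products.** For functions $f,g$ on a lower set $F$ with values in an algebra (or operators for which the products make sense), $(f\star g)(a)=\sum_{rs=a}f(r)g(s)$. $P(F)$ is the algebra of functions $F\to\mathbb C$ with this product; its unit is $\delta(x)=1$ for $x\in F_e$, $\delta(x)=0$ otherwise. $f^{n_\star}$ is the $n$-fold $\star$-power and $f^{-1_\star}$ the $\star$-inverse. For $A,B:F\times F\to\mathbb C$, $(A\star B)(a,b)=\sum_{pq=a}\sum_{rs=b}A(p,r)B(q,s)$. $[1](x,y)=1$ if $x,y$ are both idempotent, and $0$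 otherwise. For a function $f$, $ff^*$ denotes $(x,y)\mapsto f(x)f(y)^*$. **Test functions.** For a finite lower set $F$ and $\varphi:F\to\mathbb C$, the Toeplitz matrix $\mathfrak T(\varphi)$ is the operator on the Hilbert space $\mathbb C^F$ (standard inner product) with entries $[\mathfrak T(\varphi)]_{a,b}=\sum_{c:\,cb=a}\varphi(c)$; equivalently $\mathfrak T(\varphi)f=\varphi\star f$. A nonempty collection $\Psi$ of functions $G\to\mathbb C$ is a collection of test functions if (i) $\|\mathfrak T(\psi|_F)\|\le1$ for each finite lower set $F$ and $\psi\in\Psi$; (ii) for each $a\in G_e$, $\lim_{n\to\infty}\psi(a)^n=0$ uniformly in $\psi\in\Psi$; (iii) for each finite lower set $F$ the (unital) algebra generated by $\{\psi|_F:\psi\in\Psi\}$ is all of $P(F)$. **Kernels.** A function $\mathbf k:F\times F\to\mathbb C$ is a positive kernel if $(\mathbf k(a,b))_{a,b\in A}$ is positive semidefinite for each finite $A\subset F$. $\mathcal K_\Psi$ is the set of positive kernels $\mathbf k$ on $G$ such that $([1]-\psi\psi^* )\star\mathbf k$ is a positive kernel for each $\psi\in\Psi$. $H^\infty(\mathcal K_\Psi)$ is the set of $\varphi:G\to\mathbb C$ for which there is $C>0$ such that $(C^2[1]-\varphi\varphi^* )\star\mathbf k$ is a positive kernel on $G$ for every $\mathbf k\in\mathcal K_\Psi$; $\|\varphi\|_{H^\infty(\mathcal K_\Psi)}$ is the infimum of such $C$. **The algebra $\mathfrak B$.** $\Psi$ carries the topology of pointwise convergence on $G$, in which it is assumed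 compact; $\mathfrak B=C_b(\Psi)$ is the $C^*$-algebra of bounded continuous functions on $\Psi$ with the sup norm, $\mathfrak B^*$ its Banach space dual, and $E(x)\in\mathfrak B$ is $E(x)(\psi)=\psi(x)$. A function $\Gamma:F\times F\to\mathfrak B^*$ is a positive kernel if for each finite $A\subset F$ and $f:A\to\mathfrak B$, $\sum_{x,y\in A}\Gamma(x,y)(f(x)f(y)^* )\ge0$. For such $\Gamma$, $$(\Gamma\,\hat\star\,([1]-EE^* ))(x,y)=\sum_{pq=x}\sum_{rs=y}\Gamma(q,s)\big([1](p,r)1-E(p)E(r)^*\big).$$ **Colligations.** A $\mathfrak B$-unitary colligation is a triple $\Sigma=(U,\mathcal E,\rho)$ with $\mathcal E$ a Hilbert space, $U=\begin{pmatrix}A&B\\C&D\end{pmatrix}$ a unitary operator on $\mathcal E\oplus\mathbb C$, and $\rho:\mathfrak B\to B(\mathcal E)$ a unital $*$-representation. Its transfer function is $$W_\Sigma(x)=D\delta(x)+C\big(\rho(E)\star(\delta-A\rho(E))^{-1_\star}\star(B\delta)\big)(x),\qquad x\in G,$$ where $\rho(E)(x)=\rho(E(x))$, $(A\rho(E))(x)=A\rho(E(x))$, $(B\delta)(x)=\delta(x)B$, and inside the inverse $\delta(x)$ means $\delta(x)I_{\mathcal E}$. *)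

(* Defs.v *)
From HB Require Import structures.
From mathcomp Require Import all_boot all_order all_algebra finmap.
From mathcomp Require Import sesquilinear complex.
From mathcomp Require Import all_classical all_reals all_analysis.

Set Implicit Arguments.
Unset Strict Implicit.
Unset Printing Implicit Defensive.

Import Order.TTheory GRing.Theory Num.Def Num.Theory.
Import numFieldNormedType.Exports.

Local Open Scope classical_set_scope.
Local Open Scope complex_scope.
Local Open Scope ring_scope.

(* The complex numbers over [R].  Naming the [numClosedFieldType] (rather than
   writing [R[i]]) gives access to the norm, topology and module structures
   that MathComp-Analysis declares on abstract number fields; on the concrete
   type [R[i]] the canonical module structure is the one over [R]. *)
Definition Cplx (R : realType) : numClosedFieldType := R[i].
Arguments Cplx R : simpl never.

Definition toC (R : realType) (x : R) : Cplx R := x%:C.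

(* A partial multiplication is a map to [option G]; [None] is "not defined".
   The [choiceType] structure is only there for finite sums: classically every
   type has one. *)
Definition idem (G : Type) (mul : G -> G -> option G) : set G :=
  [set e | (forall x y, mul e x = Some y -> y = x) /\
           (forall x y, mul x e = Some y -> y = x)].

Definition mul3 (G : Type) (mul : G -> G -> option G) (z b w : G) : option G :=
  obind (fun zb => mul zb w) (mul z b).

Record semigroupoid := Semigroupoid {
  sg_car :> choiceType;
  sg_mul : sg_car -> sg_car -> option sg_car;
  sg_assoc : forall a b c,
    mul3 sg_mul a b c = obind (fun bc => sg_mul a bc) (sg_mul b c);
  sg_def : forall a b c ab bc, sg_mul a b = Some ab -> sg_mul b c = Some bc ->
    exists abc, sg_mul ab c = Some abc;
  sg_units : forall a, exists e f, [/\ idem sg_mul e, idem sg_mul f,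
    sg_mul e a = Some a & sg_mul a f = Some a];
  sg_idem : forall e, sg_mul e e = Some e -> idem sg_mul e;
  sg_noinv : forall a b e, sg_mul a b = Some e -> idem sg_mul e ->
    a = e /\ b = e;
  sg_finite : forall a,
    finite_set [set t : sg_car * sg_car * sg_car |
                 mul3 sg_mul t.1.1 t.1.2 t.2 = Some a];
  sg_bounded : exists N : nat, forall a c,
    ([set b | sg_mul c b = Some a] #<= `I_N)%card
}.

Section Semigroupoid.
Variable G : semigroupoid.

Definition Ge : set G := idem (@sg_mul G).

Definition sg_le (b a : G) : Prop := exists z w, mul3 (@sg_mul G) z b w = Some a.

Definition lower (F : set G) : Prop := forall a b, F a -> sg_le b a -> F b.

(* Finite, by [sg_finite]. *)
Definition factors (a : G) : set (G * G) :=
  [set p | sg_mul p.1 p.2 = Some a].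

End Semigroupoid.

(* A function (or kernel) on a lower set [F] is represented by a function on
   all of [G] of which only the values on [F] matter.  This is compatible with
   the products below: the factors of an element of [F] are in [F]. *)

Section Scalar.
Variables (R : realType) (G : semigroupoid).
Local Notation C := (Cplx R).

Definition delta (x : G) : C := (x \in @Ge G)%:R.

Definition star (f g : G -> C) (a : G) : C :=
  \sum_(p \in factors a) f p.1 * g p.2.

Definition kone (x y : G) : C := ((x \in @Ge G) && (y \in @Ge G))%:R.

Definition kstar (A B : G -> G -> C) (a b : G) : C :=
  \sum_(p \in factors a) \sum_(q \in factors b) A p.1 q.1 * B p.2 q.2.

Definition kself (f : G -> C) (x y : G) : C := f x * (f y)^*.

Definition pos_kernel (F : set G) (k : G -> G -> C) : Prop :=
  forall (A : {fset G}) (c : G -> C), [set` A] `<=` F ->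
    0 <= \sum_(a <- A) \sum_(b <- A) (c a)^* * k a b * c b.

Definition toeplitz (phi : G -> C) (a b : G) : C :=
  \sum_(c \in [set c | sg_mul c b = Some a]) phi c.

(* The operator norm on C^F of the matrix [m] is at most 1. *)
Definition contractive (F : {fset G}) (m : G -> G -> C) : Prop :=
  forall f : G -> C,
    \sum_(a <- F) `|\sum_(b <- F) m a b * f b| ^+ 2 <= \sum_(b <- F) `|f b| ^+ 2.

(* The unital subalgebra of P(F) generated by the restrictions to [F] of the
   members of [S]; [gen_eq] identifies functions that agree on [F]. *)
Inductive gen_alg (F : set G) (S : set (G -> C)) : (G -> C) -> Prop :=
| gen_base f : S f -> gen_alg F S f
| gen_unit : gen_alg F S delta
| gen_add f g : gen_alg F S f -> gen_alg F S g -> gen_alg F S (f + g)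
| gen_scale c f : gen_alg F S f -> gen_alg F S (c *: f)
| gen_star f g : gen_alg F S f -> gen_alg F S g -> gen_alg F S (star f g)
| gen_eq f g : {in F, f =1 g} -> gen_alg F S f -> gen_alg F S g.

Record test_functions (Psi : set (G -> C)) : Prop := TestFunctions {
  tf_nonempty : Psi !=set0;
  tf_contractive : forall (F : {fset G}) psi, lower [set` F] -> Psi psi ->
    contractive F (toeplitz psi);
  tf_uniform : forall a : G, Ge a ->
    {uniform Psi, (fun (n : nat) (psi : G -> C) => psi a ^+ n) @ \oo --> (fun=> 0)};
  tf_generate : forall F : {fset G}, lower [set` F] ->
    forall f : G -> C, gen_alg [set` F] Psi f
}.

Section Hinfty.
Variable Psi : set (G -> C).

Definition KPsi : set (G -> G -> C) :=
  [set k | pos_kernel setT k /\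
    forall psi, Psi psi -> pos_kernel setT (kstar (kone - kself psi) k)].

Definition Hinf_bounds (phi : G -> C) : set R :=
  [set c | 0 < c /\ forall k, KPsi k ->
    pos_kernel setT (kstar (toC c ^+ 2 *: kone - kself phi) k)].

Definition Hinf : set (G -> C) := [set phi | Hinf_bounds phi !=set0].

Definition Hinf_norm (phi : G -> C) : R := inf (Hinf_bounds phi).

End Hinfty.
End Scalar.

Record bounded_op (K : numFieldType) (V W : normedModType K) := BoundedOp {
  bop_lin :> {linear V -> W};
  bop_continuous : continuous bop_lin
}.

Definition dual (K : numFieldType) (V : normedModType K) := bounded_op V K^o.

Record hilbert (R : realType) := Hilbert {
  hs_car :> completeNormedModType (Cplx R);
  hs_inner : {dot hs_car for conjC};
  hs_norm : forall x, hs_inner x x = `|x| ^+ 2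
}.

Section Cb.
Variables (R : realType) (T : topologicalType).
Local Notation C := (Cplx R).

Definition Cb_pred : {pred T -> C} :=
  [pred f : T -> C | `[< continuous f /\ bounded_fun f >]].

Record Cb := MkCb { cb_fun :> T -> C; cb_mem : cb_fun \in Cb_pred }.

HB.instance Definition _ := [isSub for cb_fun].
HB.instance Definition _ := [Choice of Cb by <:].

Lemma Cb_predP (f : T -> C) :
  reflect (continuous f /\ exists M : C, forall t, `|f t| <= M) (f \in Cb_pred).
Proof.
apply: (iffP (asboolP _)) => -[cf bf]; split=> //.
  have [t0|] := pselect ([set: T] !=set0).
    have PF : ProperFilter (globally [set: T]).
      by case: t0 => t tT; exact: globally_properfilter tT.
    by have /ex_bound[M bM] := bf; exists M => t; exact: bM.
  by move=> T0; exists 0 => t; exfalso; apply: T0; exists t.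
have [M bM] := bf.
have [[t _]|T0] := pselect ([set: T] !=set0); last first.
  by exists 0; split=> // x _ t _; exfalso; apply: T0; exists t.
have M0 : 0 <= M by exact: le_trans (bM t).
by exists M; split=> [|x Mx s _]; [exact: ger0_real | exact: le_trans (ltW Mx)].
Qed.

Lemma Cb_pred_subring : subring_closed Cb_pred.
Proof.
split=> [|f g|f g].
- by apply/Cb_predP; split; [exact: cst_continuous | exists 1 => t; rewrite normr1].
- move=> /Cb_predP[cf [M bf]] /Cb_predP[cg [N bg]]; apply/Cb_predP; split.
    by move=> t; apply: cvgB; [exact: cf | exact: cg].
  by exists (M + N) => t; rewrite (le_trans (ler_normB _ _))// lerD.
- move=> /Cb_predP[cf [M bf]] /Cb_predP[cg [N bg]]; apply/Cb_predP; split.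
    by move=> t; apply: cvgM; [exact: cf | exact: cg].
  by exists (M * N) => t; rewrite normrM ler_pM.
Qed.

Lemma Cb_pred_submod : submod_closed Cb_pred.
Proof.
split=> [|c f g].
  by apply/Cb_predP; split; [exact: cst_continuous | exists 0 => t; rewrite normr0].
move=> /Cb_predP[cf [M bf]] /Cb_predP[cg [N bg]]; apply/Cb_predP; split.
  move=> t; apply: (@cvgD _ _ _ _ _ (fun t => c * f t)); last exact: cg.
  by apply: cvgM; [exact: cvg_cst | exact: cf].
exists (`|c| * M + N) => t; rewrite (le_trans (ler_normD _ _))// lerD//.
by rewrite [leLHS]normrM ler_wpM2l.
Qed.

HB.instance Definition _ :=
  GRing.isSubringClosed.Build (T -> C) Cb_pred Cb_pred_subring.
HB.instance Definition _ :=
  GRing.isSubmodClosed.Build C (T -> C) Cb_pred Cb_pred_submod.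
HB.instance Definition _ :=
  GRing.SubChoice_isSubComPzRing.Build _ _ Cb Cb_pred_subring.
HB.instance Definition _ := [SubZmodule_isSubLmodule of Cb by <:].

Lemma cb_conj_subproof (f : Cb) : (fun t => (f t)^*) \in Cb_pred.
Proof.
have /Cb_predP[cf [M bf]] := cb_mem f; apply/Cb_predP; split; last first.
  by exists M => t; rewrite norm_conjC.
move=> t; apply/cvgrPdist_lt => e e0.
have /cvgrPdist_lt/(_ e e0) := cf t.
by apply: filterS => s; rewrite -rmorphB norm_conjC.
Qed.

Definition cb_conj (f : Cb) : Cb := MkCb (cb_conj_subproof f).

(* The supremum norm; it is 0 when [T] is empty. *)
Definition cb_norm (f : Cb) : C :=
  toC (sup [set complex.Re `|f t| | t in [set: T]]).

Let ReK (z : C) : toC (complex.Re `|z|) = `|z|.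
Proof. by rewrite /toC RRe_real// normr_real. Qed.

Lemma cb_norm_ub (f : Cb) t : `|f t| <= cb_norm f.
Proof.
have /Cb_predP[_ [M bf]] := cb_mem f.
rewrite -ReK /cb_norm /toC lecR; apply: ub_le_sup; last by exists t.
exists (complex.Re M) => _ [s _ <-].
by have := bf s; rewrite lecE => /andP[].
Qed.

Lemma cb_norm_le (f : Cb) (M : C) :
  0 <= M -> (forall t, `|f t| <= M) -> cb_norm f <= M.
Proof.
move=> M0 bf; have -> : M = toC (complex.Re M).
  by rewrite /toC RRe_real// ger0_real.
rewrite /cb_norm /toC lecR.
have [->|/set0P[t0 _]] := eqVneq [set: T] set0.
  by rewrite image_set0 sup0; move: M0; rewrite lecE => /andP[].
apply: ge_sup; first by exists (complex.Re `|f t0|), t0.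
by move=> _ [s _ <-]; have := bf s; rewrite lecE => /andP[].
Qed.

Lemma cb_norm_ge0 (f : Cb) : 0 <= cb_norm f.
Proof.
have [T0|/set0P[t0 _]] := eqVneq [set: T] set0.
  by rewrite /cb_norm T0 image_set0 sup0.
exact: le_trans (cb_norm_ub f t0).
Qed.

Lemma cb_norm_triangle (f g : Cb) : cb_norm (f + g) <= cb_norm f + cb_norm g.
Proof.
apply: cb_norm_le => [|t]; first by rewrite addr_ge0// cb_norm_ge0.
by rewrite (le_trans (ler_normD _ _))// lerD// cb_norm_ub.
Qed.

Lemma cb_norm_scale (c : C) (f : Cb) : cb_norm (c *: f) = `|c| * cb_norm f.
Proof.
have scale_le (d : C) (g : Cb) : cb_norm (d *: g) <= `|d| * cb_norm g.
  apply: cb_norm_le => [|t]; first by rewrite mulr_ge0// cb_norm_ge0.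
  by rewrite [leLHS]normrM ler_wpM2l// cb_norm_ub.
apply/eqP; rewrite eq_le scale_le/=.
have [->|c0] := eqVneq c 0; first by rewrite normr0 mul0r cb_norm_ge0.
rewrite -ler_pdivlMl ?normr_gt0// -normfV.
by rewrite (le_trans _ (scale_le _ _))// scalerA mulVf// scale1r.
Qed.

Lemma cb_norm_eq0 (f : Cb) : cb_norm f = 0 -> f = 0.
Proof.
move=> f0; apply/val_inj/funext => t /=; apply/eqP; rewrite -normr_le0.
by rewrite -f0 cb_norm_ub.
Qed.

HB.instance Definition _ := Lmodule_isNormed.Build C Cb
  cb_norm_triangle cb_norm_scale cb_norm_eq0.

End Cb.

Section DualKernels.
Variables (R : realType) (G : semigroupoid) (Psi : set {ptws G -> Cplx R}).
Hypothesis cPsi : compact Psi.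
Local Notation C := (Cplx R).
Local Notation B := (Cb R (set_type Psi)).

Lemma evalB_subproof (x : G) :
  (fun psi : set_type Psi => (\val psi : G -> C) x) \in @Cb_pred R (set_type Psi).
Proof.
apply/asboolP; split.
  move=> psi; apply: (@continuous_comp (set_type Psi) {ptws G -> C} C
    set_val (fun f => f x)); first exact: initial_continuous.
  exact: (@proj_continuous G (fun=> C) x).
suff bd : \forall M \near +oo_C, Psi `<=` [set f | `|f x| <= M].
  by rewrite /= /bounded_near; apply: filterS bd => M bM psi _; exact/bM/set_valP.
have /compact_near_coveringP/(_ C (pinfty_nbhs C)
  (fun M (f : {ptws G -> C}) => `|f x| <= M)) := cPsi; apply=> f _.
have fx1 : \forall f' \near (f : {ptws G -> C}), `|f' x - f x| < 1.
  have pf : (fun f' : {ptws G -> C} => f' x : C) @ f --> (f x : C).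
    exact: (@proj_continuous G (fun=> C) x f).
  exact: (iffLR (cvgrPdistC_lt _ _) pf 1 ltr01).
near=> f' M => /=; rewrite -(subrK (f x) (f' x)).
rewrite (le_trans (ler_normD _ _))//.
have fM : 1 + `|f x| <= M by near: M; exact: nbhs_pinfty_ge.
apply: le_trans fM; rewrite lerD2r ltW//; near: f'; exact: fx1.
Unshelve. all: by end_near. Qed.

(* Compactness of [Psi] is what makes the evaluations bounded. *)
Definition evalB (x : G) : B := MkCb (evalB_subproof x).

Definition EE (x y : G) : B := evalB x * cb_conj (evalB y).

Definition dual_pos_kernel (F : set G) (Gam : G -> G -> dual B) : Prop :=
  forall (A : {fset G}) (f : G -> B), [set` A] `<=` F ->
    0 <= \sum_(x <- A) \sum_(y <- A) Gam x y (f x * cb_conj (f y)).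

Definition hatstar (Gam : G -> G -> dual B) (M : G -> G -> B) (x y : G) : C :=
  \sum_(p \in factors x) \sum_(q \in factors y) Gam p.2 q.2 (M p.1 q.1).

Definition oneEE (x y : G) : B := kone R x y *: (1 : B) - EE x y.

End DualKernels.

Section Colligation.
Variables (R : realType) (G : semigroupoid) (Psi : set {ptws G -> Cplx R}).
Hypothesis cPsi : compact Psi.
Local Notation C := (Cplx R).
Local Notation B := (Cb R (set_type Psi)).

Record star_rep (E : hilbert R) := StarRep {
  rep :> B -> bounded_op E E;
  rep_linear : forall (c : C) b b' v, rep (c *: b + b') v = c *: rep b v + rep b' v;
  rep_mul : forall b b' v, rep (b * b') v = rep b (rep b' v);
  rep_unit : forall v, rep 1 v = v;
  rep_conj : forall b v w,
    hs_inner E (rep b v) w = hs_inner E v (rep (cb_conj b) w)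
}.

(* The inner product of the Hilbert space direct sum of [E] and [C]. *)
Definition dsum_inner (E : hilbert R) (u v : E * C) : C :=
  hs_inner E u.1 v.1 + u.2 * (v.2)^*.

Definition unitary (E : hilbert R) (U : {linear (E * C)%type -> (E * C)%type}) :=
  (forall v, exists u, U u = v) /\
  (forall u v, dsum_inner (U u) (U v) = dsum_inner u v).

Record colligation := Colligation {
  col_space : hilbert R;
  col_U : {linear (col_space * C)%type -> (col_space * C)%type};
  col_unitary : unitary col_U;
  col_rep : star_rep col_space
}.

(* Operators are handled here as plain functions, so that sums are taken in
   [U -> W]. *)
Definition opstar (U V W : lmodType C) (S : G -> V -> W) (T : G -> U -> V)
    (a : G) : U -> W :=
  \sum_(p \in factors a) (S p.1 \o T p.2).

Definition opdelta (V : lmodType C) (x : G) (v : V) : V := delta R x *: v.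

(* The star-inverse of a function with values in B(E), itself with values in
   B(E); it is unique when it exists. *)
Definition star_inv (E : hilbert R) (S : G -> E -> E) : G -> E -> E :=
  xget S [set T : G -> E -> E |
    [/\ forall x, exists t : bounded_op E E, T x = t :> (E -> E),
      opstar S T = @opdelta E & opstar T S = @opdelta E]].

Section Transfer.
Variable Sigma : colligation.
Local Notation E := (col_space Sigma).

Definition colA (v : E) : E := (col_U Sigma (v, 0)).1.
Definition colB (z : C) : E := (col_U Sigma (0, z)).1.
Definition colC (v : E) : C := (col_U Sigma (v, 0)).2.
Definition colD (z : C) : C := (col_U Sigma (0, z)).2.

Definition rhoE (x : G) : E -> E := col_rep Sigma (evalB cPsi x).

(* An operator from C to C is identified with its value at 1. *)
Definition transfer (x : G) : C :=
  delta R x * colD 1 +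
  colC (opstar (opstar rhoE (star_inv (fun y => @opdelta E y \- (colA \o rhoE y))))
               (fun y z => delta R y *: colB z) x 1).

End Transfer.
End Colligation.

(* Main.v *)
From HB Require Import structures.
Require Import Defs.
From mathcomp Require Import all_boot all_order all_algebra finmap.
From mathcomp Require Import sesquilinear complex.
From mathcomp Require Import all_classical all_reals all_analysis.
From mathcomp Require Import ring.

Set Implicit Arguments.
Unset Strict Implicit.
Unset Printing Implicit Defensive.

Import Order.TTheory GRing.Theory Num.Def Num.Theory.
Import numFieldNormedType.Exports.

Local Open Scope classical_set_scope.
Local Open Scope ring_scope.

(** Why the theorem is true.

    A positive kernel [Gam] with values in the dual of [C_b(Psi)] is, by the
    GNS construction, of the form [Gam x y b = <rho b (g x), g y>] for vectors
    [g x] of a Hilbert space on which [C_b(Psi)] acts by [rho] ([gns_spec]).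
    With [E*g] for the star product of [x |-> rho (E x)] with [g], the
    decomposition of [[1] - phi phi^*] along [[1] - E E^*] says that the two
    families [(E*g x, delta x)] and [(g x, phi x)] have the same Gram matrix
    ([hatstar_gram]).  All steps are read through these vectors.

    From a decomposition on [G] to a colligation: families with equal Gram
    matrices are matched by a unitary of a larger space on which the
    representation still acts ([unitary_extension]).  It maps [(E*g, delta)] to
    [(g, phi)], that is, [g = A (E*g) + B delta] and [phi = C (E*g) + D delta].
    As [|psi e| <= r < 1] at every idempotent [e], the function
    [delta - A rho(E)] is star-invertible ([resolvent_inv]), so that the first
    equation determines [g] and the second one is the transfer formula
    ([transfer_eq]).

    From a colligation to the kernel condition: with
    [R = rho(E) * (delta - A rho(E))^-1] the row [(C R, delta) U] is [(L, phi)],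
    and [L * rho(E) = C R].  Since [U] is unitary, [[1] - phi phi^*] equals
    [L L^* - (L * rho(E)) (L * rho(E))^*].  Multiplying by [k] in [KPsi], the
    product of [[1] - E E^*] with [k] appears between [L] and [L^*]: a matrix
    with entries in [C_b(Psi)].  It is positive at each point of [Psi], hence the
    matrix of its images under [rho] is positive ([pos_matrix],
    [transfer_kernel]).

    From the kernel condition to a decomposition on [G]: on a finite lower set
    [F] the decomposable kernels contain a convex cone of matrices, spanned by
    [h h^* - (psi * h) (psi * h)^*].  If [[1] - phi phi^*] were not in its
    closure, it would be separated from it ([cone_separation]) by a Hermitian
    form [Q] on functions on [F] with [Q (psi * h) <= Q h].  Such a form is
    nonnegative, because the iterates of [psi *] tend to zero ([Q_ge0]).  The
    inverse matrix of [Q + eps], extended by [1 / eps] times the identity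
    outside [F], belongs to [KPsi]: inverting a form turns contractions into
    contractive adjoints ([form_duality]).  The kernel condition for this
    kernel, dualised back and applied to [delta], gives [Q phi <= Q delta],
    which the separation forbids ([no_separation]).  Hence decompositions exist
    on every finite lower set up to any error ([approx_decomp]).

    Finally, kernels with converging products have a limit kernel
    ([limit_kernel]): as [|psi e| <= r < 1], the diagonal entries bound the
    vectors [g x] by induction on the number of right factors of [x], and one
    takes limits along an ultrafilter.  This removes the error terms and
    passes from finite lower sets to [G].

    The Hilbert spaces constructed on the way are spaces [rkhs k] of functions
    on a set [S] with positive kernel [k].  Completions, GNS spaces and direct sums are then
    choices of [S] and [k], and operators between them are substitutions of
    the argument ([pull]). *)

(** * Limits of complex families *)
Section FieldLimits.
Variable C : numClosedFieldType.

Section Specialised.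
Variables (I : Type) (F : set_system I).
Context {FF : Filter F}.
Implicit Types (f g : I -> C) (l m : C).

Lemma cvgDC f g l m : f @ F --> l -> g @ F --> m ->
  (fun i => f i + g i) @ F --> (l + m : C).
Proof. by move=> fl gm; exact: cvgD. Qed.

Lemma cvgBC f g l m : f @ F --> l -> g @ F --> m ->
  (fun i => f i - g i) @ F --> (l - m : C).
Proof. by move=> fl gm; exact: cvgB. Qed.

Lemma cvgMC f g l m : f @ F --> l -> g @ F --> m ->
  (fun i => f i * g i) @ F --> (l * m : C).
Proof. by move=> fl gm; exact: cvgM. Qed.

Lemma cvgZC c f l : f @ F --> l -> (fun i => c * f i) @ F --> (c * l : C).
Proof. by move=> fl; apply: cvgMC fl; exact: cvg_cst. Qed.

Lemma cvg_cstC l : (fun=> l) @ F --> l.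
Proof. exact: cvg_cst. Qed.

Lemma cvg_sumC (J : Type) (r : seq J) (P : pred J) (f : J -> I -> C) (l : J -> C) :
  (forall j, f j @ F --> l j) ->
  (fun i => \sum_(j <- r | P j) f j i) @ F --> (\sum_(j <- r | P j) l j : C).
Proof.
move=> fl; elim: r => [|j r IH].
  by under eq_fun do rewrite big_nil; rewrite big_nil; exact: cvg_cstC.
under eq_fun do rewrite big_cons; rewrite big_cons.
by case: (P j) => //; exact: cvgDC.
Qed.

Lemma cvg_sqrnorm f l : f @ F --> l -> (fun i => `|f i| ^+ 2) @ F --> (`|l| ^+ 2 : C).
Proof.
move=> fl; rewrite expr2; under eq_fun do rewrite expr2.
by apply: cvgMC; exact: cvg_norm.
Qed.

End Specialised.

Lemma cvg_conj (I : Type) (F : set_system I) {FF : Filter F} (f : I -> C) (l : C) :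
  f @ F --> l -> (fun i => (f i)^*) @ F --> l^*.
Proof.
move=> /cvgrPdist_lt fl; apply/cvgrPdist_lt => e /fl; apply: filterS => i.
by rewrite -rmorphB norm_conjC.
Qed.

Lemma cvg_ge0 (I : Type) (F : set_system I) {FF : ProperFilter F} (f : I -> C) (l : C) :
  f @ F --> l -> (\forall i \near F, 0 <= f i) -> 0 <= l.
Proof.
move=> fl f0; rewrite ger0_def; apply/eqP.
have nl : (fun i => `|f i|) @ F --> `|l| by exact: cvg_norm.
apply: (cvg_unique _ nl); first exact: norm_hausdorff.
have : f @ F --> l by [].
apply: cvg_trans; apply: near_eq_cvg; apply: filterS f0 => i f0.
by rewrite ger0_norm.
Qed.

Lemma cvg_leC (I : Type) (F : set_system I) {FF : ProperFilter F} (f g : I -> C) (l m : C) :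
  f @ F --> l -> g @ F --> m -> (\forall i \near F, f i <= g i) -> l <= m.
Proof.
move=> fl gm fg; rewrite -subr_ge0.
apply: (@cvg_ge0 I F FF (fun i => g i - f i) (m - l)); first exact: cvgB.
by apply: filterS fg => i; rewrite subr_ge0.
Qed.

Lemma cvg_sqz0 (I : Type) (F : set_system I) {FF : Filter F} (f g : I -> C) :
  g @ F --> (0 : C) -> (\forall i \near F, `|f i| <= g i) -> f @ F --> (0 : C).
Proof.
move=> /cvgrPdist_lt g0 fg; apply/cvgrPdist_lt => e e0.
have {}g0 := g0 e e0; near=> i.
rewrite sub0r normrN.
have gi : `|0 - g i| < e by near: i.
apply: le_lt_trans gi; rewrite sub0r normrN.
have h : `|f i| <= g i by near: i.
by apply: (le_trans h); rewrite real_ler_norm// ger0_real// (le_trans _ h).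
Unshelve. all: by end_near. Qed.

Lemma cvg_lim0 (I : Type) (F : set_system I) {FF : Filter F} (f g : I -> C) (l : C) :
  g @ F --> (l : C) -> (fun i => f i - g i) @ F --> (0 : C) -> f @ F --> (l : C).
Proof.
move=> gl fg; have -> : f = (fun i => (f i - g i) + g i).
  by apply/funext => i; rewrite subrK.
by rewrite -[l]add0r; exact: cvgD.
Qed.

Lemma cvg_lim0r (I : Type) (F : set_system I) {FF : Filter F} (f g : I -> C) (l : C) :
  g @ F --> (l : C) -> (fun i => g i - f i) @ F --> (0 : C) -> f @ F --> (l : C).
Proof.
move=> gl fg; apply: (cvg_lim0 gl).
by rewrite -oppr0; under eq_fun do rewrite -opprB; exact: cvgN.
Qed.

Lemma cvg_uniqC (I : Type) (F : set_system I) {FF : ProperFilter F} (f : I -> C) (l m : C) :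
  f @ F --> l -> f @ F --> m -> l = m.
Proof. by move=> fl fm; exact: (cvg_unique _ fl fm). Qed.

Lemma le_sqr_add1 (t : C) : 0 <= t -> t <= (1 + t) ^+ 2.
Proof.
move=> t0; rewrite -subr_ge0; have -> : (1 + t) ^+ 2 - t = 1 + t + t ^+ 2 by ring.
by rewrite !addr_ge0// exprn_ge0.
Qed.

Lemma sqr_norm_add_le (x y : C) : `|x + y| ^+ 2 <= (`|x| ^+ 2 + `|y| ^+ 2) *+ 2.
Proof.
rewrite -subr_ge0; have -> : (`|x| ^+ 2 + `|y| ^+ 2) *+ 2 - `|x + y| ^+ 2 = `|x - y| ^+ 2.
  by rewrite !normCK !rmorphD !rmorphN /=; ring.
exact: exprn_ge0.
Qed.

(** A quadratic form in a complex variable stays nonnegative only if its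
    discriminant is not positive: Cauchy-Schwarz for any semi-inner product. *)
Lemma cauchy_schwarz_num (a b d : C) : 0 <= d ->
  (forall c : C, 0 <= a - c^* * b - c * b^* + `|c| ^+ 2 * d) ->
  `|b| ^+ 2 <= a * d.
Proof.
move=> d0 h.
have [d00|dn0] := eqVneq d 0; last first.
  have dp : 0 < d by rewrite lt_def dn0.
  have := h (b / d); rewrite rmorphM fmorphV /= (geC0_conj d0) normf_div.
  rewrite (ger0_norm d0) expr_div_n -mulrA.
  have e1 : b^* * (d^-1 * b) = `|b| ^+ 2 / d by rewrite normCKC mulrCA mulrC.
  have e2 : b / d * b^* = `|b| ^+ 2 / d by rewrite normCK mulrAC.
  rewrite [b^* * _]e1 [b / d * _]e2.
  have -> : `|b| ^+ 2 / d ^+ 2 * d = `|b| ^+ 2 / d.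
    by rewrite expr2 invfM mulrA divfK.
  by rewrite subrK subr_ge0 ler_pdivrMr.
subst d; rewrite mulr0.
have a0 : 0 <= a by have := h 0; rewrite conjC0 normr0 !mul0r !subr0 expr0n mul0r addr0.
have {}h (t : C) : 0 <= t -> 0 <= a - t * `|b| ^+ 2 *+ 2.
  move=> t0; have := h (t * b); rewrite mulr0 addr0 rmorphM /= (geC0_conj t0).
  by rewrite -[t * b^* * b]mulrA -normCKC -[t * b * _]mulrA -normCK -addrA -opprD -mulr2n.
have [->|bn0] := eqVneq b 0; first by rewrite normr0 expr0n.
have bp : 0 < `|b| ^+ 2 by rewrite exprn_gt0// normr_gt0.
exfalso; have [a00|an0] := eqVneq a 0.
  have := h 1 ler01; rewrite a00 mul1r sub0r oppr_ge0 => h1.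
  by move: h1; rewrite pmulrn_rle0// => /(lt_le_trans bp); rewrite ltxx.
have q0 : 0 <= a / `|b| ^+ 2 by rewrite divr_ge0// ltW.
have := h _ q0; rewrite divfK ?gt_eqF// mulr2n opprD addrA subrr sub0r oppr_ge0 => a1.
by move: an0; rewrite eq_le a0 a1.
Qed.

End FieldLimits.

Section ComplexLimits.
Variable R : realType.
Local Notation C := (Cplx R).

Lemma toC_norm (x : R) : `|toC x| = toC `|x|.
Proof. by rewrite /toC normc_def /= expr0n /= addr0 sqrtr_sqr. Qed.

Lemma toC_le (x y : R) : (toC x <= toC y) = (x <= y).
Proof. exact: lecR. Qed.

Lemma toC_lt (x y : R) : (toC x < toC y) = (x < y).
Proof. exact: ltcR. Qed.

Lemma toCD (x y : R) : toC (x + y) = toC x + toC y.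
Proof. exact: (rmorphD (real_complex R)). Qed.

Lemma toCM (x y : R) : toC (x * y) = toC x * toC y.
Proof. exact: (rmorphM (real_complex R)). Qed.

Lemma toCX (x : R) n : toC (x ^+ n) = toC x ^+ n.
Proof. exact: (rmorphXn (real_complex R)). Qed.

Lemma toCB (x y : R) : toC (x - y) = toC x - toC y.
Proof. exact: (rmorphB (real_complex R)). Qed.

Lemma toC1 : toC (1 : R) = 1. Proof. by []. Qed.
Lemma toC0 : toC (0 : R) = 0. Proof. by []. Qed.

Lemma toCK (z : C) : 0 <= z -> toC (complex.Re z) = z.
Proof. by move=> z0; rewrite /toC RRe_real// ger0_real. Qed.

Lemma toC_conj (x : R) : (toC x)^* = toC x.
Proof. by apply: conj_Creal; rewrite /toC complex_real. Qed.

Lemma Cdecomp (z : C) : z = toC (complex.Re z) + 'i * toC (complex.Im z).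
Proof. by rewrite {1}[z]complexE complexiE. Qed.

Lemma ReBC (x y : C) : complex.Re (x - y) = complex.Re x - complex.Re y.
Proof. by case: x y => [a b] [c d]. Qed.

Lemma Re_leC (x y : C) : x <= y -> complex.Re x <= complex.Re y.
Proof. by rewrite lecE => /andP[]. Qed.

Lemma toCRe (z : C) : toC (complex.Re z) = 'Re z.
Proof. exact: complexRe. Qed.

Lemma addJ_Re (z : C) : z + z^* = toC (2 * complex.Re z).
Proof.
have -> : toC (2 * complex.Re z) = 2 * toC (complex.Re z) by rewrite toCM /toC rmorph_nat.
by rewrite toCRe ReE mulrC divfK// pnatr_eq0.
Qed.

Lemma Re_ge0 (z : C) : 0 <= z -> 0 <= complex.Re z.
Proof. exact: Re_leC. Qed.

Lemma Re_norm_le (z : C) : complex.Re z <= complex.Re `|z|.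
Proof.
have := normc_ge_Re z; rewrite lecE => /andP[_ /= h].
exact: le_trans (ler_norm _) h.
Qed.

Lemma cvg_toC (I : Type) (F : set_system I) {FF : Filter F} (f : I -> R) (l : R) :
  f @ F --> l -> (fun i => toC (f i)) @ F --> toC l.
Proof.
move=> /cvgrPdist_lt fl; apply/cvgrPdist_lt => e e0.
have e0' : 0 < complex.Re e by have := e0; rewrite ltcE => /andP[].
apply: filterS (fl _ e0') => i.
by rewrite -toCB toC_norm -(toCK (ltW e0)) toC_lt.
Qed.

Lemma harmonicC : (fun n : nat => n.+1%:R^-1 : C) @ \oo --> (0 : C).
Proof.
have e : (fun n => toC (n.+1%:R^-1 : R)) = (fun n : nat => n.+1%:R^-1 : C).
  by apply/funext => n; rewrite /toC fmorphV/= rmorph_nat.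
by rewrite -e -[X in _ --> X]toC0; apply: cvg_toC; exact: cvg_harmonic.
Qed.

Lemma cvg_geoC (r : C) : 0 <= r -> r < 1 -> (fun n => r ^+ n) @ \oo --> (0 : C).
Proof.
move=> r0 r1.
have h : (fun n => complex.Re r ^+ n) @ \oo --> (0 : R).
  apply: cvg_expr; rewrite ger0_norm ?Re_ge0//.
  by have := r1; rewrite ltcE => /andP[].
have -> : (fun n => r ^+ n) = (fun n => toC (complex.Re r ^+ n)).
  by apply/funext => n; rewrite toCX toCK.
by rewrite -[X in _ --> X]toC0; exact: cvg_toC.
Qed.

(** Compactness of squares.  Completeness of the function spaces, separation from
    cones and limits of kernels all rest on it. *)
Lemma ultra_cvg (I : Type) (U : set_system I) {UU : UltraFilter U} (f : I -> C)
    (M : C) : (\forall i \near U, `|f i| <= M) -> exists l : C, f @ U --> l.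
Proof.
move=> fM.
have ultra_img (g : I -> R) : UltraFilter (g @ U).
  split=> [|H HF sub]; first exact: fmap_proper_filter.
  apply/seteqP; split=> [A HA|]; last exact: sub.
  have [//|nUA] := in_ultra_setVsetC (g @^-1` A) UU.
  have : H (~` A) by exact: sub.
  by move/(filterI HA); rewrite setICr => /filter_not_empty.
have real_cvg (g : I -> R) (m : R) : (\forall i \near U, `|g i| <= m) ->
    exists l : R, g @ U --> l.
  move=> gm.
  have := @segment_compact R (- m) m; rewrite compact_ultra => /(_ (g @ U) (ultra_img g)).
  have h : (g @ U) `[- m, m]%classic.
    by rewrite /= ; apply: filterS gm => i; rewrite /= in_itv /= ler_norml.
  by case/(_ h) => l [_ gl]; exists l.
have M0 : 0 <= M.
  by have [i iM] := filter_ex fM; exact: le_trans iM.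
have [|a ga] := real_cvg (fun i => complex.Re (f i)) (complex.Re M).
  apply: filterS fM => i; rewrite -{1}(toCK M0).
  have := normc_ge_Re (f i) => h1 h2; have := le_trans h1 h2.
  by rewrite -lecR.
have [|b gb] := real_cvg (fun i => complex.Im (f i)) (complex.Re M).
  apply: filterS fM => i; rewrite -{1}(toCK M0).
  have := normc_ge_Re (f i * 'i) => h1 h2.
  rewrite -lecR; apply: le_trans h2; apply: le_trans (le_trans h1 _).
    by rewrite -complexiE ReiNIm normrN.
  by rewrite normrM normCi mulr1.
exists (toC a + 'i * toC b).
have -> : f = (fun i => toC (complex.Re (f i)) + 'i * toC (complex.Im (f i))).
  by apply/funext => i; rewrite -Cdecomp.
by apply: cvgD; [exact: cvg_toC|apply: cvgM; [exact: cvg_cst|exact: cvg_toC]].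
Unshelve. all: end_near. Qed.

End ComplexLimits.

(** * Reproducing kernel Hilbert spaces *)
Section Combinations.
Variables (C : numClosedFieldType) (S : Type).
Implicit Types (k : S -> S -> C) (f g : S -> C) (l m : seq (C * S)).

(** A list [l] of pairs [(c, s)] stands for the combination of the kernel
    functions at the points [s] with coefficients [c]; [ev f l] is the inner
    product of [f] with it, and [sform k] is the Gram form of such combinations. *)
Definition ev f l : C := \sum_(p <- l) (p.1)^* * f p.2.

Definition comb k l (t : S) : C := \sum_(p <- l) p.1 * k t p.2.

Definition sform k l m : C := ev (comb k l) m.

Definition kpos k := forall l, 0 <= sform k l l.

Definition scomb (c : C) l := [seq (c * p.1, p.2) | p <- l].

Lemma ev_nil f : ev f [::] = 0. Proof. exact: big_nil. Qed.

Lemma ev_cat f l m : ev f (l ++ m) = ev f l + ev f m.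
Proof. exact: big_cat. Qed.

Lemma ev_scale f c l : ev f (scomb c l) = c^* * ev f l.
Proof.
by rewrite /ev big_map mulr_sumr; apply: eq_bigr => p _; rewrite rmorphM mulrA.
Qed.

Lemma ev_single f c s : ev f [:: (c, s)] = c^* * f s.
Proof. exact: big_seq1. Qed.

Lemma evP c f g l : ev (c *: f + g) l = c * ev f l + ev g l.
Proof.
rewrite /ev mulr_sumr -big_split; apply: eq_bigr => p _ /=.
by rewrite mulrDr mulrCA.
Qed.

Lemma evD f g l : ev (f + g) l = ev f l + ev g l.
Proof. by rewrite -[f]scale1r evP mul1r scale1r. Qed.

Lemma ev0 l : ev 0 l = 0.
Proof. by rewrite /ev big1// => p _; rewrite mulr0. Qed.

Lemma evZ c f l : ev (c *: f) l = c * ev f l.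
Proof. by rewrite -[_ *: f]addr0 evP ev0 addr0. Qed.

Lemma evN f l : ev (- f) l = - ev f l.
Proof. by rewrite -scaleN1r evZ mulN1r. Qed.

Lemma evB f g l : ev (f - g) l = ev f l - ev g l.
Proof. by rewrite evD evN. Qed.

Lemma comb_cat k l m : comb k (l ++ m) = comb k l + comb k m.
Proof. by apply/funext => t; exact: big_cat. Qed.

Lemma comb_scale k c l : comb k (scomb c l) = c *: comb k l.
Proof.
apply/funext => t; rewrite /comb big_map /= [RHS]mulr_sumr.
by apply: eq_bigr => p _; rewrite mulrA.
Qed.

Lemma sform_catr k l m n : sform k l (m ++ n) = sform k l m + sform k l n.
Proof. exact: ev_cat. Qed.

Lemma sform_catl k l m n : sform k (l ++ m) n = sform k l n + sform k m n.
Proof. by rewrite /sform comb_cat evD. Qed.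

Lemma sform_scaler k l c m : sform k l (scomb c m) = c^* * sform k l m.
Proof. exact: ev_scale. Qed.

Lemma sform_scalel k l c m : sform k (scomb c l) m = c * sform k l m.
Proof. by rewrite /sform comb_scale evZ. Qed.

Section Positive.
Variable k : S -> S -> C.
Hypothesis kp : kpos k.

(** Polarisation: the values of the form at [l + m] and at [l + i m] are real. *)
Lemma sform_herm l m : sform k l m = (sform k m l)^*.
Proof.
have real_form c : sform k (l ++ scomb c m) (l ++ scomb c m)
    = (sform k (l ++ scomb c m) (l ++ scomb c m))^*.
  by rewrite geC0_conj.
have hl : (sform k l l)^* = sform k l l by rewrite geC0_conj.
have hm : (sform k m m)^* = sform k m m by rewrite geC0_conj.
have h c : c^* * sform k l m + c * sform k m l
    = c * (sform k l m)^* + c^* * (sform k m l)^*.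
  have := real_form c.
  rewrite !(sform_catl, sform_catr, sform_scalel, sform_scaler).
  rewrite !(rmorphD, rmorphM) /= !conjCK hl hm.
  set x := sform k l m; set y := sform k m l => e.
  apply: (@addrI _ (sform k l l + c * (c^* * sform k m m))).
  rewrite -[LHS]addrACA; apply: etrans (etrans e _); first by ring.
  by ring.
have h1 := h 1; have := h 'i.
rewrite conjCi !mulNr; rewrite !conjC1 !mul1r in h1.
set x := sform k l m in h1 *; set y := sform k m l in h1 *.
move=> h2.
have {}h2 : y - x = x^* - y^*.
  apply: (mulfI (neq0Ci C)); rewrite !mulrBr -[LHS]addrC -[RHS]addrC.
  by rewrite h2 addrC.
have e : x *+ 2 = y^* *+ 2.
  have -> : x *+ 2 = (x + y) - (y - x) by ring.
  by rewrite h1 h2; ring.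
by move/eqP: e; rewrite eqrMn2r ?orFb// => /eqP.
Qed.

Lemma sform_cs l m : `|sform k l m| ^+ 2 <= sform k l l * sform k m m.
Proof.
apply: cauchy_schwarz_num => // c.
have := kp (l ++ scomb (- c) m).
rewrite !(sform_catl, sform_catr, sform_scalel, sform_scaler).
rewrite [sform k m l]sform_herm normCK rmorphN.
by congr (0 <= _); ring.
Qed.

End Positive.
End Combinations.

Section Riesz.
Variables (R : realType) (S : Type).
Local Notation C := (Cplx R).
Variable k : S -> S -> C.
Hypothesis kp : kpos k.
Implicit Types (f g : S -> C) (l m : seq (C * S)).

(** These are the functions of the completion: pairing with [f] is a bounded
    functional on the combinations. *)
Definition kbounded f :=
  exists2 M : C, 0 <= M & forall l, `|ev f l| ^+ 2 <= M * sform k l l.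

(** The representation theorem: minimising the distance functional
    [|| J l ||^2 - 2 Re f(l)] over the combinations [l] gives vectors [J l]
    that represent [f] up to an arbitrarily small error. *)
Lemma riesz_approx f : kbounded f -> forall e : C, 0 < e ->
  exists l, forall m, `|ev f m - sform k l m| ^+ 2 <= e * sform k m m.
Proof.
case=> M M0 fM e e0.
(* The squared norm of [f] minus the squared distance from [f] to [J l]. *)
pose EC l : C := ev f l + (ev f l)^* - sform k l l.
pose E l : R := complex.Re (EC l).
have EE l : toC (E l) = EC l.
  have real1 : EC l \is Num.real.
    apply: rpredB; last exact: ger0_real.
    by rewrite CrealE rmorphD /= conjCK addrC.
  by rewrite /E /toC RRe_real.
have Eub l : EC l <= M.
  rewrite /EC lerBlDr addJ_Re.
  have h1 : toC (complex.Re (ev f l)) <= `|ev f l|.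
    by rewrite -(toCK (normr_ge0 _)) toC_le; exact: Re_norm_le.
  have -> : toC (2 * complex.Re (ev f l)) = toC (complex.Re (ev f l)) *+ 2.
    by rewrite mulr_natl mulr2n toCD -mulr2n.
  apply: (@le_trans _ _ (`|ev f l| *+ 2)); first by rewrite lerMn2r.
  rewrite -(@ler_pXn2r _ 2%N)// ?nnegrE ?mulrn_wge0 ?addr_ge0// .
  rewrite -mulr_natl exprMn -subr_ge0.
  have h2 := fM l; rewrite -subr_ge0 in h2.
  have -> : (M + sform k l l) ^+ 2 - 2 ^+ 2 * `|ev f l| ^+ 2 =
    4 * (M * sform k l l - `|ev f l| ^+ 2) + (M - sform k l l) ^+ 2 by ring.
  apply: addr_ge0; first by apply: mulr_ge0.
  rewrite real_exprn_even_ge0//; apply: rpredB; exact: ger0_real.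
have hs : has_sup [set E l | l in setT].
  split; first by exists (E [::]), [::].
  exists (complex.Re M) => _ [l _ <-].
  by rewrite -toC_le EE toCK.
have e0' : 0 < complex.Re e by have := e0; rewrite ltcE => /andP[].
have [_ [l _ <-] lsup] := sup_adherent e0' hs.
exists l => m.
have lmax m' : EC m' <= EC l + e.
  rewrite -EE -EE -(toCK (ltW e0)) -toCD toC_le.
  have : E m' <= sup [set E l | l in setT].
    by apply: ub_le_sup; [case: hs|exists m'].
  by move/le_trans; apply; rewrite -lerBlDr ltW.
apply: cauchy_schwarz_num => // c.
have := lmax (l ++ scomb c m).
rewrite -subr_ge0 /EC !(ev_cat, ev_scale).
rewrite !(sform_catl, sform_catr, sform_scalel, sform_scaler).
rewrite [sform k m l](sform_herm kp) normCK !(rmorphD, rmorphM, rmorphB) /= !conjCK.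
by congr (0 <= _); ring.
Qed.

Lemma kbounded_comb l : kbounded (comb k l).
Proof. by exists (sform k l l) => // m; exact: sform_cs. Qed.

Lemma kbounded_lin c f g : kbounded f -> kbounded g -> kbounded (c *: f + g).
Proof.
case=> M M0 fM [N N0 gN].
exists ((`|c| ^+ 2 * M + N) *+ 2) => [|l].
  by rewrite mulrn_wge0// addr_ge0// mulr_ge0// exprn_ge0.
rewrite evP.
apply: (le_trans (sqr_norm_add_le _ _)).
rewrite mulrnAl lerMn2r orFb mulrDl normrM exprMn -[_ * M * _]mulrA.
by rewrite lerD// ler_wpM2l// exprn_ge0.
Qed.

End Riesz.

(** The positivity proof is bundled so that the function space can be a type
    depending on the kernel alone. *)
Record pkernel (C : numClosedFieldType) (S : Type) :=
  PKernel { pk_fun :> S -> S -> C; pkP : kpos pk_fun }.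

Section RKHStype.
Variables (R : realType) (S : Type) (k : pkernel (Cplx R) S).
Local Notation C := (Cplx R).

Definition rk_pred : {pred S -> C} := [pred f | `[< kbounded k f >]].

Lemma rk_submod : submod_closed rk_pred.
Proof.
split=> [|c f g /asboolP hf /asboolP hg]; apply/asboolP.
  by exists 0 => // l; rewrite ev0 normr0 expr0n mul0r.
exact: kbounded_lin.
Qed.

Record rkhs := MkRkhs { rk_fun :> S -> C; rk_mem : rk_fun \in rk_pred }.

HB.instance Definition _ := [isSub for rk_fun].
HB.instance Definition _ := [Choice of rkhs by <:].
HB.instance Definition _ :=
  GRing.isSubmodClosed.Build C (S -> C) rk_pred rk_submod.
HB.instance Definition _ := [SubChoice_isSubZmodule of rkhs by <:].
HB.instance Definition _ := [SubZmodule_isSubLmodule of rkhs by <:].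

Lemma rk_bounded (f : rkhs) : kbounded k f. Proof. by have /asboolP := rk_mem f. Qed.

Lemma rkP (f g : rkhs) : (forall s, f s = g s) -> f = g.
Proof. by move=> h; apply/val_inj/funext. Qed.

Lemma rk_evP c (f g : rkhs) l : ev (c *: f + g) l = c * ev f l + ev g l.
Proof. exact: evP. Qed.

Lemma Jmem l : comb k l \in rk_pred.
Proof. by apply/asboolP; apply: kbounded_comb; exact: pkP. Qed.

Definition rkJ l : rkhs := MkRkhs (Jmem l).

End RKHStype.

Section RKHSinner.
Variables (R : realType) (S : Type) (k : pkernel (Cplx R) S).
Local Notation C := (Cplx R).
Local Notation H := (rkhs k).
Let kp : kpos k := @pkP _ _ k.
Implicit Types (f g : H) (l m : seq (C * S)).

Lemma approx_ex f (n : nat) : exists l, forall m,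
  `|ev f m - sform k l m| ^+ 2 <= n.+1%:R^-1 * sform k m m.
Proof.
apply: (riesz_approx kp (rk_bounded f)).
by rewrite invr_gt0 ltr0n.
Qed.

Definition approx f n := projT1 (cid (approx_ex f n)).

Lemma approxP f n m :
  `|ev f m - sform k (approx f n) m| ^+ 2 <= n.+1%:R^-1 * sform k m m.
Proof. exact: (projT2 (cid (approx_ex f n))). Qed.

Lemma sqr_le_self (a b : C) : 0 <= a -> 0 <= b -> a ^+ 2 <= b * a -> a <= b.
Proof.
move=> a0 b0; have [->//|an] := eqVneq a 0.
by rewrite expr2 ler_pM2r// lt_def an.
Qed.

Lemma approx_bound f : exists2 M : C, 0 <= M &
  forall n, sform k (approx f n) (approx f n) <= M.
Proof.
have [M M0 fM] := rk_bounded f.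
exists ((1 + M) *+ 2) => [|n]; first by rewrite mulrn_wge0// addr_ge0.
set a := approx f n; set s := sform k a a.
have s0 : 0 <= s by exact: kp.
apply: sqr_le_self => //; first by rewrite mulrn_wge0// addr_ge0.
have h1 := approxP f n a; have h2 := fM a.
have e : s = ev f a - (ev f a - s) by rewrite opprB addrC subrK.
rewrite -(ger0_norm s0) {1}e.
apply: (le_trans (sqr_norm_add_le _ _)); rewrite normrN mulrnAl lerMn2r orFb addrC ger0_norm// mulrDl.
apply: lerD h2; apply: (le_trans h1); rewrite ler_wpM2r//.
by rewrite invf_le1 ?ltr0n// ler1n.
Qed.

Lemma ultra_ex : exists U : set_system nat, UltraFilter U /\ \oo `<=` U.
Proof. exact: ultraFilterLemma. Qed.

(** A fixed free ultrafilter makes taking limits of bounded sequences linear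
    without passing to subsequences. *)
Definition UN : set_system nat := projT1 (cid ultra_ex).

Lemma UN_ultra : UltraFilter UN.
Proof. exact: (projT2 (cid ultra_ex)).1. Qed.
Local Existing Instance UN_ultra.

Lemma UN_oo : \oo `<=` UN.
Proof. exact: (projT2 (cid ultra_ex)).2. Qed.

Lemma UN_cvg (u : nat -> C) (z : C) : u @ \oo --> z -> u @ UN --> z.
Proof. by move=> uz A /uz; exact: UN_oo. Qed.

Lemma ev_approx_cvg f g : exists z : C, (fun n => ev f (approx g n)) @ UN --> z.
Proof.
have [M M0 fM] := rk_bounded f; have [N N0 gN] := approx_bound g.
apply: (@ultra_cvg _ _ _ _ _ (1 + M * N)); apply: nearW => n.
set t := `|ev f _|.
have h : t ^+ 2 <= M * N by apply: (le_trans (fM _)); rewrite ler_wpM2l.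
have MN : 0 <= M * N by rewrite mulr_ge0.
rewrite -(@ler_pXn2r _ 2%N)// ?nnegrE ?addr_ge0 ?normr_ge0//.
by apply: (le_trans h); exact: le_sqr_add1.
Qed.

(** The inner product of [f] with [g] is the limit of its inner products with
    combinations approximating [g]. *)
Definition rk_ip f g : C := projT1 (cid (ev_approx_cvg f g)).

Lemma rk_ipP f g : (fun n => ev f (approx g n)) @ UN --> rk_ip f g.
Proof. exact: (projT2 (cid (ev_approx_cvg f g))). Qed.

Arguments rk_ipP : clear implicits.

Lemma sq_cvg0 (u : nat -> C) : (fun n => `|u n| ^+ 2) @ UN --> (0 : C) ->
  u @ UN --> (0 : C).
Proof.
move=> /cvgrPdist_lt h; apply/cvgrPdist_lt => e e0.
have e2 : 0 < e ^+ 2 by rewrite exprn_gt0.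
apply: filterS (h _ e2) => n.
rewrite !sub0r !normrN normrX normr_id => h1.
by rewrite -(@ltr_pXn2r _ 2%N)// ?nnegrE// ltW.
Qed.

Lemma harmonicM (c : C) : (fun n : nat => n.+1%:R^-1 * c) @ UN --> (0 : C).
Proof.
rewrite -[X in _ --> X](mul0r c); apply: UN_cvg.
by apply: cvgM; [exact: harmonicC|exact: cvg_cst].
Qed.

Arguments harmonicM : clear implicits.

(** Along bounded combinations the approximants of [f] may replace [f]. *)
Lemma approx_cvg0 f (w : nat -> seq (C * S)) (N : C) :
  (forall n, sform k (w n) (w n) <= N) ->
  (fun n => ev f (w n) - sform k (approx f n) (w n)) @ UN --> (0 : C).
Proof.
move=> wN; apply: sq_cvg0; apply: (cvg_sqz0 (harmonicM N)).
apply: nearW => n; rewrite normrX normr_id.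
apply: (le_trans (approxP _ _ _)); by rewrite ler_wpM2l.
Qed.

Arguments approx_cvg0 : clear implicits.

Lemma rk_ipC f g : rk_ip f g = (rk_ip g f)^*.
Proof.
have [M M0 fM] := approx_bound f; have [N N0 gN] := approx_bound g.
have h1 : (fun n => sform k (approx f n) (approx g n)) @ UN --> rk_ip f g.
  apply: (cvg_lim0r (rk_ipP f g)).
  exact: approx_cvg0 f _ _ gN.
have h2 : (fun n => (sform k (approx g n) (approx f n))^*) @ UN --> (rk_ip g f)^*.
  apply: cvg_conj; apply: (cvg_lim0r (rk_ipP g f)).
  exact: approx_cvg0 g _ _ fM.
apply: (cvg_uniqC h1).
by under eq_fun do rewrite (sform_herm kp).
Qed.

Lemma rk_ip_linl (c : C) f f' g :
  rk_ip (c *: f + f') g = c * rk_ip f g + rk_ip f' g.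
Proof.
apply: (cvg_uniqC (rk_ipP _ _)).
under eq_fun do rewrite rk_evP.
apply: cvgD (rk_ipP _ _); apply: cvgM (rk_ipP _ _); exact: cvg_cst.
Qed.

Lemma rk_ipJ f l : rk_ip f (rkJ k l) = ev f l.
Proof.
apply: (cvg_uniqC (rk_ipP _ _)).
apply: (cvg_lim0 (g := fun=> ev f l)); first exact: cvg_cst.
have [M M0 fM] := rk_bounded f.
apply: sq_cvg0; apply: (cvg_sqz0 (harmonicM M)).
apply: nearW => n; rewrite normrX normr_id.
set a := approx _ n.
have e : ev f a - ev f l = ev f (a ++ scomb (-1) l).
  by rewrite ev_cat ev_scale rmorphN /= conjC1 mulN1r.
rewrite e; apply: (le_trans (fM _)); rewrite mulrC ler_wpM2r//.
set d := a ++ _; apply: sqr_le_self => //.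
have := approxP (rkJ k l) n d; rewrite -/a.
have -> : ev (rkJ k l) d - sform k a d = - sform k d d.
  rewrite {2}/d sform_catl sform_scalel mulN1r opprD opprK addrC.
  by rewrite /sform.
by rewrite normrN ger0_norm.
Qed.

Lemma rk_ip_cvg f : (fun n => sform k (approx f n) (approx f n)) @ UN --> rk_ip f f.
Proof.
have [M M0 fM] := approx_bound f.
by apply: (cvg_lim0r (rk_ipP f f)); exact: approx_cvg0 f _ _ fM.
Qed.

Arguments rk_ip_cvg : clear implicits.

Lemma rk_ip_ge0 f : 0 <= rk_ip f f.
Proof. by apply: (cvg_ge0 (rk_ip_cvg f)); apply: nearW => n; exact: kp. Qed.

Lemma rk_ev_bound f m : `|ev f m| ^+ 2 <= rk_ip f f * sform k m m.
Proof.
have h1 : (fun n => sform k (approx f n) m) @ UN --> ev f m.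
  apply: (cvg_lim0r (g := fun=> ev f m)); first exact: cvg_cst.
  exact: approx_cvg0 f (fun=> m) _ (fun=> lexx _).
have h2 : (fun n => `|sform k (approx f n) m| ^+ 2) @ UN --> `|ev f m| ^+ 2.
  by rewrite expr2; under eq_fun do rewrite expr2; apply: cvgM; apply: cvg_norm.
apply: (cvg_leC h2 (g := fun n => sform k (approx f n) (approx f n) * sform k m m)).
  by apply: cvgM (rk_ip_cvg f) _; exact: cvg_cst.
by apply: nearW => n; exact: sform_cs.
Qed.

Lemma rk_ip_eq0 f : rk_ip f f = 0 -> f = 0.
Proof.
move=> f0; apply: rkP => s.
have := rk_ev_bound f [:: (1, s)]; rewrite f0 mul0r ev_single conjC1 mul1r.
by rewrite -normrX normr_le0 sqrf_eq0 => /eqP.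
Qed.

(** Together with [rk_ev_bound]: the squared norm is the best constant in
    [kbounded]. *)
Lemma rk_ip_le f (M : C) : 0 <= M ->
  (forall l, `|ev f l| ^+ 2 <= M * sform k l l) -> rk_ip f f <= M.
Proof.
move=> M0 fM; apply: sqr_le_self => //; first exact: rk_ip_ge0.
have h2 : (fun n => `|ev f (approx f n)| ^+ 2) @ UN --> rk_ip f f ^+ 2.
  rewrite -(ger0_norm (rk_ip_ge0 f)) expr2; under eq_fun do rewrite expr2.
  by apply: cvgM; apply: cvg_norm; exact: rk_ipP.
apply: (cvg_leC h2 (g := fun n => M * sform k (approx f n) (approx f n))).
  by apply: cvgM (rk_ip_cvg f); exact: cvg_cst.
by apply: nearW => n; exact: fM.
Qed.

Lemma rk_ip0l g : rk_ip 0 g = 0.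
Proof.
have := rk_ip_linl 1 0 0 g; rewrite scaler0 addr0 mul1r => e.
by apply: (@addrI _ (rk_ip 0 g)); rewrite -e addr0.
Qed.

Lemma rk_ipZl c f g : rk_ip (c *: f) g = c * rk_ip f g.
Proof. by rewrite -[c *: f]addr0 rk_ip_linl rk_ip0l addr0. Qed.

Lemma rk_ipDl f g h : rk_ip (f + g) h = rk_ip f h + rk_ip g h.
Proof. by rewrite -[f]scale1r rk_ip_linl mul1r scale1r. Qed.

Lemma rk_ipDr f g h : rk_ip h (f + g) = rk_ip h f + rk_ip h g.
Proof. by rewrite rk_ipC rk_ipDl rmorphD /= -!rk_ipC. Qed.

Lemma rk_cs f g : `|rk_ip f g| ^+ 2 <= rk_ip f f * rk_ip g g.
Proof.
apply: cauchy_schwarz_num => [|c]; first exact: rk_ip_ge0.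
have := rk_ip_ge0 (- c *: g + f).
have Zr a h h' : rk_ip h (a *: h') = a^* * rk_ip h h'.
  by rewrite rk_ipC rk_ipZl rmorphM /= -rk_ipC.
rewrite !(rk_ipDl, rk_ipDr, rk_ipZl, Zr) [rk_ip g f]rk_ipC normCK rmorphN.
move: (rk_ip f f) (rk_ip g g) (rk_ip f g) => a d b.
by congr (0 <= _); ring.
Qed.

Definition rk_norm f : C := sqrtC (rk_ip f f).

Lemma rk_normK f : rk_norm f ^+ 2 = rk_ip f f.
Proof. exact: sqrtCK. Qed.

Lemma rk_norm_ge0 f : 0 <= rk_norm f.
Proof. by rewrite sqrtC_ge0 rk_ip_ge0. Qed.

Lemma rk_normZ (c : C) f : rk_norm (c *: f) = `|c| * rk_norm f.
Proof.
apply/eqP; rewrite -(@eqrXn2 _ 2%N)//; last 2 first.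
- exact: rk_norm_ge0.
- by rewrite mulr_ge0// rk_norm_ge0.
by rewrite exprMn !rk_normK rk_ipZl rk_ipC rk_ipZl rmorphM /= -rk_ipC mulrA -normCK.
Qed.

Lemma rk_normD f g : rk_norm (f + g) <= rk_norm f + rk_norm g.
Proof.
have e : rk_ip (f + g) (f + g) = rk_ip f f + (rk_ip f g + (rk_ip f g)^*) + rk_ip g g.
  rewrite -rk_ipC rk_ipDl !rk_ipDr.
  by move: (rk_ip f f) (rk_ip g g) (rk_ip f g) (rk_ip g f) => a d b c; ring.
rewrite -(@ler_pXn2r _ 2%N)// ?nnegrE ?addr_ge0// ?rk_norm_ge0//.
rewrite [leLHS](etrans (rk_normK _) e) -(rk_normK f) -(rk_normK g) sqrrD.
rewrite lerD2r lerD2l.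
have h : `|rk_ip f g| <= rk_norm f * rk_norm g.
  rewrite -(@ler_pXn2r _ 2%N)// ?nnegrE ?mulr_ge0 ?rk_norm_ge0//.
  by rewrite exprMn !rk_normK; exact: rk_cs.
apply: (@le_trans _ _ (`|rk_ip f g| *+ 2)); last by rewrite lerMn2r.
rewrite mulr2n; apply: le_trans (real_ler_norm _) _.
  by rewrite CrealE rmorphD /= conjCK addrC.
by apply: (le_trans (ler_normD _ _)); rewrite norm_conjC.
Qed.

Lemma rk_norm_eq0 f : rk_norm f = 0 -> f = 0.
Proof. by move=> /eqP; rewrite sqrtC_eq0 => /eqP; exact: rk_ip_eq0. Qed.

End RKHSinner.

Section RKHShilbert.
Variables (R : realType) (S : Type) (k : pkernel (Cplx R) S).
Local Notation C := (Cplx R).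
Local Notation H := (rkhs k).

HB.instance Definition _ := Lmodule_isNormed.Build C H
  (@rk_normD R S k) (@rk_normZ R S k) (@rk_norm_eq0 R S k).

Lemma rk_normE (f : H) : `|f| = rk_norm f. Proof. by []. Qed.

Lemma rk_ev_le (f : H) m : `|ev f m| ^+ 2 <= `|f| ^+ 2 * sform k m m.
Proof. by rewrite rk_normE rk_normK; exact: rk_ev_bound. Qed.

(** A Cauchy filter converges pointwise along any ultrafilter finer than it,
    and the pointwise limit is the limit in norm. *)
Lemma rk_complete (F : set_system H) : ProperFilter F -> cauchy F -> cvg F.
Proof.
move=> FF /cauchyP cF.
have [U [UU FU]] := ultraFilterLemma FF.
have lim_ex (s : S) : exists z : C, (fun f : H => f s) @ U --> z.
  have [f0 hf0] := cF 1 ltr01.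
  have ks0 : 0 <= sform k [:: (1, s)] [:: (1, s)] by exact: pkP.
  apply: (@ultra_cvg _ _ _ _ _ (`|f0 s| + (1 + sform k [:: (1, s)] [:: (1, s)]))).
  have {}hf0 : U (ball f0 1) by exact: FU.
  apply: filterS hf0 => f; rewrite -ball_normE /ball_ /= => h.
  have e : f s = f0 s + (f s - f0 s) by rewrite addrC subrK.
  rewrite {1}e; apply: (le_trans (ler_normD _ _)); rewrite lerD2l.
  have := rk_ev_le (f0 - f) [:: (1, s)]; rewrite ev_single conjC1 mul1r => h2.
  rewrite -(@ler_pXn2r _ 2%N)// ?nnegrE ?addr_ge0// distrC.
  apply: (le_trans h2); set t := sform _ _ _ in ks0 *.
  apply: (@le_trans _ _ t).
    by rewrite ler_piMl// expr_le1// ltW.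
  exact: le_sqr_add1.
pose l s := projT1 (cid (lim_ex s)).
have lP s : (fun f : H => f s) @ U --> l s := projT2 (cid (lim_ex s)).
have evl (m : seq (C * S)) : (fun f : H => ev f m) @ U --> ev l m.
  by apply: cvg_sumC => p; apply: cvgZC; exact: lP.
have close (e : C) : 0 < e -> \forall f \near F, forall m : seq (C * S),
    `|ev l m - ev (f : H) m| ^+ 2 <= e ^+ 2 * sform k m m.
  move=> e0; have [f0 hf0] := cF (e / 2) (divr_gt0 e0 (ltr0Sn _ _)).
  have hF : F (ball f0 (e / 2)) by exact: hf0.
  apply: filterS hF => f hf m.
  have lf : (fun g : H => `|ev g m - ev f m| ^+ 2) @ U --> `|ev l m - ev f m| ^+ 2.
    by apply: cvg_sqrnorm; apply: cvgBC (evl m) _; exact: cvg_cstC.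
  apply: (cvg_leC lf (g := fun=> e ^+ 2 * sform k m m)); first exact: cvg_cstC.
  have hU : U (ball f0 (e / 2)) by exact: FU.
  apply: filterS hU => g hg.
  have -> : ev g m - ev f m = ev (g - f) m by rewrite evB.
  apply: (le_trans (rk_ev_le _ _)); rewrite ler_wpM2r//; first exact: pkP.
  rewrite ler_pXn2r ?nnegrE// ?ltW//.
  move: hf hg; rewrite -!ball_normE /ball_ /= => hf hg.
  have -> : g - f = (f0 - f) - (f0 - g) :> H by rewrite opprB [RHS]addrC addrA subrK.
  by apply: le_lt_trans (ler_normB _ _) _; rewrite (splitr e); exact: ltrD.
have lmem : l \in rk_pred k.
  apply/asboolP; have [f hf] := filter_ex (close 1 ltr01).
  have -> : l = 1 *: (l - f) + f by rewrite scale1r subrK.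
  apply: kbounded_lin; try exact: pkP; last exact: rk_bounded.
  by exists (1 ^+ 2) => [|m]; rewrite ?expr1n// evB (le_trans (hf m))// expr1n.
apply/cvg_ex; exists (MkRkhs lmem); apply/cvgrPdist_le => /= e e0.
apply: filterS (close _ e0) => f hf.
set d : H := (X in `|X|).
have e2 : 0 <= e ^+ 2 by rewrite exprn_ge0// ltW.
have hd : rk_ip d d <= e ^+ 2.
  by apply: rk_ip_le => // m; rewrite evB; exact: hf.
move: hd; rewrite -rk_normK -rk_normE.
by rewrite ler_pXn2r// nnegrE ?normr_ge0// ltW.
Qed.

HB.instance Definition _ := Uniform_isComplete.Build H rk_complete.

Definition rk_dot (f g : H) : C := rk_ip f g.

Lemma rk_dot_bilin : bilinear_for ( *%R : C -> C -> C) ((conjC : C -> C) \; *%R) rk_dot.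
Proof.
split=> [g c f f'|f c g g'] /=; first exact: rk_ip_linl.
by rewrite /rk_dot rk_ipDr rk_ipC rk_ipZl rmorphM /= -rk_ipC.
Qed.

Lemma rk_dot_herm (f g : H) : rk_dot f g = (-1) ^+ false * (rk_dot g f)^*.
Proof. by rewrite expr0 mul1r /rk_dot -rk_ipC. Qed.

Lemma rk_dot_gt0 (f : H) : f != 0 -> 0 < rk_dot f f.
Proof.
move=> f0; rewrite lt_def rk_ip_ge0 andbT; apply: contraNN f0 => /eqP h.
by apply/eqP; exact: rk_ip_eq0.
Qed.

HB.instance Definition _ := bilinear_isBilinear.Build C H H C _ _ rk_dot rk_dot_bilin.
HB.instance Definition _ := isHermitianSesquilinear.Build C H false conjC rk_dot rk_dot_herm.
HB.instance Definition _ := isDotProduct.Build C H rk_dot rk_dot_gt0.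

Definition rk_hilbert : hilbert R :=
  @Hilbert R H rk_dot (fun f => esym (rk_normK f)).

End RKHShilbert.

(** * Divisibility in a semigroupoid *)
Section Order.
Variable G : semigroupoid.
Implicit Types a b c e p q x y : G.
Local Notation mul := (@sg_mul G).

Lemma mulA_l a b c ab abc : mul a b = Some ab -> mul ab c = Some abc ->
  exists2 bc, mul b c = Some bc & mul a bc = Some abc.
Proof.
move=> h1 h2; have := sg_assoc a b c; rewrite /mul3 h1 /= h2.
by case: (mul b c) => //= bc e; exists bc.
Qed.

Lemma mulA_r a b c bc abc : mul b c = Some bc -> mul a bc = Some abc ->
  exists2 ab, mul a b = Some ab & mul ab c = Some abc.
Proof.
move=> h1 h2; have := sg_assoc a b c; rewrite /mul3 h1 /= h2.
by case: (mul a b) => //= ab e; exists ab.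
Qed.

Lemma sg_le_trans x y a : sg_le x y -> sg_le y a -> sg_le x a.
Proof.
move=> [z [w]]; rewrite /mul3; case zx: (mul z x) => [zx'|//] /= zxw.
move=> [z' [w']]; rewrite /mul3; case zy: (mul z' y) => [zy'|//] /= zyw.
have [u zzx uw] := mulA_r zxw zy.
have [t zz tx] := mulA_r zx zzx.
have [v ww vw] := mulA_l uw zyw.
by exists t, v; rewrite /mul3 tx.
Qed.

Lemma sg_le_fac2 p q a : mul p q = Some a -> sg_le q a.
Proof.
move=> pq; have [e [f [_ ff _ af]]] := sg_units a.
by exists p, f; rewrite /mul3 pq.
Qed.

Lemma sg_le_refl a : sg_le a a.
Proof. by have [e [f [_ _ ea _]]] := sg_units a; exact: sg_le_fac2 ea. Qed.

Lemma sg_le_finite a : finite_set [set b | sg_le b a].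
Proof.
apply: (sub_finite_set _ (finite_image (fun t : G * G * G => t.1.2) (sg_finite a))).
by move=> b [z [w h]]; exists (z, b, w).
Qed.

Lemma factors_finite a : finite_set (factors a).
Proof.
have [e [f [_ _ _ af]]] := sg_units a.
apply: (sub_finite_set _ (finite_image (fun t : G * G * G => t.1) (sg_finite a))).
by move=> [p q] /= pq; exists (p, q, f) => //; rewrite /= /mul3 /= pq.
Qed.

(** If [u a v = a] then the powers of [u] stay defined and divide [a], so that
    two of them coincide; a suitable power is then an idempotent, which has no
    proper factors. *)
Lemma idem_of_fix u a v : mul3 mul u a v = Some a -> Ge u.
Proof.
move=> uav.
have step y w : mul3 mul y a w = Some a ->
    exists y' w', mul u y = Some y' /\ mul3 mul y' a w' = Some a.
  move: uav; rewrite /mul3; case ua: (mul u a) => [ua'|//] /= uv.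
  case ya: (mul y a) => [ya'|//] /= yw.
  have [t uya tw] := mulA_r yw ua.
  have [y' uy y'a] := mulA_r ya uya.
  have [w' ww tw'] := mulA_l tw uv.
  by exists y', w'; rewrite y'a.
(* The power of [u] with exponent [n.+1]. *)
pose pw n := iter n (obind (mul u)) (Some u).
have pwS n : pw n.+1 = obind (mul u) (pw n) by [].
have pwP n : exists y w, pw n = Some y /\ mul3 mul y a w = Some a.
  elim: n => [|n [y [w [yn yw]]]]; first by exists u, v.
  have [y' [w' [uy y'w]]] := step _ _ yw.
  by exists y', w'; rewrite pwS yn.
pose y n := projT1 (cid (pwP n)).
have yE n : pw n = Some (y n).
  by have [w []] := projT2 (cid (pwP n)).
have yS n : mul u (y n) = Some (y n.+1) by rewrite -yE pwS yE.
have yD i j : mul (y i) (y j) = Some (y (i + j).+1).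
  elim: i => [|i IH].
    have -> : y 0%N = u by apply: Some_inj; rewrite -yE.
    by rewrite add0n yS.
  have [t ut] := mulA_r IH (yS _); rewrite yS in ut.
  by case: ut => <-.
have [i [j [ij yij]]] : exists i j, (i < j)%N /\ y i = y j.
  have yfin : finite_set [set y n | n in setT].
    apply: (sub_finite_set _ (finite_image (fun t : G * G * G => t.1.1) (sg_finite a))).
    move=> _ [n _ <-]; have [w [_ h]] := projT2 (cid (pwP n)).
    by exists (y n, a, w).
  pose fs := fset_set [set y n | n in setT].
  have : ~~ uniq [seq y n | n <- iota 0 #|` fs|.+1].
    apply/negP => u1.
    have sub : {subset [seq y n | n <- iota 0 #|` fs|.+1] <= fs}.
      by move=> _ /mapP[n _ ->]; rewrite in_fset_set// inE; exists n.
    by have := uniq_leq_size u1 sub; rewrite size_map size_iota ltnn.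
  move=> /(uniqPn u)[i [j [ij]]]; rewrite size_map size_iota => jn.
  rewrite !(nth_map 0%N) ?size_iota ?(ltn_trans ij)// !nth_iota ?(ltn_trans ij)//.
  by rewrite !add0n => e; exists i, j.
have yper m : y (i + m)%N = y (j + m)%N.
  elim: m => [|m IH]; first by rewrite !addn0.
  by apply: Some_inj; rewrite !addnS -!yS IH.
have d0 : (0 < j - i)%N by rewrite subn_gt0.
have yperk n r : (i <= n)%N -> y (n + r * (j - i))%N = y n.
  move=> ni; elim: r => [|r IH]; first by rewrite addn0.
  rewrite mulSn -{1}(subnKC ni) -IH -{2}(subnKC ni).
  have -> : (i + (n - i) + (j - i + r * (j - i)) = j + (n - i + r * (j - i)))%N.
    by rewrite addnACA (subnKC (ltnW ij)).
  by rewrite -yper addnA.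
(* From [i] on the powers have period [j - i]; the exponent [n.+1] is a multiple
   of the period, which makes the power equal to its square. *)
pose n := (i.+1 * (j - i)).-1.
have nS : n.+1 = (i.+1 * (j - i))%N by rewrite prednK// muln_gt0.
have ni : (i <= n)%N by rewrite -ltnS nS leq_pmulr.
have yid : Ge (y n).
  apply: (@sg_idem G); rewrite yD -addnS nS yperk//.
case: n nS ni yid => [|n'] nS ni yid.
  by have <- : y 0%N = u by apply: Some_inj; rewrite -yE.
by have [->] := sg_noinv (yS n') yid.
Qed.

Lemma idem_of_lfix p x : mul p x = Some x -> Ge p.
Proof.
have [e [f [_ _ _ af]]] := sg_units x.
by move=> px; apply: (@idem_of_fix p x f); rewrite /mul3 px.
Qed.

Lemma idem_mull e x y : Ge e -> mul e x = Some y -> y = x.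
Proof. by case=> h _; exact: h. Qed.

Lemma idem_mulr e x y : Ge e -> mul x e = Some y -> y = x.
Proof. by case=> _ h; exact: h. Qed.

Lemma left_unit_uniq e e' x : Ge e -> Ge e' -> mul e x = Some x -> mul e' x = Some x ->
  e = e'.
Proof.
move=> he he' ex e'x; have [t ee' _] := mulA_r e'x ex.
by rewrite -(idem_mulr he' ee') (idem_mull he ee').
Qed.

Lemma right_unit_uniq e e' x : Ge e -> Ge e' -> mul x e = Some x -> mul x e' = Some x ->
  e = e'.
Proof.
move=> he he' ex e'x; have [t ee' _] := mulA_l ex e'x.
by rewrite -(idem_mulr he' ee') (idem_mull he ee').
Qed.

Lemma idem_sq e : Ge e -> mul e e = Some e.
Proof.
move=> he; have [f [g [hf _ fe _]]] := sg_units e.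
by have h := idem_mulr he fe; rewrite -h in fe.
Qed.

Definition height x : nat := #|` fset_set [set q | exists p, mul p q = Some x]|.

Lemma rfactors_finite x : finite_set [set q | exists p, mul p q = Some x].
Proof.
apply: (sub_finite_set _ (sg_le_finite x)) => q [p]; exact: sg_le_fac2.
Qed.

(** Right factors by non-idempotents are strictly lower: this is the measure
    for all the recursions over the semigroupoid. *)
Lemma height_lt p q x : mul p q = Some x -> q <> x -> (height q < height x)%N.
Proof.
move=> pq qx; apply: fproper_ltn_card; rewrite fproperE; apply/andP; split.
  apply/fsubsetP => r; rewrite !in_fset_set ?inE; try exact: rfactors_finite.
  move=> [p' p'r]; have [t _ tr] := mulA_r p'r pq.
  by exists t.
have [e [f [_ _ ex _]]] := sg_units x.
apply/negP => /fsubsetP /(_ x).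
rewrite !in_fset_set ?inE; try exact: rfactors_finite.
move=> /(_ (ex_intro _ e ex))[p' p'x]; have [t pp' tx] := mulA_r p'x pq.
have [pt _] := sg_noinv pp' (idem_of_lfix tx).
apply: qx; move: pq; rewrite pt => /(idem_mull (idem_of_lfix tx)).
by [].
Qed.

Lemma height_ind (P : G -> Prop) :
  (forall x, (forall p q, mul p q = Some x -> q <> x -> P q) -> P x) -> forall x, P x.
Proof.
move=> step x; have [n] := ubnP (height x); elim: n x => // n IH x hx.
apply: step => p q pq qx; apply: IH.
by rewrite ltnS in hx; exact: leq_trans (height_lt pq qx) hx.
Qed.

End Order.

(** * Sums over factorisations *)
Section Factorisations.
Variable G : semigroupoid.
Implicit Types a b c e p q x y : G.
Local Notation mul := (@sg_mul G).

Definition fac x : {fset G * G} := fset_set (factors x).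

Lemma facP x (p : G * G) : reflect (mul p.1 p.2 = Some x) (p \in fac x).
Proof.
rewrite /fac in_fset_set; last exact: factors_finite.
by apply: (iffP idP) => [/set_mem|/mem_set].
Qed.

Definition left_unit x : G := projT1 (cid (sg_units x)).

Lemma left_unitP x : Ge (left_unit x) /\ mul (left_unit x) x = Some x.
Proof. by have [f []] := projT2 (cid (sg_units x)). Qed.

Definition right_unit x : G := projT1 (cid (projT2 (cid (sg_units x)))).

Lemma right_unitP x : Ge (right_unit x) /\ mul x (right_unit x) = Some x.
Proof. by have [] := projT2 (cid (projT2 (cid (sg_units x)))). Qed.

Section Sums.
Variable V : zmodType.

Lemma fac_lunit x (F : G * G -> V) :
  \sum_(p <- fac x | p.1 \in @Ge G) F p = F (left_unit x, x).
Proof.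
have [hl lx] := left_unitP x.
rewrite -big_filter (perm_big [:: (left_unit x, x)]) ?big_seq1//.
apply: uniq_perm => [|//|[p q]]; first by rewrite filter_uniq// fset_uniq.
rewrite mem_filter inE /=; apply/andP/eqP => [[pe /facP /= pq]|[-> ->]].
  rewrite inE in pe; have qx := idem_mull pe pq; rewrite -qx in pq *.
  by rewrite (left_unit_uniq pe hl pq lx).
by split; [rewrite inE|apply/facP].
Qed.

Lemma fac_runit x (F : G * G -> V) :
  \sum_(p <- fac x | p.2 \in @Ge G) F p = F (x, right_unit x).
Proof.
have [hl lx] := right_unitP x.
rewrite -big_filter (perm_big [:: (x, right_unit x)]) ?big_seq1//.
apply: uniq_perm => [|//|[p q]]; first by rewrite filter_uniq// fset_uniq.
rewrite mem_filter inE /=; apply/andP/eqP => [[pe /facP /= pq]|[-> ->]].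
  rewrite inE in pe; have qx := idem_mulr pe pq; rewrite -qx in pq *.
  by rewrite (right_unit_uniq pe hl pq lx).
by split; [rewrite inE|apply/facP].
Qed.

(** The only factorisation of [x] whose right factor is [x] uses the left unit;
    in the others the right factor has smaller height. *)
Lemma fac_split x (F : G * G -> V) :
  \sum_(p <- fac x) F p = F (left_unit x, x) + \sum_(p <- fac x | p.2 != x) F p.
Proof.
have [hl lx] := left_unitP x.
have mem : (left_unit x, x) \in fac x by apply/facP.
rewrite (bigD1_seq _ mem (fset_uniq _)) /=; congr (_ + _).
rewrite [LHS]big_seq_cond [RHS]big_seq_cond.
apply: eq_bigl => -[p q] /=; case: (boolP (_ \in _)) => //= /facP /= pq.
congr (~~ _); apply/eqP/eqP => [[_ ->]//|qx]; subst q.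
by congr pair; exact: left_unit_uniq (idem_of_lfix pq) hl pq lx.
Qed.

(** Both sides run over the factorisations of [x] into three factors. *)
Lemma fac_assoc x (F : G -> G -> G -> V) :
  \sum_(p <- fac x) \sum_(q <- fac p.1) F q.1 q.2 p.2 =
  \sum_(p <- fac x) \sum_(q <- fac p.2) F p.1 q.1 q.2.
Proof.
pose F3 (t : G * G * G) := F t.1.1 t.1.2 t.2.
have -> : \sum_(p <- fac x) \sum_(q <- fac p.1) F q.1 q.2 p.2 =
   \sum_(t <- [seq (q, p.2) | p : G * G <- fac x, q : G * G <- fac p.1]) F3 t.
  by rewrite big_allpairs_dep.
have -> : \sum_(p <- fac x) \sum_(q <- fac p.2) F p.1 q.1 q.2 =
   \sum_(t <- [seq (p.1, q.1, q.2) | p : G * G <- fac x, q : G * G <- fac p.2]) F3 t.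
  by rewrite big_allpairs_dep.
apply: perm_big; apply: uniq_perm.
- apply: allpairs_uniq_dep => [|p _|]; try exact: fset_uniq.
  move=> _ _ /allpairsPdep[p [q [px /facP qp ->]]] /allpairsPdep[p' [q' [p'x /facP q'p ->]]] /=.
  case=> ee e2; rewrite -ee qp in q'p; case: q'p => e1.
  by rewrite -ee [p]surjective_pairing [p']surjective_pairing e1 e2.
- apply: allpairs_uniq_dep => [|p _|]; try exact: fset_uniq.
  move=> _ _ /allpairsPdep[p [q [px /facP qp ->]]] /allpairsPdep[p' [q' [p'x /facP q'p ->]]] /=.
  case=> e1 e2 e3.
  have eq : q = q' by rewrite [q]surjective_pairing [q']surjective_pairing e2 e3.
  rewrite -eq qp in q'p; case: q'p => e4.
  by rewrite -eq [p]surjective_pairing [p']surjective_pairing e1 e4.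
- move=> [[a b] c]; apply/allpairsPdep/allpairsPdep.
  + move=> [[p1 p2] [[q1 q2] [/facP /= px /facP /= qp [-> -> ->]]]].
    have [t t1 t2] := mulA_l qp px.
    by exists (q1, t), (q2, p2); split; try apply/facP.
  + move=> [[p1 p2] [[q1 q2] [/facP /= px /facP /= qp [-> -> ->]]]].
    have [t t1 t2] := mulA_r qp px.
    by exists (t, q2), (p1, q1); split; try apply/facP.
Qed.

Lemma sum_fsbig x (F : G * G -> V) : \sum_(p \in factors x) F p = \sum_(p <- fac x) F p.
Proof. by rewrite fsbig_finite//; exact: factors_finite. Qed.

End Sums.

(** Grouping factorisations by the right factor turns star products into
    products with Toeplitz matrices. *)
Lemma fac_sum_right (V : zmodType) x (A : {fset G}) (F : G -> G -> V) :
  lower [set` A] -> x \in A ->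
  \sum_(p <- fac x) F p.1 p.2 =
  \sum_(b <- A) \sum_(p <- fac x | p.2 == b) F p.1 b.
Proof.
move=> lA xA; rewrite [RHS](exchange_big_dep xpredT)//=.
apply: eq_big_seq => p /facP px.
rewrite (big_rem p.2) /= ?eqxx; last by apply: (lA x) => //; exact: sg_le_fac2 px.
rewrite big1_seq ?addr0// => b /andP[/eqP <-].
by rewrite mem_rem_uniqF// fset_uniq.
Qed.

Definition lower_closure (A : {fset G}) : {fset G} :=
  fset_set [set b | exists2 a, a \in A & sg_le b a].

Lemma lower_closureP (A : {fset G}) b :
  b \in lower_closure A <-> exists2 a, a \in A & sg_le b a.
Proof.
rewrite /lower_closure in_fset_set ?inE//.
rewrite (_ : [set b | _] = \bigcup_(a in [set` A]) [set b | sg_le b a]).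
  by apply: bigcup_finite => // a _; exact: sg_le_finite.
by apply/seteqP; split=> [c [a aA ca]|c [a aA ca]]; exists a.
Qed.

(** Divisors being finite in number, finite sets lie in finite lower sets. *)
Lemma lower_closure_lower (A : {fset G}) : lower [set` lower_closure A].
Proof.
move=> a b /= /lower_closureP[c cA ac] ba; apply/lower_closureP.
by exists c => //; exact: sg_le_trans ba ac.
Qed.

Lemma sub_lower_closure (A : {fset G}) : (A `<=` lower_closure A)%fset.
Proof.
apply/fsubsetP => a aA; apply/lower_closureP; exists a => //; exact: sg_le_refl.
Qed.

End Factorisations.

Section StarProducts.
Variables (R : realType) (G : semigroupoid).
Local Notation C := (Cplx R).
Implicit Types (f g h : G -> C) (x y : G).

Lemma starE f g x : star f g x = \sum_(p <- fac x) f p.1 * g p.2.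
Proof. exact: sum_fsbig. Qed.

Lemma kstarE (A B : G -> G -> C) x y : kstar A B x y =
  \sum_(p <- fac x) \sum_(q <- fac y) A p.1 q.1 * B p.2 q.2.
Proof. by rewrite /kstar sum_fsbig; apply: eq_bigr => p _; exact: sum_fsbig. Qed.

Lemma star_deltar f x : star f (@delta R G) x = f x.
Proof.
rewrite starE; under eq_bigr do rewrite /delta mulr_natr mulrb.
by rewrite -big_mkcond fac_runit.
Qed.

Lemma toeplitzE f x y : toeplitz f x y = \sum_(p <- fac x | p.2 == y) f p.1.
Proof.
have fin : finite_set [set c | sg_mul c y = Some x].
  apply: (sub_finite_set _ (finite_image fst (factors_finite x))).
  by move=> c cy; exists (c, y).
rewrite /toeplitz fsbig_finite//.
transitivity (\sum_(c <- [seq p.1 | p <- [seq p : G * G <- fac x | p.2 == y]]) f c).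
  2: by rewrite big_map big_filter.
apply: perm_big; apply: uniq_perm; first exact: fset_uniq.
  rewrite map_inj_in_uniq ?filter_uniq ?fset_uniq//.
  move=> [a b] [c d]; rewrite !mem_filter /= => /andP[/eqP -> _] /andP[/eqP -> _].
  by move=> ->.
move=> c; rewrite in_fset_set//; apply/idP/mapP.
  by move=> /set_mem /= cy; exists (c, y) => //; rewrite mem_filter eqxx; apply/facP.
by move=> [[a b]]; rewrite mem_filter /= => /andP[/eqP -> /facP /= ab] ->; apply/mem_set.
Qed.

Lemma toeplitz_star (A : {fset G}) f g x : lower [set` A] -> x \in A ->
  \sum_(y <- A) toeplitz f x y * g y = star f g x.
Proof.
move=> lA xA; rewrite starE (fac_sum_right (fun p q => f p * g q) lA xA).
by apply: eq_bigr => y _; rewrite toeplitzE mulr_suml.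
Qed.

Lemma kstar_toeplitz (A : {fset G}) f (k : G -> G -> C) x y :
  lower [set` A] -> x \in A -> y \in A ->
  kstar (kself f) k x y =
  \sum_(a <- A) \sum_(b <- A) toeplitz f x a * k a b * (toeplitz f y b)^*.
Proof.
move=> lA xA yA; rewrite kstarE.
have e1 (p : G * G) : \sum_(q <- fac y) kself f p.1 q.1 * k p.2 q.2 =
    f p.1 * \sum_(b <- A) k p.2 b * (toeplitz f y b)^*.
  rewrite (fac_sum_right (fun q1 q2 => kself f p.1 q1 * k p.2 q2) lA yA).
  rewrite mulr_sumr; apply: eq_bigr => b _.
  rewrite toeplitzE rmorph_sum !mulr_sumr; apply: eq_bigr => q _.
  by rewrite /kself -mulrA; congr (_ * _); rewrite mulrC.
under eq_bigr do rewrite e1.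
rewrite (fac_sum_right (fun p1 p2 => f p1 * \sum_(b <- A) k p2 b * (toeplitz f y b)^*) lA xA).
apply: eq_bigr => a _; rewrite -mulr_suml -toeplitzE mulr_sumr.
by apply: eq_bigr => b _; rewrite mulrA.
Qed.

Lemma koneE x y : kone R x y = delta R x * delta R y.
Proof. by rewrite /kone /delta -natrM mulnb. Qed.

Lemma kstar_kone (k : G -> G -> C) x y : kstar (@kone R G) k x y = k x y.
Proof.
rewrite kstarE.
under eq_bigr => p _.
  under eq_bigr do rewrite koneE -mulrA.
  rewrite -mulr_sumr.
  under eq_bigr do rewrite /delta mulr_natl mulrb.
  rewrite -big_mkcond fac_lunit /=.
  over.
under eq_bigr do rewrite /delta mulr_natl mulrb.
by rewrite -big_mkcond fac_lunit.
Qed.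

Lemma kstarBl (A B k : G -> G -> C) x y :
  kstar (A - B) k x y = kstar A k x y - kstar B k x y.
Proof.
rewrite !kstarE -sumrB; apply: eq_bigr => p _; rewrite -sumrB.
by apply: eq_bigr => q _; rewrite -mulrBl.
Qed.

End StarProducts.

(** * Hilbert spaces and representations of the function algebra *)
Section HilbertFacts.
Variables (R : realType) (E : hilbert R).
Local Notation C := (Cplx R).
Implicit Types u v w : E.
Local Notation ip := (hs_inner E).

Lemma hs_ipC u v : ip u v = (ip v u)^*.
Proof. by rewrite hermC expr0 mul1r. Qed.

Lemma hs_ipZr (c : C) u v : ip u (c *: v) = c^* * ip u v.
Proof. by rewrite linearZr_LR. Qed.

Lemma hs_ipZl (c : C) u v : ip (c *: u) v = c * ip u v.
Proof. by rewrite linearZl_LR. Qed.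

Lemma hs_ip_suml (I : Type) (r : seq I) (u : I -> E) v :
  ip (\sum_(i <- r) u i) v = \sum_(i <- r) ip (u i) v.
Proof. exact: linear_sumlz. Qed.

Lemma hs_ip_sumr (I : Type) (r : seq I) (u : I -> E) v :
  ip v (\sum_(i <- r) u i) = \sum_(i <- r) ip v (u i).
Proof. exact: linear_sumr. Qed.

Lemma hs_ipDl u v w : ip (u + v) w = ip u w + ip v w.
Proof. exact: linearDl. Qed.

Lemma hs_ipDr u v w : ip w (u + v) = ip w u + ip w v.
Proof. exact: linearDr. Qed.

Lemma hs_ip0l u : ip 0 u = 0.
Proof. by rewrite -(scale0r (0 : E)) hs_ipZl mul0r. Qed.

Lemma hs_ip0r u : ip u 0 = 0.
Proof. by rewrite hs_ipC hs_ip0l conjC0. Qed.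

Lemma hs_ip_ge0 u : 0 <= ip u u.
Proof. by rewrite hs_norm exprn_ge0. Qed.

Lemma hs_cs u v : `|ip u v| ^+ 2 <= ip u u * ip v v.
Proof.
apply: cauchy_schwarz_num => [|c]; first exact: hs_ip_ge0.
have := hs_ip_ge0 (- c *: v + u).
rewrite linearDl !linearDr /= !(hs_ipZl, hs_ipZr) [ip v u]hs_ipC normCK rmorphN /=.
move: (ip u u) (ip v v) (ip u v) => a d b.
by congr (0 <= _); ring.
Qed.

Lemma hs_cs_norm u v : `|ip u v| <= `|u| * `|v|.
Proof.
rewrite -(@ler_pXn2r _ 2%N)// ?nnegrE ?mulr_ge0//.
by rewrite exprMn -!hs_norm hs_cs.
Qed.

Lemma hs_ext u v : (forall w, ip u w = ip v w) -> u = v.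
Proof.
move=> h; apply/eqP; rewrite -subr_eq0; apply/eqP/normr0_eq0/eqP.
by rewrite -sqrf_eq0 -hs_norm linearBl /= h subrr.
Qed.

Lemma hs_extr u v : (forall w, ip w u = ip w v) -> u = v.
Proof. by move=> h; apply: hs_ext => w; rewrite hs_ipC h -hs_ipC. Qed.

End HilbertFacts.

Section FunctionAlgebra.
Variables (R : realType) (T : topologicalType).
Local Notation C := (Cplx R).
Local Notation B := (Cb R T).
Implicit Types b c : B.

Lemma cb_ext b c : (forall t, b t = c t) -> b = c.
Proof. by move=> h; apply/val_inj/funext. Qed.

Lemma cb_cont b : continuous (b : T -> C).
Proof. by have /Cb_predP[] := cb_mem b. Qed.

Lemma cvg_ReC (I : Type) (F : set_system I) {FF : Filter F} (f : I -> C) (l : C) :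
  f @ F --> l -> (fun i => complex.Re (f i)) @ F --> complex.Re l.
Proof.
move=> /cvgrPdist_lt fl; apply/cvgrPdist_lt => e e0.
have e0' : (0 : C) < toC e by rewrite -toC0 toC_lt.
apply: filterS (fl _ e0') => i h.
rewrite -ReBC -toC_lt -toC_norm; apply: le_lt_trans h.
by have := normc_ge_Re (l - f i); rewrite toC_norm.
Qed.

(** Continuous functional calculus, for functions that are continuous on the
    values taken. *)
Lemma cb_real_comp b (g : R -> R) (M : C) :
  (forall t, {for complex.Re (b t), continuous g}) ->
  (forall t, `|toC (g (complex.Re (b t)))| <= M) ->
  exists c : B, forall t, c t = toC (g (complex.Re (b t))).
Proof.
move=> gc gM.
have mem : (fun t => toC (g (complex.Re (b t)))) \in @Cb_pred R T.
  apply/Cb_predP; split; last by exists M.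
  move=> t; apply: cvg_toC.
  have h : (fun s => complex.Re (b s)) @ nbhs t --> complex.Re (b t).
    by apply: cvg_ReC; exact: (cb_cont (b := b)).
  exact: (cvg_comp _ _ h (gc t)).
by exists (MkCb mem).
Qed.

Lemma cb_sqrt b : (forall t, 0 <= b t) ->
  exists c : B, (forall t, (c t)^* = c t) /\ c * c = b.
Proof.
move=> b0.
have [t|t|c cE] := @cb_real_comp b (@Num.sqrt R) (1 + cb_norm b).
- exact: sqrt_continuous.
- rewrite toC_norm ger0_norm ?sqrtr_ge0//.
  rewrite -(@ler_pXn2r _ 2%N)// ?nnegrE ?addr_ge0 ?cb_norm_ge0//; last first.
    by rewrite -toC0 toC_le sqrtr_ge0.
  rewrite -toCX sqr_sqrtr ?Re_ge0// toCK//.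
  have h : b t <= cb_norm b by rewrite -[b t]ger0_norm// cb_norm_ub.
  by apply: (le_trans h); apply: le_sqr_add1; exact: cb_norm_ge0.
- exists c; split=> [t|]; first by rewrite cE toC_conj.
  apply: cb_ext => t; rewrite -[RHS]toCK//.
  have -> : (c * c) t = c t * c t by [].
  by rewrite cE -toCM -expr2 sqr_sqrtr// Re_ge0.
Qed.

Lemma cb_inv b (e : C) : 0 < e -> (forall t, e <= b t) ->
  exists c : B, (forall t, 0 <= c t) /\ c * b = 1.
Proof.
move=> e0 eb.
have bp t : 0 < b t by exact: lt_le_trans (eb t).
have rp t : 0 < complex.Re (b t) by have := bp t; rewrite ltcE => /andP[].
have [t|t|c cE] := @cb_real_comp b (@GRing.inv R) e^-1.
- by apply: inv_continuous; rewrite gt_eqF.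
- rewrite toC_norm ger0_norm; last by rewrite invr_ge0 ltW.
  have -> : toC (complex.Re (b t))^-1 = (b t)^-1.
    by rewrite -[in RHS](toCK (ltW (bp t))) /toC fmorphV.
  by rewrite lef_pV2// posrE.
- have cE' t : c t = (b t)^-1.
    by rewrite cE -[in RHS](toCK (ltW (bp t))) /toC fmorphV.
  exists c; split=> [t|]; first by rewrite cE' invr_ge0 ltW.
  apply: cb_ext => t; have -> : (c * b) t = c t * b t by [].
  by rewrite cE' mulVf// gt_eqF.
Qed.

Lemma cb_conjE b t : cb_conj b t = (b t)^*. Proof. by []. Qed.

Lemma cb_conjK b : cb_conj (cb_conj b) = b.
Proof. by apply: cb_ext => t; rewrite !cb_conjE conjCK. Qed.

Lemma cb_conjM b c : cb_conj (b * c) = cb_conj b * cb_conj c.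
Proof.
apply: cb_ext => t; rewrite cb_conjE.
have -> : (b * c) t = b t * c t by [].
by rewrite rmorphM.
Qed.

Lemma cb_conj1 : cb_conj (1 : B) = 1.
Proof. by apply: cb_ext => t; rewrite cb_conjE; exact: conjC1. Qed.

Lemma cb_conjD b c : cb_conj (b + c) = cb_conj b + cb_conj c.
Proof.
apply: cb_ext => t; rewrite cb_conjE.
have -> : (b + c) t = b t + c t by [].
by rewrite rmorphD.
Qed.

Lemma cb_conjZ (a : C) b : cb_conj (a *: b) = a^* *: cb_conj b.
Proof.
apply: cb_ext => t; rewrite cb_conjE.
have -> : (a *: b) t = a * b t by [].
by rewrite rmorphM.
Qed.

Lemma cb_conj0 : cb_conj (0 : B) = 0.
Proof. by apply: (@addrI _ (cb_conj (0 : B))); rewrite -cb_conjD !addr0. Qed.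

Lemma cb_conj_sum (I : Type) (r : seq I) (P : pred I) (f : I -> B) :
  cb_conj (\sum_(i <- r | P i) f i) = \sum_(i <- r | P i) cb_conj (f i).
Proof. exact: (big_morph _ cb_conjD cb_conj0). Qed.

Lemma cb_scaleAl (a : C) b c : (a *: b) * c = a *: (b * c).
Proof.
apply: cb_ext => t.
have -> : (a *: b * c) t = a * b t * c t by [].
have -> : (a *: (b * c)) t = a * (b t * c t) by [].
by rewrite mulrA.
Qed.

Lemma cb_scaleAr (a : C) b c : b * (a *: c) = a *: (b * c).
Proof. by rewrite mulrC cb_scaleAl mulrC. Qed.

Lemma cb_conjB b c : cb_conj (b - c) = cb_conj b - cb_conj c.
Proof. by rewrite cb_conjD -scaleN1r cb_conjZ rmorphN /= conjC1 scaleN1r. Qed.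

(** The defect is a nonnegative function, and so a square. *)
Lemma cb_defect b (M : C) : 0 <= M -> (forall t, `|b t| <= M) ->
  exists c : B, M ^+ 2 *: (1 : B) - cb_conj b * b = cb_conj c * c.
Proof.
move=> M0 bM.
have [t|c [cr cc]] := @cb_sqrt (M ^+ 2 *: (1 : B) - cb_conj b * b).
  have -> : (M ^+ 2 *: (1 : B) - cb_conj b * b) t = M ^+ 2 * 1 - (b t)^* * b t by [].
  by rewrite mulr1 -normCKC subr_ge0 ler_pXn2r// nnegrE.
exists c; rewrite -cc; congr (_ * _); apply: cb_ext => t.
by rewrite cb_conjE cr.
Qed.

End FunctionAlgebra.

Section Representations.
Variables (R : realType) (G : semigroupoid) (Psi : set {ptws G -> Cplx R}).
Local Notation C := (Cplx R).
Local Notation B := (Cb R (set_type Psi)).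
Variables (E : hilbert R) (rho : star_rep Psi E).
Local Notation ip := (hs_inner E).
Implicit Types b c : B.

Lemma repD b c v : rho (b + c) v = rho b v + rho c v.
Proof. by rewrite -[b]scale1r rep_linear !scale1r. Qed.

Lemma rep0 v : rho 0 v = 0.
Proof. by apply: (@addrI _ (rho 0 v)); rewrite -repD !addr0. Qed.

Lemma repZ (a : C) b v : rho (a *: b) v = a *: rho b v.
Proof. by rewrite -[a *: b]addr0 rep_linear rep0 addr0. Qed.

Lemma repN b v : rho (- b) v = - rho b v.
Proof. by rewrite -scaleN1r repZ scaleN1r. Qed.

Lemma repB b c v : rho (b - c) v = rho b v - rho c v.
Proof. by rewrite repD repN. Qed.

Lemma rep_conjr b v w : ip v (rho b w) = ip (rho (cb_conj b) v) w.
Proof. by rewrite rep_conj cb_conjK. Qed.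

(** Representations of a C*-algebra are contractive: [M^2 - b^* b] is a square. *)
Lemma rep_norm_le b (M : C) v : 0 <= M -> (forall t, `|b t| <= M) ->
  `|rho b v| <= M * `|v|.
Proof.
move=> M0 bM; rewrite -(@ler_pXn2r _ 2%N)// ?nnegrE ?mulr_ge0//.
rewrite exprMn -!hs_norm.
have [c hc] := cb_defect M0 bM.
have := hs_ip_ge0 (rho c v).
rewrite [ip _ _]rep_conj -rep_mul -hc repB repZ rep_unit rep_mul.
rewrite linearBr /= hs_ipZr -rep_conj subr_ge0.
by rewrite rmorphXn /= (geC0_conj M0).
Qed.

End Representations.

(** * Maps between reproducing kernel spaces *)
Lemma rk_sq (R : realType) S (k : pkernel (Cplx R) S) (f : rkhs k) :
  `|f| ^+ 2 = rk_ip f f.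
Proof. exact: rk_normK. Qed.

Section Pull.
Variables (R : realType) (S1 S2 : Type).
Local Notation C := (Cplx R).
Variables (k1 : pkernel C S1) (k2 : pkernel C S2).

(** A map [Z] from points to combinations induces, by linearity, a map of
    combinations. *)
Definition zmap (Z : S1 -> seq (C * S2)) (l : seq (C * S1)) : seq (C * S2) :=
  flatten [seq scomb p.1 (Z p.2) | p <- l].

Lemma ev_zmap Z f l : ev (fun s => ev f (Z s)) l = ev f (zmap Z l).
Proof.
elim: l => [|p l IH]; first by rewrite !ev_nil.
by rewrite /zmap /= ev_cat ev_scale -IH /ev big_cons.
Qed.

Definition zbounded (Z : S1 -> seq (C * S2)) := exists2 M : C, 0 <= M &
  forall l, sform k2 (zmap Z l) (zmap Z l) <= M * sform k1 l l.

Variable Z : S1 -> seq (C * S2).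
Hypothesis Zb : zbounded Z.

Lemma pull_mem (f : rkhs k2) : (fun s => ev f (Z s)) \in rk_pred k1.
Proof.
have [M M0 ZM] := Zb; have [N N0 fN] := rk_bounded f.
apply/asboolP; exists (N * M) => [|l]; first exact: mulr_ge0.
rewrite ev_zmap; apply: (le_trans (fN _)); rewrite -mulrA ler_wpM2l//.
Qed.

(** The adjoint of the map [J l |-> J (zmap l)]. *)
Definition pull (f : rkhs k2) : rkhs k1 := MkRkhs (pull_mem f).

Lemma ev_pull f l : ev (pull f) l = ev f (zmap Z l).
Proof. exact: ev_zmap. Qed.

Lemma pull_linear : linear pull.
Proof. by move=> c f g; apply: rkP => s /=; exact: rk_evP. Qed.

HB.instance Definition _ := GRing.isLinear.Build C (rkhs k2) (rkhs k1) _ pull pull_linear.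

Lemma pull_bound : exists2 M : C, 0 <= M & forall f, `|pull f| <= M * `|f|.
Proof.
have [M M0 ZM] := Zb; exists (sqrtC M) => [|f]; first by rewrite sqrtC_ge0.
have sM0 : 0 <= sqrtC M by rewrite sqrtC_ge0.
rewrite -(@ler_pXn2r _ 2%N)//; try by rewrite nnegrE ?mulr_ge0// normr_ge0.
have sM : sqrtC M ^+ 2 = M by exact: sqrtCK.
rewrite exprMn sM (rk_sq f) (rk_sq (pull f)).
apply: rk_ip_le => [|l]; first by rewrite mulr_ge0// rk_ip_ge0.
rewrite ev_pull; apply: (le_trans (rk_ev_bound _ _)).
by rewrite [M * _]mulrC -mulrA ler_wpM2l// rk_ip_ge0.
Qed.

End Pull.

Lemma bounded_continuous (K : numFieldType) (V W : normedModType K)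
    (h : {linear V -> W}) (M : K) : (forall v, `|h v| <= M * `|v|) -> continuous h.
Proof.
move=> hM; apply/linear_bounded_continuous; apply/linear_boundedP.
have M0 : `|M| \is Num.real by exact: normr_real.
exists `|M|; split=> // r Mr v.
have [->|v0] := eqVneq v 0; first by rewrite linear0 !normr0 mulr0.
have vp : 0 < `|v| by rewrite normr_gt0.
have MR : M \is Num.real.
  have h0 : 0 <= M * `|v| by exact: le_trans (hM v).
  by rewrite ger0_real// -(pmulr_lge0 _ vp).
by apply: (le_trans (hM v)); rewrite ler_pM2r// (le_trans (real_ler_norm MR))// ltW.
Qed.

Section Density.
Variables (R : realType) (S : Type) (k : pkernel (Cplx R) S).
Local Notation C := (Cplx R).
Local Notation H := (rkhs k).

(** The error in [riesz_approx] bounds the distance, the norm being the best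
    constant in [kbounded]. *)
Lemma rk_dense (g : H) (e : C) : 0 < e -> exists l, `|g - rkJ k l| <= e.
Proof.
move=> e0; have e2 : 0 < e ^+ 2 by rewrite exprn_gt0.
have [l hl] := riesz_approx (@pkP _ _ k) (rk_bounded g) e2.
exists l; rewrite -(@ler_pXn2r _ 2%N)// ?nnegrE//; last exact: ltW.
rewrite rk_normE rk_normK; apply: rk_ip_le => [|m]; first exact: ltW.
by rewrite evB; exact: hl.
Qed.

(** By density.  This is how adjoint relations are verified: on kernel functions
    only. *)
Lemma rk_dense_eq (a b : H -> C) (K : C) :
  {morph a : x y / x - y} -> {morph b : x y / x - y} ->
  (forall g, `|a g| <= K * `|g|) -> (forall g, `|b g| <= K * `|g|) ->
  (forall l, a (rkJ k l) = b (rkJ k l)) -> forall g, a g = b g.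
Proof.
move=> aB bB aK bK ab g.
apply/eqP; rewrite -subr_eq0; apply/eqP; apply/eqP; rewrite -normr_le0.
have [K0|Kn] := boolP (0 <= K); last first.
  have [->|g0] := eqVneq g 0.
    by rewrite -(subrr g) aB bB !subrr normr0.
  exfalso; apply: (negP Kn); have gp : 0 < `|g| by rewrite normr_gt0.
  by rewrite -(pmulr_lge0 _ gp); exact: le_trans (aK g).
apply/ler_addgt0Pr => e e0; rewrite add0r.
have K1 : 0 < (K + 1) *+ 2 by rewrite pmulrn_lgt0// ltr_wpDl.
have [l hl] := rk_dense g (divr_gt0 e0 K1).
have -> : a g - b g = a (g - rkJ k l) - b (g - rkJ k l).
  by rewrite aB bB ab opprB addrA subrK.
apply: (le_trans (ler_normB _ _)).
apply: (@le_trans _ _ (K * `|g - rkJ k l| *+ 2)); first by rewrite mulr2n lerD.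
apply: (@le_trans _ _ (K * (e / ((K + 1) *+ 2)) *+ 2)).
  by rewrite lerMn2r orFb ler_wpM2l.
rewrite -mulrnAl mulrA mulrAC; apply: ler_piMl; first exact: ltW.
by rewrite ler_pdivrMr// mul1r lerMn2r orFb lerDl.
Qed.

End Density.

Section Repetition.
Variables (V : zmodType) (T : choiceType) (X : eqType).

Lemma big_fiber (l : seq X) (t : X -> T) (A : {fset T}) (H : X -> T -> V) :
  {in l, forall p, t p \in A} ->
  \sum_(x <- A) \sum_(p <- l | t p == x) H p x = \sum_(p <- l) H p (t p).
Proof.
move=> tA; rewrite (exchange_big_dep xpredT)//=; apply: eq_big_seq => p pl.
rewrite (big_rem (t p)) /= ?eqxx; last exact: tA.
rewrite big1_seq ?addr0// => b /andP[/eqP <-].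
by rewrite mem_rem_uniqF// fset_uniq.
Qed.

End Repetition.

Section PosKernels.
Variables (R : realType) (G : semigroupoid).
Local Notation C := (Cplx R).

(** Positivity on finite sets of distinct points gives positivity on families
    with repetitions, by collecting the coefficients of equal points. *)
Lemma pos_kernel_kpos (k : G -> G -> C) : pos_kernel setT k -> kpos k.
Proof.
move=> kp l; pose A := [fset p.2 | p in l]%fset.
have lA : {in l, forall p, p.2 \in A}.
  by move=> p pl; apply/imfsetP; exists p.
have := kp A (fun a => \sum_(p <- l | p.2 == a) p.1) (fun _ _ => I).
congr (0 <= _); rewrite /sform /ev /comb.
under eq_bigr => a _.
  under eq_bigr => b _ do rewrite mulr_sumr.
  rewrite (big_fiber (fun p b => (\sum_(p <- l | p.2 == a) p.1)^* * k a b * p.1) lA).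
  rewrite rmorph_sum /=.
  under eq_bigr => q _ do rewrite mulr_suml mulr_suml.
  rewrite exchange_big /=.
  over.
rewrite (big_fiber (fun p a => \sum_(q <- l) p.1^* * k a q.2 * q.1) lA).
apply: eq_bigr => p _; rewrite mulr_sumr; apply: eq_bigr => q _.
by rewrite -mulrA [k _ _ * _]mulrC.
Qed.

Lemma kpos_pos_kernel (F : set G) (k : G -> G -> C) : kpos k -> pos_kernel F k.
Proof.
move=> kp A c _; have := kp [seq (c a, a) | a <- A].
congr (0 <= _); rewrite /sform /ev /comb big_map; apply: eq_bigr => a _.
rewrite big_map /= mulr_sumr; apply: eq_bigr => b _.
by rewrite -mulrA [c b * _]mulrC.
Qed.

End PosKernels.

(** * The Gelfand-Naimark-Segal construction for dual-valued kernels *)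
Section GNS.
Variables (R : realType) (G : semigroupoid) (Psi : set {ptws G -> Cplx R}).
Local Notation C := (Cplx R).
Local Notation B := (Cb R (set_type Psi)).
Variable Gam : G -> G -> dual B.
Hypothesis Gp : dual_pos_kernel setT Gam.
Implicit Types b c : B.

(** The point [(b, x)] stands for the vector [rho b (g x)]. *)
Definition gns_kernel (t s : B * G) : C := Gam s.2 t.2 (s.1 * cb_conj t.1).

Lemma dual_sum (L : dual B) (I : Type) (r : seq I) (P : pred I) (f : I -> B) :
  L (\sum_(i <- r | P i) f i) = \sum_(i <- r | P i) L (f i).
Proof. exact: linear_sum. Qed.

Lemma dualZ (L : dual B) (a : C) b : L (a *: b) = a * L b.
Proof. exact: linearZ. Qed.

Lemma gns_pos_seq (l : seq (B * G)) :
  0 <= \sum_(p <- l) \sum_(q <- l) Gam p.2 q.2 (p.1 * cb_conj q.1).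
Proof.
pose A := [fset p.2 | p in l]%fset.
have lA : {in l, forall p, p.2 \in A}.
  by move=> p pl; apply/imfsetP; exists p.
have := Gp (A := A) (fun a => \sum_(p <- l | p.2 == a) p.1) (fun _ _ => I).
congr (0 <= _).
under eq_bigr => a _.
  under eq_bigr => b _ do rewrite cb_conj_sum mulr_sumr dual_sum.
  rewrite (big_fiber (fun q y => Gam a y ((\sum_(p <- l | p.2 == a) p.1) * cb_conj q.1)) lA).
  under eq_bigr => q _ do rewrite mulr_suml dual_sum.
  rewrite exchange_big /=.
  over.
exact: (big_fiber (fun p a => \sum_(q <- l) Gam a q.2 (p.1 * cb_conj q.1)) lA).
Qed.

Lemma gns_sform (l : seq (C * (B * G))) : sform gns_kernel l l =
  \sum_(p <- [seq (r.1 *: r.2.1, r.2.2) | r <- l])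
    \sum_(q <- [seq (r.1 *: r.2.1, r.2.2) | r <- l]) Gam p.2 q.2 (p.1 * cb_conj q.1).
Proof.
rewrite big_map exchange_big /= big_map; apply: eq_bigr => q _ /=.
rewrite mulr_sumr; apply: eq_bigr => p _.
rewrite /gns_kernel cb_conjZ cb_scaleAr cb_scaleAl !dualZ.
by rewrite mulrCA mulrA.
Qed.

Lemma gns_kpos : kpos gns_kernel.
Proof. by move=> l; rewrite gns_sform gns_pos_seq. Qed.

Definition gns_pk : pkernel C (B * G) := PKernel gns_kpos.

Definition gns_mul b (s : B * G) : seq (C * (B * G)) := [:: (1, (cb_conj b * s.1, s.2))].

Lemma gns_zmap b l : zmap (gns_mul b) l = [seq (p.1, (cb_conj b * p.2.1, p.2.2)) | p <- l].
Proof.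
by rewrite /zmap; elim: l => //= p l ->; rewrite mulr1.
Qed.

Lemma gns_sform_mul d (l : seq (C * (B * G))) :
  sform gns_kernel [seq (p.1, (d * p.2.1, p.2.2)) | p <- l]
                   [seq (p.1, (d * p.2.1, p.2.2)) | p <- l] =
  \sum_(q <- l) \sum_(p <- l) q.1^* * (p.1 *
     Gam p.2.2 q.2.2 (cb_conj d * d * (p.2.1 * cb_conj q.2.1))).
Proof.
rewrite /sform /ev big_map; apply: eq_bigr => q _ /=.
rewrite /comb big_map mulr_sumr; apply: eq_bigr => p _ /=.
congr (_ * (_ * _)); rewrite /gns_kernel /=; congr (Gam _ _ _).
by rewrite cb_conjM mulrACA [d * cb_conj d]mulrC.
Qed.

(** The difference is the form at the combination multiplied by a square root
    of [M^2 - b^* b], hence nonnegative. *)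
Lemma gns_mul_bound b (M : C) l : 0 <= M -> (forall t, `|b t| <= M) ->
  sform gns_kernel (zmap (gns_mul b) l) (zmap (gns_mul b) l)
    <= M ^+ 2 * sform gns_kernel l l.
Proof.
move=> M0 bM.
have [t|c hc] := @cb_defect _ _ (cb_conj b) M M0; first by rewrite cb_conjE norm_conjC.
rewrite gns_zmap -subr_ge0.
have := gns_kpos [seq (p.1, (c * p.2.1, p.2.2)) | p <- l].
congr (0 <= _); rewrite !gns_sform_mul -hc mulr_sumr -sumrB.
apply: eq_bigr => q _; rewrite mulr_sumr mulr_sumr -sumrB.
apply: eq_bigr => p _; rewrite mulrBl linearB /= cb_scaleAl mul1r dualZ /gns_kernel.
set u := Gam _ _ (p.2.1 * cb_conj q.2.1); set v := Gam _ _ (_ * _ * _).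
by move: u v (conjC q.1) => u v w; ring.
Qed.

Lemma gns_zbounded b : zbounded gns_pk gns_pk (gns_mul b).
Proof.
exists (cb_norm b ^+ 2) => [|l]; first by rewrite exprn_ge0// cb_norm_ge0.
by apply: gns_mul_bound => [|t]; [exact: cb_norm_ge0|exact: cb_norm_ub].
Qed.

Definition gns_space : hilbert R := rk_hilbert gns_pk.

Lemma gns_op_continuous b : continuous (pull (gns_zbounded b)).
Proof.
have [M M0 hM] := pull_bound (gns_zbounded b); exact: bounded_continuous hM.
Qed.

Definition gns_op b : bounded_op gns_space gns_space :=
  @BoundedOp _ gns_space gns_space (pull (gns_zbounded b)) (@gns_op_continuous b).

Lemma gns_opE b (f : rkhs gns_pk) s : (gns_op b f : rkhs gns_pk) s = f (cb_conj b * s.1, s.2).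
Proof. by rewrite /= ev_single conjC1 mul1r. Qed.

(** Combinations of points that have norm zero are annihilated by every
    function of the space. *)
Lemma gns_f_lin (f : rkhs gns_pk) (a : C) c c' x :
  f (a *: c + c', x) = a^* * f (c, x) + f (c', x).
Proof.
pose l := [:: (1, (a *: c + c', x)); (- a, (c, x)); (-1, (c', x))] : seq (C * (B * G)).
have l0 : sform gns_pk l l = 0.
  rewrite [sform _ _ _]gns_sform /= !big_cons !big_nil /= !scaleN1r scale1r.
  set b1 := _ + c'; rewrite !addr0 -!linearD /= -!mulrDr -!cb_conjD.
  have -> : b1 + (- a *: c + - c') = 0 by rewrite scaleNr -opprD subrr.
  by rewrite cb_conj0 !mulr0 !addr0 linear0.
have [M M0 fM] := rk_bounded f.
have := fM l; rewrite l0 mulr0 -normrX normr_le0 sqrf_eq0 => /eqP.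
rewrite /ev !big_cons big_nil addr0 /= conjC1 mul1r !rmorphN /= conjC1 mulN1r mulNr.
by rewrite -opprD => /eqP; rewrite subr_eq0 => /eqP.
Qed.

Definition gns_rep : star_rep Psi gns_space.
Proof.
refine (@StarRep R G Psi gns_space gns_op _ _ _ _).
- move=> c b b' v; apply: rkP => s.
  transitivity (c * (gns_op b v : rkhs gns_pk) s + (gns_op b' v : rkhs gns_pk) s); last by [].
  rewrite !gns_opE.
  rewrite cb_conjD cb_conjZ mulrDl cb_scaleAl gns_f_lin conjCK.
  by [].
- move=> b b' v; apply: rkP => s.
  by rewrite !gns_opE /= cb_conjM mulrA [cb_conj b' * _]mulrC.
- by move=> v; apply: rkP => s; rewrite gns_opE cb_conj1 mul1r -surjective_pairing.
- move=> b v w.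
  have [K K0 hK] := pull_bound (gns_zbounded b).
  have [K' K0' hK'] := pull_bound (gns_zbounded (cb_conj b)).
  apply: (@rk_dense_eq _ _ gns_pk (fun w => hs_inner gns_space (gns_op b v) w)
    (fun w => hs_inner gns_space v (gns_op (cb_conj b) w)) ((K + K') * `|v|)).
  + by move=> x y; exact: linearBr.
  + by move=> x y; rewrite linearB /=; exact: linearBr.
  + move=> g; apply: (le_trans (hs_cs_norm _ _)); rewrite ler_wpM2r//.
    by apply: (le_trans (hK _)); rewrite ler_wpM2r// lerDl.
  + move=> g; apply: (le_trans (hs_cs_norm _ _)); rewrite [X in _ <= X * _]mulrC -mulrA ler_wpM2l//.
    by apply: (le_trans (hK' _)); rewrite ler_wpM2r// lerDr.
  + move=> l; rewrite [LHS]rk_ipJ [LHS]ev_pull.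
    have -> : gns_op (cb_conj b) (rkJ gns_pk l) = rkJ gns_pk (zmap (gns_mul b) l).
      apply: rkP => s; rewrite gns_opE cb_conjK gns_zmap /= /comb big_map.
      apply: eq_bigr => p _; congr (_ * _); rewrite /= /gns_kernel /=.
      by rewrite cb_conjM mulrCA mulrA.
    by rewrite [RHS]rk_ipJ.
Defined.

Lemma gns_repE b v : gns_rep b v = gns_op b v.
Proof. by []. Qed.

Definition gns_vec (x : G) : gns_space := rkJ gns_pk [:: (1, (1, x))].

Lemma gns_spec x y b : Gam x y b = hs_inner gns_space (gns_rep b (gns_vec x)) (gns_vec y).
Proof.
rewrite [RHS]rk_ipJ ev_single conjC1 mul1r.
rewrite gns_repE gns_opE /= /comb big_seq1 /= mul1r.
by rewrite /gns_kernel /= mul1r mulr1 cb_conjK.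
Qed.

End GNS.

(** * Limits of kernels *)
Section Kernels.
Variables (R : realType) (G : semigroupoid) (Psi : set {ptws G -> Cplx R}).
Variables (tPsi : test_functions Psi) (cPsi : compact Psi).
Local Notation C := (Cplx R).
Local Notation B := (Cb R (set_type Psi)).
Local Notation eB x := (evalB cPsi x).

(** As [psi e ^+ n] tends to zero uniformly, some power is below one half for
    all [psi] at once. *)
Lemma idem_norm_lt1 (e : G) : Ge e -> exists r : C, [/\ 0 <= r, r < 1 &
  forall t : set_type Psi, `|eB e t| <= r].
Proof.
move=> he; have h := tf_uniform tPsi he.
have {}h A : entourage A -> \forall n \near \oo, forall psi, Psi psi -> A (0, psi e ^+ n).
  move=> entA; apply: (h [set f : (G -> C) -> C | forall psi, Psi psi -> A (0, f psi)]).
  by apply/uniform_nbhs; exists A; split.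
have h2 : (0 : C) < 2^-1 by rewrite invr_gt0.
have /h/filter_ex[n hn] := @entourage_ball C C (PosNum h2).
have {}hn psi : Psi psi -> `|psi e| ^+ n < 2^-1.
  by move=> /hn; rewrite /= -ball_normE /ball_ /= sub0r normrN normrX.
have [psi0 hpsi0] := tf_nonempty tPsi.
have n0 : (0 < n)%N.
  rewrite lt0n; apply/eqP => n0; have := hn _ hpsi0.
  rewrite n0 expr0; have h3 : 2^-1 < 1 :> C by rewrite invf_lt1// ltr1n.
  by move/(lt_trans h3); rewrite ltxx.
exists (n.-root 2^-1); split.
- by rewrite rootC_ge0// ltW.
- by rewrite rootC_lt1// ?ltW// invf_lt1// ltr1n.
- move=> t; rewrite -(@ler_pXn2r _ n)// ?nnegrE ?rootC_ge0// ?ltW//.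
  by rewrite rootCK//; apply: hn; exact: set_valP.
Qed.

Lemma dual_ex (L : B -> C) (M : C) :
  (forall (a : C) (b c : B), L (a *: b + c) = a * L b + L c) ->
  (forall b, `|L b| <= M * cb_norm b) -> exists D : dual B, forall b, D b = L b.
Proof.
move=> Ll LM.
pose L' : B -> C^o := L.
have Llin : linear L' by move=> a b c; exact: Ll.
pose Lm := GRing.isLinear.Build C B C^o _ L' Llin.
pose LL : {linear B -> C^o} := HB.pack L' Lm.
have cL : continuous LL by apply: (@bounded_continuous C B C^o LL M) => b; exact: LM.
by exists (BoundedOp cL).
Qed.

Lemma hatstarE (Gam : G -> G -> dual B) M x y : hatstar Gam M x y =
  \sum_(p <- fac x) \sum_(q <- fac y) Gam p.2 q.2 (M p.1 q.1).
Proof. by rewrite /hatstar sum_fsbig; apply: eq_bigr => p _; exact: sum_fsbig. Qed.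

Section Gram.
Variables (E : hilbert R) (rho : star_rep Psi E) (gam : G -> E).
Local Notation ip := (hs_inner E).

Definition Estar x : E := \sum_(p <- fac x) rho (eB p.1) (gam p.2).

(** In Gram form the defining identity says that the families
    [(Estar x, delta x)] and [(gam x, phi x)] have the same inner products. *)
Lemma hatstar_gram (Gam : G -> G -> dual B) :
  (forall x y b, Gam x y b = ip (rho b (gam x)) (gam y)) ->
  forall x y, hatstar Gam (oneEE cPsi) x y =
    ip (gam x) (gam y) - ip (Estar x) (Estar y).
Proof.
move=> hG x y; rewrite hatstarE.
have e (p q : G * G) : Gam p.2 q.2 (oneEE cPsi p.1 q.1) =
    delta R p.1 * (delta R q.1 * ip (gam p.2) (gam q.2)) -
    ip (rho (eB p.1) (gam p.2)) (rho (eB q.1) (gam q.2)).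
  rewrite hG /oneEE repB linearBl /= repZ hs_ipZl rep_unit mulrA.
  rewrite koneE; congr (_ - _).
  by rewrite /EE mulrC rep_mul rep_conj cb_conjK.
under eq_bigr => p _ do [under eq_bigr => q _ do rewrite e; rewrite sumrB].
rewrite sumrB; congr (_ - _).
  under eq_bigr => p _.
    rewrite -mulr_sumr.
    under eq_bigr do rewrite {1}/delta mulr_natl mulrb.
    rewrite -big_mkcond fac_lunit /= /delta mulr_natl mulrb.
    over.
  by rewrite -big_mkcond fac_lunit.
rewrite /Estar linear_sumlz; apply: eq_bigr => p _.
by rewrite linear_sumr.
Qed.

End Gram.

Lemma near_seq (I : Type) (F : set_system I) {FF : Filter F} (X : eqType) (l : seq X)
    (Q : X -> I -> Prop) : (forall p, p \in l -> \forall i \near F, Q p i) ->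
  \forall i \near F, forall p, p \in l -> Q p i.
Proof.
elim: l => [_|p l IH h]; first exact: nearW.
have h1 : \forall i \near F, Q p i by apply: h; rewrite mem_head.
have h2 : \forall i \near F, forall q, q \in l -> Q q i.
  by apply: IH => q ql; apply: h; rewrite inE ql orbT.
apply: filterS2 h1 h2 => i q1 q2 q; rewrite inE => /orP[/eqP ->//|]; exact: q2.
Qed.

Section Limit.
Variables (I : Type) (F : set_system I).
Context {FF : ProperFilter F}.
Variables (Gam : I -> G -> G -> dual B) (K : G -> G -> C).
Hypothesis Gp : forall i, dual_pos_kernel setT (Gam i).
Hypothesis GK : forall x y,
  (fun i => hatstar (Gam i) (oneEE cPsi) x y) @ F --> K x y.

Let gvec i x : gns_space (Gp i) := gns_vec (Gp i) x.

Lemma gvec_spec i x y b : Gam i x y b = hs_inner _ (gns_rep (Gp i) b (gvec i x)) (gvec i y).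
Proof. exact: gns_spec. Qed.

(** The identity at [(x, x)] bounds the norm of the vector at [x] by the
    vectors at the proper right factors of [x], because the evaluation at the
    left unit of [x] has norm less than one. *)
Lemma gvec_bounded x : exists c : C, \forall i \near F, `|gvec i x| <= c.
Proof.
elim/(@height_ind G): x => x IH.
pose c q := xget 0 [set c : C | \forall i \near F, `|gvec i q| <= c].
have cP q p : sg_mul p q = Some x -> q <> x -> \forall i \near F, `|gvec i q| <= c q.
  move=> pq qx; have [c0 h0] := IH p q pq qx.
  exact: (xgetI 0 (P := [set c : C | \forall i \near F, `|gvec i q| <= c]) h0).
have [r [r0 r1 rE]] := idem_norm_lt1 (left_unitP x).1.
pose l := [seq p <- fac x | p.2 != x].
have hl : \forall i \near F, forall p, p \in l -> `|gvec i p.2| <= c p.2.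
  apply: near_seq => p; rewrite mem_filter => /andP[/eqP px /facP pp].
  exact: cP pp px.
pose s := \sum_(p <- l) cb_norm (eB p.1) * c p.2.
pose k0 := 1 + `|K x x|.
have hk : \forall i \near F, `|hatstar (Gam i) (oneEE cPsi) x x| <= k0.
  have /cvgrPdist_lt/(_ 1 ltr01) := @GK x x; apply: filterS => i h.
  rewrite -(subKr (K x x) (hatstar _ _ _ _)) (le_trans (ler_normB _ _))// addrC lerD2r ltW//.
exists ((1 + k0 + s) / (1 - r)); apply: filterS2 hl hk => i hl hk.
have r1' : 0 < 1 - r by rewrite subr_gt0.
rewrite ler_pdivlMr// mulrBr mulr1 lerBlDr.
have -> : `|gvec i x| * r = r * `|gvec i x| by rewrite mulrC.
pose u := Estar (gns_rep (Gp i)) (gvec i) x.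
have hu : `|u| <= r * `|gvec i x| + s.
  rewrite /u /Estar fac_split; apply: (le_trans (ler_normD _ _)).
  apply: lerD; first exact: rep_norm_le.
  rewrite -big_filter (le_trans (ler_norm_sum _ _ _))//.
  rewrite /s ![\sum_(_ <- l) _]big_seq; apply: ler_sum => p pl.
  apply: (@le_trans _ _ (cb_norm (eB p.1) * `|gvec i p.2|)).
    by apply: rep_norm_le => [|t]; [exact: cb_norm_ge0|exact: cb_norm_ub].
  by rewrite ler_wpM2l ?cb_norm_ge0// hl.
have hsq : `|gvec i x| ^+ 2 = hatstar (Gam i) (oneEE cPsi) x x + `|u| ^+ 2.
  by rewrite (hatstar_gram (gvec_spec i)) -!hs_norm subrK.
have k00 : 0 <= k0 by rewrite addr_ge0.
have h1 : `|gvec i x| <= 1 + k0 + `|u|.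
  rewrite -(@ler_pXn2r _ 2%N)// ?nnegrE ?addr_ge0//.
  rewrite hsq; apply: (@le_trans _ _ (k0 + `|u| ^+ 2)).
    rewrite lerD2r; apply: le_trans hk; apply: real_ler_norm.
    have -> : hatstar (Gam i) (oneEE cPsi) x x = `|gvec i x| ^+ 2 - `|u| ^+ 2.
      by rewrite hsq addrK.
    by rewrite rpredB// ger0_real// exprn_ge0.
  rewrite -subr_ge0; move: (normr_ge0 u); set w := `|u| => w0.
  have -> : (1 + k0 + w) ^+ 2 - (k0 + w ^+ 2) =
    1 + k0 + k0 ^+ 2 + w *+ 2 + k0 * w *+ 2 by ring.
  by rewrite !addr_ge0 ?mulrn_wge0 ?mulr_ge0 ?exprn_ge0.
by apply: (le_trans h1); rewrite -[X in _ <= X]addrA lerD2l addrC.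
Qed.

(** By [gvec_bounded] the scalars [Gam i x y b] are bounded, so that they
    converge along an ultrafilter; the identities pass to the limit because all
    sums are finite. *)
Lemma limit_kernel : exists2 Gl : G -> G -> dual B, dual_pos_kernel setT Gl &
  forall x y, K x y = hatstar Gl (oneEE cPsi) x y.
Proof.
have [U [UU FU]] := ultraFilterLemma FF.
have [c hc] := choice gvec_bounded.
have bnd x y b : \forall i \near U, `|Gam i x y b| <= c x * c y * cb_norm b.
  apply: FU; apply: filterS2 (hc x) (hc y) => i hx hy.
  rewrite gvec_spec; apply: (le_trans (hs_cs_norm _ _)).
  rewrite mulrC [c x * _]mulrC -mulrA ler_pM// [c x * _]mulrC.
  apply: (@le_trans _ _ (cb_norm b * `|gvec i x|)).
    by apply: rep_norm_le => [|t]; [exact: cb_norm_ge0|exact: cb_norm_ub].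
  by rewrite ler_wpM2l// cb_norm_ge0.
pose lim x y b := projT1 (cid (ultra_cvg (UU := UU) (bnd x y b))).
have limP x y b : (fun i => Gam i x y b : C) @ U --> lim x y b.
  exact: (projT2 (cid (ultra_cvg (UU := UU) (bnd x y b)))).
have dual_lim x y : exists D : dual B, forall b, D b = lim x y b.
  apply: (@dual_ex _ (c x * c y)).
    move=> a b b'; apply: (cvg_uniqC (limP x y _)).
    under eq_fun do rewrite linearP.
    by apply: cvgDC => //; apply: cvgZC.
  move=> b; have h : (fun i => `|Gam i x y b : C|) @ U --> `|lim x y b|.
    by apply: cvg_norm; exact: limP.
  apply: (cvg_leC h (g := fun=> c x * c y * cb_norm b)); first exact: cvg_cstC.
  exact: bnd.
have [Gl GlE] : exists Gl : G -> G -> dual B, forall x y b, Gl x y b = lim x y b.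
  have [Gl h] := choice (fun xy : G * G => dual_lim xy.1 xy.2).
  by exists (fun x y => Gl (x, y)) => x y b; exact: h.
have Gl_lim x y b : (fun i => Gam i x y b : C) @ U --> (Gl x y b : C) by rewrite GlE.
exists Gl => [A f _|x y].
  apply: (@cvg_ge0 _ _ U _ (fun i => \sum_(x <- A) \sum_(y <- A) Gam i x y (f x * cb_conj (f y)))).
    by apply: cvg_sumC => x; apply: cvg_sumC => y; exact: Gl_lim.
  by apply: nearW => i; exact: Gp.
have h1 : (fun i => hatstar (Gam i) (oneEE cPsi) x y) @ U --> K x y.
  by move=> A /GK; exact: FU.
apply: (cvg_uniqC h1); rewrite hatstarE; under eq_fun do rewrite hatstarE.
by apply: cvg_sumC => p; apply: cvg_sumC => q; exact: Gl_lim.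
Qed.

End Limit.
End Kernels.

(** * Matrices indexed by finite sets *)
Section FinMatrices.
Variables (C : numClosedFieldType) (T : choiceType).
Implicit Types (A F : {fset T}) (L k M : T -> T -> C) (f g u v w : T -> C).

(** Matrices are functions of two arguments, used on varying finite subsets of
    their domain; this makes restriction and extension free. *)
Definition app A M f x : C := \sum_(y <- A) M x y * f y.
Definition dot A f g : C := \sum_(x <- A) (f x)^* * g x.
Definition madj M x y : C := (M y x)^*.

Lemma dotC A f g : dot A f g = (dot A g f)^*.
Proof.
rewrite /dot rmorph_sum; apply: eq_bigr => x _.
by rewrite rmorphM /= conjCK mulrC.
Qed.

Lemma eq_dot A f f' g g' : {in A, f =1 f'} -> {in A, g =1 g'} -> dot A f g = dot A f' g'.
Proof. by move=> ff gg; apply: eq_big_seq => x xA; rewrite ff// gg. Qed.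

Lemma eq_app A M f g : {in A, f =1 g} -> app A M f =1 app A M g.
Proof. by move=> fg x; apply: eq_big_seq => y yA; rewrite fg. Qed.

Lemma dotBr A f g h : dot A f (fun x => g x - h x) = dot A f g - dot A f h.
Proof. by rewrite /dot -sumrB; apply: eq_bigr => x _; rewrite mulrBr. Qed.

Lemma dotBl A f g h : dot A (fun x => g x - h x) f = dot A g f - dot A h f.
Proof. by rewrite dotC dotBr rmorphB /= -!dotC. Qed.

Lemma dotDr A f g h : dot A f (fun x => g x + h x) = dot A f g + dot A f h.
Proof. by rewrite /dot -big_split; apply: eq_bigr => x _; rewrite mulrDr. Qed.

Lemma dotZr A f (c : C) g : dot A f (fun x => c * g x) = c * dot A f g.
Proof. by rewrite /dot mulr_sumr; apply: eq_bigr => x _; rewrite mulrCA. Qed.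

Lemma dot_ge0 A f : 0 <= dot A f f.
Proof. by apply: sumr_ge0 => x _; rewrite -normCKC exprn_ge0. Qed.

Lemma appB A M f g x : app A M (fun x => f x - g x) x = app A M f x - app A M g x.
Proof. by rewrite /app -sumrB; apply: eq_bigr => y _; rewrite mulrBr. Qed.

Lemma dot_madj A M f g : dot A (app A (madj M) f) g = dot A f (app A M g).
Proof.
rewrite /dot /app; under eq_bigr do rewrite rmorph_sum mulr_suml.
rewrite exchange_big; apply: eq_bigr => x _; rewrite mulr_sumr.
by apply: eq_bigr => y _; rewrite /madj rmorphM /= conjCK mulrAC mulrC mulrA.
Qed.

Lemma dot_madjr A M f g : dot A (app A M f) g = dot A f (app A (madj M) g).
Proof. by rewrite dotC -dot_madj -dotC. Qed.

(** If [M] is a contraction for the form [L], its adjoint is a contraction for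
    the inverse form [k]: expand the form at [k v - M (k (M^* v))]. *)
Lemma form_duality A L k M :
  (forall f g, dot A (app A L f) g = dot A f (app A L g)) ->
  (forall f, {in A, app A L (app A k f) =1 f}) ->
  (forall f, 0 <= dot A f (app A L f)) ->
  (forall u, dot A (app A M u) (app A L (app A M u)) <= dot A u (app A L u)) ->
  forall v, dot A (app A (madj M) v) (app A k (app A (madj M) v))
    <= dot A v (app A k v).
Proof.
move=> Lh Lk Lp LM v.
set z := app A (madj M) v; set u := app A k z; set w := app A k v.
have hw : dot A w (app A L w) = dot A v w.
  by rewrite -Lh; apply: eq_dot => //; exact: Lk.
have hu : dot A u (app A L u) = dot A z u.
  by rewrite -Lh; apply: eq_dot => //; exact: Lk.
have h := Lp (fun x => w x - app A M u x).
have e : dot A (fun x => w x - app A M u x) (app A L (fun x => w x - app A M u x)) =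
    dot A v w - dot A z u - (dot A z u)^* + dot A (app A M u) (app A L (app A M u)).
  rewrite (eq_dot (f' := fun x => w x - app A M u x) (g' := fun x =>
    app A L w x - app A L (app A M u) x)) => [|//|x _]; last exact: appB.
  have e1 : dot A w (app A L (app A M u)) = dot A z u.
    by rewrite -Lh dot_madj; apply: eq_dot => //; exact: Lk.
  have e2 : dot A (app A M u) (app A L w) = (dot A z u)^*.
    by rewrite dotC Lh e1.
  rewrite dotBr !dotBl hw e1 e2.
  by rewrite opprB addrA addrAC [_ + _ - dot A z u]addrAC addrAC.
have zr : (dot A z u)^* = dot A z u.
  by apply: geC0_conj; rewrite -hu.
rewrite e zr in h; rewrite -subr_ge0.
have h2 := LM u; rewrite hu -subr_ge0 in h2.
have := addr_ge0 h h2; congr (0 <= _).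
by move: (dot A v w) (dot A z u) (dot A (app A M u) _) => a b c; ring.
Qed.

(** A form without isotropic vectors is nondegenerate. *)
Lemma posdef_inverse A L :
  (forall f, (exists2 x, x \in A & f x != 0) -> dot A f (app A L f) != 0) ->
  exists k, (forall f, {in A, app A L (app A k f) =1 f}) /\
            (forall f, {in A, app A k (app A L f) =1 f}).
Proof.
move=> Lp.
have [->|[x0 x0A]] := fset_0Vmem A.
  by exists (fun _ _ => 0); split=> f x; rewrite inE.
pose s : seq T := A; pose n := size s.
have us : uniq s by exact: fset_uniq.
pose e (i : 'I_n) : T := nth x0 s i.
have eE i j : (e i == e j) = (i == j) by rewrite /e nth_uniq.
have eA i : e i \in A by rewrite /e; apply: mem_nth.
have sumE (F : T -> C) : \sum_(y <- A) F y = \sum_(i < n) F (e i).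
  by rewrite (big_nth x0) big_mkord.
have idxlt x : x \in A -> (index x s < n)%N by rewrite index_mem.
pose om := \matrix_(i < n, j < n) L (e i) (e j).
have omU : om \in unitmx.
  rewrite -unitmx_tr -row_free_unit.
  apply: inj_row_free => v hv.
  apply/rowP => i; rewrite mxE; apply/eqP/negPn/negP => vi.
  pose f x : C := \sum_(j < n | e j == x) v 0 j.
  have fe j : f (e j) = v 0 j.
    by rewrite /f (big_pred1 j)// => j'; exact: eE.
  have : dot A f (app A L f) != 0.
    by apply: Lp; exists (e i); rewrite ?fe.
  rewrite /dot sumE big1 ?eqxx// => j _.
  have -> : app A L f (e j) = 0.
    have := congr1 (fun m : 'rV_n => m 0 j) hv; rewrite !mxE => <-.
    rewrite /app sumE; apply: eq_bigr => j' _.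
    by rewrite fe !mxE mulrC.
  by rewrite mulr0.
pose iv := invmx om.
pose k x y : C := \sum_(i < n | e i == x) \sum_(j < n | e j == y) iv i j.
have ke i j : k (e i) (e j) = iv i j.
  rewrite /k (big_pred1 i) => [|i']; last exact: eE.
  by rewrite (big_pred1 j)// => j'; exact: eE.
have ex x : x \in A -> exists i, x = e i.
  by move=> xA; exists (Ordinal (idxlt _ xA)); rewrite /e /= nth_index.
have comp (K1 K2 : T -> T -> C) (m1 m2 : 'M[C]_n) :
    (forall i j, K1 (e i) (e j) = m1 i j) -> (forall i j, K2 (e i) (e j) = m2 i j) ->
    m1 *m m2 = 1%:M -> forall f, {in A, app A K1 (app A K2 f) =1 f}.
  move=> h1 h2 h12 f x /ex[i ->].
  rewrite /app sumE; under eq_bigr do rewrite sumE mulr_sumr.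
  rewrite exchange_big /=.
  transitivity (\sum_(j < n) (m1 *m m2) i j * f (e j)).
    apply: eq_bigr => j _; rewrite mxE mulr_suml; apply: eq_bigr => j' _.
    by rewrite h1 h2 mulrA.
  rewrite h12 (bigD1 i)//= mxE eqxx mul1r big1 ?addr0// => j ji.
  by rewrite mxE eq_sym (negbTE ji) mul0r.
exists k; split.
  by apply: (comp _ _ om iv) => // [i j|]; [rewrite mxE|rewrite mulmxV].
by apply: (comp _ _ iv om) => // [i j|]; [rewrite mxE|rewrite mulVmx].
Qed.

End FinMatrices.

(** * Separation from a convex cone in finite dimension *)
Lemma cvg_sum_in (C : numClosedFieldType) (I : Type) (F : set_system I) {FF : Filter F}
    (J : eqType) (r : seq J) (f : J -> I -> C) (l : J -> C) :
  (forall j, j \in r -> f j @ F --> l j) ->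
  (fun i => \sum_(j <- r) f j i) @ F --> (\sum_(j <- r) l j : C).
Proof.
elim: r => [|j r IH] fl.
  by under eq_fun do rewrite big_nil; rewrite big_nil; exact: cvg_cstC.
under eq_fun do rewrite big_cons; rewrite big_cons.
apply: cvgDC; first by apply: fl; rewrite mem_head.
by apply: IH => k kr; apply: fl; rewrite inE kr orbT.
Qed.

Section ConeSeparation.
Variables (R : realType) (T : choiceType) (D : seq T).
Local Notation C := (Cplx R).
Implicit Types (u v w l kap : T -> C).

Definition cip u v : C := \sum_(t <- D) u t * (v t)^*.
(** Twice the real part of the inner product. *)
Definition rip u v : C := cip u v + cip v u.

Lemma cipC u v : cip u v = (cip v u)^*.
Proof.
rewrite /cip rmorph_sum; apply: eq_bigr => x _.
by rewrite rmorphM /= conjCK mulrC.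
Qed.

Lemma cip_ge0 u : 0 <= cip u u.
Proof. by apply: sumr_ge0 => t _; rewrite -normCK exprn_ge0. Qed.

Lemma cip_expand w v (t : C) : t^* = t ->
  cip (fun x => w x + t * v x) (fun x => w x + t * v x) =
  cip w w + t * rip w v + t ^+ 2 * cip v v.
Proof.
move=> tr; rewrite /rip mulrDr /cip !mulr_sumr -!big_split; apply: eq_bigr => x _ /=.
rewrite rmorphD rmorphM /= tr.
by move: (w x) (v x) ((w x)^*) ((v x)^*) => a b c d; ring.
Qed.

Lemma cvg_cip (I : Type) (F : set_system I) {FF : Filter F} (a b : I -> T -> C) u v :
  (forall t, t \in D -> (fun i => a i t) @ F --> u t) ->
  (forall t, t \in D -> (fun i => b i t) @ F --> v t) ->
  (fun i => cip (a i) (b i)) @ F --> cip u v.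
Proof.
move=> au bv; by apply: cvg_sum_in => t tD; apply: cvgMC; [exact: au|apply: cvg_conj; exact: bv].
Qed.

Lemma cvg_rip (I : Type) (F : set_system I) {FF : Filter F} (a b : I -> T -> C) u v :
  (forall t, t \in D -> (fun i => a i t) @ F --> u t) ->
  (forall t, t \in D -> (fun i => b i t) @ F --> v t) ->
  (fun i => rip (a i) (b i)) @ F --> rip u v.
Proof.
move=> au bv; rewrite /rip.
exact: (cvgDC (cvg_cip au bv) (cvg_cip bv au)).
Qed.

(** Divide by [t] and let it tend to zero: the first variation of a quadratic
    function at a minimum. *)
Lemma real_conj_small (a b : C) : (forall t : C, 0 < t -> t < 1 -> 0 <= t * a + t ^+ 2 * b) ->
  0 <= b -> 0 <= a.
Proof.
move=> h b0.
have {}h t : 0 < t -> t < 1 -> 0 <= a + t * b.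
  by move=> t0 t1; rewrite -(pmulr_rge0 _ t0) mulrDr mulrA -expr2; exact: h.
have c1 : (fun n : nat => a + n.+2%:R^-1 * b) @ \oo --> a.
  rewrite -[X in _ --> X]addr0 -[X in _ --> _ + X](mul0r b).
  apply: cvgDC; first exact: cvg_cstC.
  apply: cvgMC; last exact: cvg_cstC.
  by have := @harmonicC R; rewrite -cvg_shiftS.
apply: (cvg_ge0 c1); apply: nearW => n; apply: h.
  by rewrite invr_gt0.
by rewrite invf_lt1// ltr1n.
Qed.

Variables (cone : set (T -> C)) (kap : T -> C).
Hypothesis cone0 : cone !=set0.
Hypothesis coneD : forall u v, cone u -> cone v -> cone (fun x => u x + v x).
Hypothesis coneZ : forall (t : C) u, 0 <= t -> cone u -> cone (fun x => t * u x).

Definition dist u : C := cip (fun x => u x - kap x) (fun x => u x - kap x).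

Lemma dist_ge0 u : 0 <= dist u.
Proof. exact: cip_ge0. Qed.

(** The distance need not be attained, as the cone need not be closed. *)
Lemma dist_inf : exists d : C, [/\ 0 <= d, forall u, cone u -> d <= dist u &
  forall e : C, 0 < e -> exists2 u, cone u & dist u <= d + e].
Proof.
pose Dset := [set complex.Re (dist u) | u in cone].
have D0 : Dset !=set0 by have [u cu] := cone0; exists (complex.Re (dist u)), u.
have Dlb : lbound Dset 0 by move=> _ [u _ <-]; apply: Re_ge0; exact: cip_ge0.
have Dinf : has_inf Dset by split=> //; exists 0.
exists (toC (inf Dset)); split.
- by rewrite -toC0 toC_le; apply: lb_le_inf.
- move=> u cu; rewrite -(toCK (dist_ge0 u)) toC_le.
  by apply: ge_inf; [exists 0|exists u].
- move=> e e0; have e0' : 0 < complex.Re e by have := e0; rewrite ltcE => /andP[].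
  have [_ [u cu <-] hu] := inf_adherent e0' Dinf.
  exists u => //; rewrite -(toCK (dist_ge0 u)) -(toCK (ltW e0)) -toCD toC_le.
  exact: ltW.
Qed.

(** Hahn-Banach for a convex cone: the separating functional is the limit of
    the residuals of a minimising sequence for the distance to the cone. *)
Lemma cone_separation :
  (forall e : C, 0 < e -> exists2 u, cone u & dist u <= e) \/
  exists (l : T -> C) (w : nat -> T -> C),
    [/\ forall n, cone (fun x => w n x + kap x),
        forall t, t \in D -> (fun n => w n t) @ UN --> l t,
        forall v, cone v -> 0 <= rip l v & rip l kap < 0].
Proof.
have [d [d0 dlb dap]] := dist_inf.
have UNp : ProperFilter UN by exact: (@ultra_proper _ _ UN_ultra).
have [dz|dnz] := eqVneq d 0.
  by left=> e e0; have := dap e e0; rewrite dz add0r.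
have dp : 0 < d by rewrite lt_def dnz.
right.
have seq_ex (n : nat) : exists u, cone u /\ dist u <= d + n.+1%:R^-1.
  have [|u cu du] := dap n.+1%:R^-1; first by rewrite invr_gt0.
  by exists u.
have [u hu] := choice seq_ex.
pose w n x := u n x - kap x.
have wb n : cip (w n) (w n) <= d + n.+1%:R^-1 by case: (hu n).
have wd n : d <= cip (w n) (w n) by apply: dlb; case: (hu n).
have wt n t : t \in D -> `|w n t| <= 1 + (d + 1).
  move=> tD; have h : `|w n t| ^+ 2 <= d + 1.
    apply: (@le_trans _ _ (cip (w n) (w n))).
      rewrite /cip (big_rem t)//= -normCK lerDl.
      by apply: sumr_ge0 => t' _; rewrite -normCK exprn_ge0.
    by apply: (le_trans (wb n)); rewrite lerD2l invf_le1// ler1n.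
  have d1 : 0 <= d + 1 by rewrite addr_ge0.
  rewrite -(@ler_pXn2r _ 2%N)// ?nnegrE ?addr_ge0//.
  by apply: (le_trans h); exact: le_sqr_add1.
have lim_ex t : exists z : C, t \in D -> (fun n => w n t) @ UN --> z.
  have [tD|tD] := boolP (t \in D); last by exists 0.
  have [|z hz] := @ultra_cvg R nat UN UN_ultra (fun n => w n t) (1 + (d + 1)).
    by apply: nearW => n; exact: wt.
  by exists z.
have [l hl] := choice lim_ex.
have harm : (fun n : nat => n.+1%:R^-1 : C) @ UN --> (0 : C).
  by apply: UN_cvg; exact: harmonicC.
exists l, w; split=> //.
- move=> n; have [cu _] := hu n; rewrite (_ : (fun x => _) = u n)//.
  by apply/funext => x; rewrite /w subrK.
- move=> v cv; apply: (real_conj_small (b := cip v v)) (cip_ge0 _) => t t0 t1.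
  have tr : t^* = t by rewrite geC0_conj// ltW.
  have c1 : (fun n => t * rip (w n) v + t ^+ 2 * cip v v + n.+1%:R^-1) @ UN -->
      t * rip l v + t ^+ 2 * cip v v + 0.
    apply: cvgDC harm; apply: cvgDC; last exact: cvg_cstC.
    apply: cvgZC; apply: (cvg_rip hl) => s _; exact: cvg_cstC.
  rewrite -[X in 0 <= X]addr0; apply: (cvg_ge0 c1); apply: nearW => n.
  have := dlb _ (coneD (hu n).1 (coneZ (ltW t0) cv)).
  rewrite /dist (_ : (fun x => _ - kap x) = fun x => w n x + t * v x); last first.
    by apply/funext => x; rewrite /w addrAC.
  rewrite (cip_expand _ _ tr) => h.
  have h2 := wb n; rewrite -subr_ge0 in h; rewrite -subr_ge0 in h2.
  have := addr_ge0 h h2; congr (0 <= _).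
  by move: (cip (w n) (w n)) (rip (w n) v) (cip v v) => a b c; ring.
- (* The cone is stable under shrinking, and [w n + kap] belongs to it. *)
  have lk : 0 <= - rip l (fun x => l x + kap x).
    apply: (real_conj_small (b := cip (fun x => l x + kap x) (fun x => l x + kap x))) (cip_ge0 _).
    move=> t t0 t1.
    have tr : (- t)^* = - t by rewrite rmorphN /= geC0_conj// ltW.
    have ul s : s \in D -> (fun n => w n s + kap s) @ UN --> (l s + kap s : C).
      by move=> sD; apply: cvgDC; [exact: hl|exact: cvg_cstC].
    pose wk n x := w n x + kap x; pose lk x := l x + kap x.
    have c1 : (fun n => t * - rip (w n) (wk n) + t ^+ 2 * cip (wk n) (wk n) + n.+1%:R^-1)
        @ UN --> t * - rip l lk + t ^+ 2 * cip lk lk + 0.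
      apply: cvgDC harm; apply: cvgDC; apply: cvgZC.
        by have h := cvg_rip hl ul; apply: cvgN; exact: h.
      by have h := cvg_cip ul ul; exact: h.
    rewrite -[X in 0 <= X]addr0; apply: (cvg_ge0 c1); apply: nearW => n.
    have t1' : 0 <= 1 - t by rewrite subr_ge0 ltW.
    have := dlb _ (coneZ t1' (hu n).1).
    rewrite /dist (_ : (fun x => _ - kap x) = fun x => w n x + - t * wk n x); last first.
      by apply/funext => x; rewrite /wk /w subrK mulrBl mul1r mulNr addrAC.
    rewrite (cip_expand _ _ tr) => h.
    have h2 := wb n; rewrite -subr_ge0 in h; rewrite -subr_ge0 in h2.
    have := addr_ge0 h h2; congr (0 <= _).
    by move: (cip (w n) (w n)) (rip (w n) (wk n)) (cip (wk n) (wk n)) => a b c; ring.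
  have ld : d <= cip l l.
    apply: (@cvg_leC _ _ UN _ (fun=> d) (fun n => cip (w n) (w n))).
    + exact: cvg_cstC.
    + by have h := cvg_cip hl hl; exact: h.
    + by apply: nearW => n; exact: wd.
  have e : rip l (fun x => l x + kap x) = cip l l *+ 2 + rip l kap.
    rewrite /rip /cip mulr2n -!big_split /=; apply: eq_bigr => x _.
    by rewrite rmorphD /= mulrDr mulrDl; ring.
  move: lk; rewrite e opprD subr_ge0 => h.
  have h2 : cip l l *+ 2 <= - rip l kap.
    by rewrite lerNr.
  rewrite -oppr_gt0; apply: lt_le_trans h2.
  by rewrite pmulrn_lgt0//; exact: lt_le_trans ld.
Qed.

End ConeSeparation.

(** * From the kernel condition to approximate decompositions *)
Section Approximation.
Variables (R : realType) (G : semigroupoid) (Psi : set {ptws G -> Cplx R}).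
Variables (tPsi : test_functions Psi) (cPsi : compact Psi).
Local Notation C := (Cplx R).
Local Notation B := (Cb R (set_type Psi)).
Implicit Types (h f : G -> C) (x y : G).

(** The condition defining the unit ball of the algebra of bounded multipliers. *)
Definition kernel_condition (phi : G -> C) : Prop :=
  forall k, KPsi Psi k -> pos_kernel setT (kstar (@kone R G - kself phi) k).

Lemma toC1_ge0 (a b : C) : 0 <= a ->
  (forall e : R, 0 < e -> exists2 c : R, 0 < c < 1 + e & 0 <= toC c ^+ 2 * a - b) ->
  0 <= a - b.
Proof.
move=> a0 h.
have c1 : (fun n : nat => (1 + n.+1%:R^-1) ^+ 2 * a - b) @ \oo --> a - b.
  apply: cvgBC; last exact: cvg_cstC.
  rewrite -[X in _ --> X]mul1r; apply: cvgMC; last exact: cvg_cstC.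
  have c2 : (fun n : nat => 1 + n.+1%:R^-1 : C) @ \oo --> (1 : C).
    rewrite -[X in _ --> X]addr0; apply: cvgDC; [exact: cvg_cstC|exact: harmonicC].
  have := cvgMC c2 c2; rewrite mulr1 => c3.
  by under eq_fun do rewrite expr2; exact: c3.
apply: (cvg_ge0 c1); apply: nearW => n.
have [|c /andP[c0 c1'] hc] := h n.+1%:R^-1; first by rewrite invr_gt0.
apply: (le_trans hc); rewrite lerD2r ler_wpM2r// (@ler_pXn2r _ 2%N)// ?nnegrE.
- have -> : 1 + n.+1%:R^-1 = toC (1 + n.+1%:R^-1 : R).
    by rewrite toCD /toC fmorphV/= rmorph_nat.
  by rewrite toC_le ltW.
- by rewrite -toC0 toC_le ltW.
- by rewrite addr_ge0// invr_ge0 ler0n.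
Qed.

(** The infimum of the admissible constants is attained. *)
Lemma Hinf_norm_le1P (phi : G -> C) :
  Hinf Psi phi /\ Hinf_norm Psi phi <= 1 <-> kernel_condition phi.
Proof.
have kE (c : C) k x y : kstar (c *: @kone R G - kself phi) k x y =
    c * k x y - kstar (kself phi) k x y.
  rewrite kstarBl -(kstar_kone k x y) !kstarE mulr_sumr; congr (_ - _).
  apply: eq_bigr => p _; rewrite mulr_sumr; apply: eq_bigr => q _.
  by rewrite -mulrA.
split=> [[[c0 hc0] n1] k kK A c _|h].
  pose a := \sum_(x <- A) \sum_(y <- A) (c x)^* * k x y * c y.
  pose b := \sum_(x <- A) \sum_(y <- A) (c x)^* * kstar (kself phi) k x y * c y.
  have e (t : C) : \sum_(x <- A) \sum_(y <- A)
      (c x)^* * kstar (t *: @kone R G - kself phi) k x y * c y = t * a - b.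
    rewrite /a /b mulr_sumr -sumrB; apply: eq_bigr => x _.
    rewrite mulr_sumr -sumrB; apply: eq_bigr => y _; rewrite kE.
    by rewrite mulrBr mulrBl mulrCA !mulrA.
  have := e 1; rewrite scale1r mul1r => ->.
  apply: toC1_ge0; first by apply: kK.1.
  move=> d d0.
  have hi : has_inf (Hinf_bounds Psi phi).
    by split; [exists c0|exists 0 => t [/ltW]].
  have [t ht tlt] := inf_adherent d0 hi.
  exists t; first by rewrite ht.1 (lt_le_trans tlt)// lerD2r.
  by rewrite -e; apply: ht.2.
have b1 : Hinf_bounds Psi phi 1.
  by split=> // k kK; rewrite toC1 expr1n scale1r; exact: h.
split; first by exists 1.
by apply: ge_inf => //; exists 0 => t [/ltW].
Qed.

Lemma kself_starE f h x y : kstar (kself f) (kself h) x y = kself (star f h) x y.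
Proof.
rewrite kstarE /kself !starE rmorph_sum mulr_suml; apply: eq_bigr => p _.
rewrite mulr_sumr; apply: eq_bigr => q _; rewrite rmorphM /=.
by move: (f p.1) (h p.2) ((f q.1)^*) ((h q.2)^*) => a b c d; ring.
Qed.

Lemma kone_kself x y : kone R x y = kself (@delta R G) x y.
Proof. by rewrite koneE /kself /delta conjC_nat. Qed.

(** The kernel decomposed by the sum of the rank one kernels [h h^*] placed at
    the evaluations at [psi], over the pairs [(h, psi)] of the list. *)
Definition elem (l : seq ((G -> C) * set_type Psi)) x y : C :=
  \sum_(q <- l) (kself q.1 x y - kself (star (\val q.2) q.1) x y).

Lemma elem_kernel l : exists2 Gam : G -> G -> dual B, dual_pos_kernel setT Gam &
  forall x y, hatstar Gam (oneEE cPsi) x y = elem l x y.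
Proof.
have [Gam hG] : exists Gam : G -> G -> dual B, forall x y b,
    Gam x y b = \sum_(q <- l) kself q.1 x y * b q.2.
  have ex (xy : G * G) : exists D : dual B, forall b,
      D b = \sum_(q <- l) kself q.1 xy.1 xy.2 * b q.2.
    apply: (@dual_ex _ _ _ (fun b => \sum_(q <- l) kself q.1 xy.1 xy.2 * b q.2)
      (\sum_(q <- l) `|kself q.1 xy.1 xy.2|)).
      move=> a b c; rewrite mulr_sumr -big_split; apply: eq_bigr => q _ /=.
      transitivity (kself q.1 xy.1 xy.2 * (a * b q.2 + c q.2)); first by [].
      by rewrite mulrDr mulrCA.
    move=> b; rewrite mulr_suml (le_trans (ler_norm_sum _ _ _))//.
    by apply: ler_sum => q _; rewrite normrM ler_wpM2l// cb_norm_ub.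
  have [D hD] := choice ex.
  by exists (fun x y => D (x, y)) => x y b; exact: hD.
exists Gam => [A f _|x y].
  have -> : \sum_(x <- A) \sum_(y <- A) Gam x y (f x * cb_conj (f y)) =
      \sum_(q <- l) `|\sum_(x <- A) q.1 x * f x q.2| ^+ 2.
    under eq_bigr => x _ do under eq_bigr => y _ do rewrite hG.
    under eq_bigr => x _ do rewrite exchange_big.
    rewrite exchange_big; apply: eq_bigr => q _.
    rewrite normCK rmorph_sum mulr_suml; apply: eq_bigr => x _.
    rewrite mulr_sumr; apply: eq_bigr => y _.
    have -> : (f x * cb_conj (f y)) q.2 = f x q.2 * (f y q.2)^* by [].
    rewrite /kself rmorphM /=.
    by move: (q.1 x) ((q.1 y)^*) (f x q.2) ((f y q.2)^*) => a b c d; ring.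
  by apply: sumr_ge0 => q _; rewrite exprn_ge0.
rewrite hatstarE /elem.
under eq_bigr => p _ do under eq_bigr => q _ do rewrite hG.
under eq_bigr => p _ do rewrite exchange_big.
rewrite exchange_big; apply: eq_bigr => q _.
rewrite -kself_starE -[kself q.1 x y]kstar_kone -kstarBl kstarE.
apply: eq_bigr => p _; apply: eq_bigr => r _; rewrite mulrC; congr (_ * _).
transitivity (kone R p.1 r.1 * 1 -
  (\val q.2 : G -> C) p.1 * ((\val q.2 : G -> C) r.1)^*); first by [].
by rewrite mulr1.
Qed.

Definition elem_cone : set (G * G -> C) :=
  [set u | exists l, u = fun t => elem l t.1 t.2].

Lemma elem_coneD (u v : G * G -> C) : elem_cone u -> elem_cone v -> elem_cone (fun x : G * G => u x + v x).
Proof.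
move=> [l ->] [m ->]; exists (l ++ m); apply/funext => t.
by rewrite /elem big_cat.
Qed.

Lemma elem_coneZ (t : C) (u : G * G -> C) : 0 <= t -> elem_cone u -> elem_cone (fun x : G * G => t * u x).
Proof.
move=> t0 [l ->]; exists [seq (fun x => sqrtC t * q.1 x, q.2) | q <- l].
have st : (sqrtC t)^* = sqrtC t by rewrite geC0_conj// sqrtC_ge0.
apply/funext => z; rewrite /elem big_map mulr_sumr; apply: eq_bigr => q _ /=.
have sE x : star (\val q.2) (fun x => sqrtC t * q.1 x) x = sqrtC t * star (\val q.2) q.1 x.
  by rewrite !starE mulr_sumr; apply: eq_bigr => p _; rewrite mulrCA.
rewrite /kself !sE !rmorphM /= st -{1}(sqrtCK t).
move: (sqrtC t) (star _ _ z.1) ((star _ _ z.2)^*) (q.1 z.1) ((q.1 z.2)^*) => a b c d e.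
by ring.
Qed.

Lemma elem_herm l x y : elem l x y = (elem l y x)^*.
Proof.
rewrite /elem rmorph_sum; apply: eq_bigr => q _.
by rewrite /kself rmorphB !rmorphM /= !conjCK mulrC [star _ _ _ * _]mulrC.
Qed.

(** Past the rank where [v] is small, [|a|] contracts by [r] up to an error
    that sums to [e / 2]. *)
Lemma recurrence_cvg0 (a v : nat -> C) (c r : C) :
  `|c| <= r -> r < 1 -> (fun n => r ^+ n) @ \oo --> (0 : C) ->
  (forall n, a n.+1 = c * a n + v n) -> v @ \oo --> (0 : C) -> a @ \oo --> (0 : C).
Proof.
move=> cr c1 rn av /cvgrPdist_le v0; apply/cvgrPdist_le => e e0.
have r0 : 0 <= r by exact: le_trans cr.
have r1 : 0 < 1 - r by rewrite subr_gt0.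
have e2 : 0 < e / 2 by rewrite divr_gt0.
have e' : 0 < e / 2 * (1 - r) by rewrite mulr_gt0.
have [N _ hN] := v0 _ e'.
have bnd m : `|a (N + m)%N| <= e / 2 + r ^+ m * `|a N|.
  elim: m => [|m IH]; first by rewrite addn0 expr0 mul1r lerDr ltW.
  rewrite addnS av; apply: (le_trans (ler_normD _ _)).
  have := hN (N + m)%N (leq_addr _ _); rewrite /= sub0r normrN => h.
  rewrite normrM; apply: (@le_trans _ _ (r * (e / 2 + r ^+ m * `|a N|) + e / 2 * (1 - r))).
    by apply: lerD h; exact: ler_pM.
  by rewrite exprS le_eqVlt; apply/orP; left; apply/eqP; ring.
have : (fun m => r ^+ m * `|a N|) @ \oo --> (0 : C).
  rewrite -(mul0r `|a N|); apply: cvgMC; last exact: cvg_cstC.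
  exact: rn.
move=> /cvgrPdist_le/(_ _ e2)[M _ hM].
exists (N + M)%N => // n /= hn; rewrite sub0r normrN.
have -> : n = (N + (n - N))%N by rewrite subnKC// (leq_trans _ hn)// leq_addr.
apply: (le_trans (bnd _)); rewrite [X in _ <= X](splitr e) lerD2l.
have := hM (n - N)%N; rewrite /= sub0r normrN => h.
apply: le_trans (h _); first by rewrite real_ler_norm// ger0_real// mulr_ge0// exprn_ge0.
by rewrite leq_subRL// (leq_trans _ hn)// leq_addr.
Qed.

(** Multiplication by [psi] is triangular for the height, and its diagonal
    entry at [x] is the value of [psi] at the left unit of [x], which is less
    than one in modulus. *)
Lemma star_iter_cvg0 psi h : Psi psi -> forall x,
  (fun n => iter n (star psi) h x) @ \oo --> (0 : C).
Proof.
move=> hpsi; elim/(@height_ind G) => x IH.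
have [hl _] := left_unitP x.
have [r [r0 r1 rE]] := idem_norm_lt1 tPsi cPsi hl.
have pr : `|psi (left_unit x)| <= r.
  by have := rE (exist _ psi (mem_set hpsi)).
have cn : (fun n => `|psi (left_unit x)| ^+ n) @ \oo --> (0 : C).
  by apply: cvg_geoC => //; exact: le_lt_trans pr r1.
apply: (recurrence_cvg0 (c := psi (left_unit x)) (r := `|psi (left_unit x)|)
  (v := fun n => \sum_(p <- fac x | p.2 != x) psi p.1 * iter n (star psi) h p.2)) => //.
- exact: le_lt_trans pr r1.
- by move=> n; rewrite iterS starE fac_split.
- have -> : (fun n => \sum_(p <- fac x | p.2 != x) psi p.1 * iter n (star psi) h p.2) =
      fun n => \sum_(p <- [seq p <- fac x | p.2 != x]) psi p.1 * iter n (star psi) h p.2.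
    by apply/funext => n; rewrite big_filter.
  rewrite [X in _ --> X](_ : 0 = \sum_(p <- [seq p <- fac x | p.2 != x]) psi p.1 * 0); last first.
    by rewrite big1// => p _; rewrite mulr0.
  apply: cvg_sum_in => p; rewrite mem_filter => /andP[/eqP px /facP pp].
  by apply: cvgZC; exact: IH pp px.
Qed.

End Approximation.

Section Separation.
Variables (R : realType) (G : semigroupoid) (Psi : set {ptws G -> Cplx R}).
Variables (tPsi : test_functions Psi) (cPsi : compact Psi).
Local Notation C := (Cplx R).
Implicit Types (A : {fset G}) (h f c : G -> C) (x y : G) (M k : G -> G -> C).

(** On a lower set, star multiplication of a kernel by [f f^*] is conjugation by
    the Toeplitz matrix of [f]. *)
Lemma kstar_app A f k c x : lower [set` A] -> x \in A ->
  app A (kstar (kself f) k) c x =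
  app A (toeplitz f) (app A k (app A (madj (toeplitz f)) c)) x.
Proof.
move=> lA xA; rewrite /app.
transitivity (\sum_(y <- A) (\sum_(a <- A) \sum_(b <- A)
    toeplitz f x a * k a b * (toeplitz f y b)^*) * c y).
  by apply: eq_big_seq => y yA; rewrite (kstar_toeplitz _ _ lA).
under eq_bigr do rewrite mulr_suml.
rewrite exchange_big; apply: eq_bigr => a _; rewrite mulr_sumr.
under eq_bigr do rewrite mulr_suml.
rewrite exchange_big; apply: eq_bigr => b _; rewrite !mulr_sumr.
by apply: eq_bigr => y _; rewrite /madj !mulrA.
Qed.

Lemma dot_sum A c M : \sum_(a <- A) \sum_(b <- A) (c a)^* * M a b * c b =
  dot A c (app A M c).
Proof.
apply: eq_bigr => a _; rewrite /app mulr_sumr; apply: eq_bigr => b _.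
by rewrite mulrA.
Qed.

Lemma dot_kone_kself A f k c : lower [set` A] ->
  dot A c (app A (kstar (@kone R G - kself f) k) c) = dot A c (app A k c) -
  dot A (app A (madj (toeplitz f)) c) (app A k (app A (madj (toeplitz f)) c)).
Proof.
move=> lA; rewrite dot_madj -dotBr; apply: eq_dot => // x xA.
rewrite -kstar_app// /app -sumrB; apply: eq_bigr => y _.
by rewrite kstarBl kstar_kone mulrBl.
Qed.

(** Extending coefficients by zero, one may test positivity on large lower sets
    only, where star products are matrix products. *)
Lemma pos_kernel_reduce (F : {fset G}) M :
  (forall A, lower [set` A] -> (F `<=` A)%fset -> forall c, 0 <= dot A c (app A M c)) ->
  pos_kernel setT M.
Proof.
move=> h A0 c _; pose A := lower_closure (A0 `|` F)%fset.
have sA : ((A0 `|` F) `<=` A)%fset by exact: sub_lower_closure.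
have A0A : (A0 `<=` A)%fset by apply: fsubset_trans sA; exact: fsubsetUl.
have FA : (F `<=` A)%fset by apply: fsubset_trans sA; exact: fsubsetUr.
pose c' x := if x \in A0 then c x else 0.
have := h A (@lower_closure_lower _ _) FA c'; rewrite -dot_sum.
congr (0 <= _); symmetry.
rewrite -(big_fset_incl _ A0A) => [|a _ /negbTE aA]; last first.
  by rewrite big1// => b _; rewrite /c' aA conjC0 !mul0r.
apply: eq_big_seq => a aA.
rewrite -(big_fset_incl _ A0A) => [|b _ /negbTE bA]; last first.
  by rewrite /c' bA !mulr0.
by apply: eq_big_seq => b bA; rewrite /c' aA bA.
Qed.

(** A matrix that is a multiple of the identity away from [F] is block diagonal. *)
Lemma block_app (F A : {fset G}) M (m : G -> G -> C) (t : C) f x :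
  (F `<=` A)%fset -> x \in A ->
  (forall x y, x \in F -> y \in F -> M x y = m x y) ->
  (forall x y, ~~ ((x \in F) && (y \in F)) -> M x y = (x == y)%:R * t) ->
  app A M f x = if x \in F then app F m f x else t * f x.
Proof.
move=> FA xA Mm Mt; case: ifPn => xF.
  rewrite /app -(big_fset_incl _ FA) => [|y _ yF].
    by apply: eq_big_seq => y yF; rewrite Mm.
  rewrite Mt ?(negbTE yF) ?andbF//.
  have -> : (x == y) = false by apply: contraNF yF => /eqP <-.
  by rewrite !mul0r.
rewrite /app (bigD1_seq x)//= Mt ?(negbTE xF)// eqxx mul1r big1 ?addr0// => y yx.
by rewrite Mt ?(negbTE xF)// eq_sym (negbTE yx) !mul0r.
Qed.

Variables (F : {fset G}) (lF : lower [set` F]).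
Variables (phi : G -> C) (hphi : kernel_condition Psi phi).

(** A Hermitian form on functions on [F] that decreases under multiplication
    by test functions is nonnegative, and the inverse of a small perturbation
    of it extends to a kernel in [KPsi]; applying the kernel condition to that
    kernel shows that the form also decreases under multiplication by [phi]. *)
Section Form.
Variable lam : G -> G -> C.
Hypothesis lamF : forall x y, ~~ ((x \in F) && (y \in F)) -> lam x y = 0.
Hypothesis lam_herm : forall x y, lam x y = (lam y x)^*.
Let Q h := dot F h (app F lam h).
Hypothesis Q_decr : forall psi h, Psi psi -> Q (star psi h) <= Q h.

Lemma Q_ge0 h : 0 <= Q h.
Proof.
have [psi hpsi] := tf_nonempty tPsi.
pose u n := iter n (star psi) h.
have Qu n : Q (u n) <= Q h.
  by elim: n => // n; apply: le_trans; rewrite /u iterS; exact: Q_decr.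
have c1 : (fun n => Q (u n)) @ \oo --> (0 : C).
  rewrite [X in _ --> X](_ : 0 = \sum_(x <- F) 0 * \sum_(y <- F) lam x y * 0).
    apply: cvg_sum_in => x _; apply: cvgMC.
      by rewrite -conjC0; apply: cvg_conj; exact: (star_iter_cvg0 tPsi cPsi).
    by apply: cvg_sum_in => y _; apply: cvgZC; exact: (star_iter_cvg0 tPsi cPsi).
  by rewrite big1// => x _; rewrite mul0r.
apply: (cvg_leC c1 (g := fun=> Q h)); first exact: cvg_cstC.
exact: nearW.
Qed.

Variables (eps : C) (eps0 : 0 < eps).

(** The perturbation is by a multiple of the identity on all of [G], so that
    off [F] it is that multiple of the identity and has an explicit inverse. *)
Definition pert x y : C := lam x y + (x == y)%:R * eps.

Lemma pert_block x y : ~~ ((x \in F) && (y \in F)) -> pert x y = (x == y)%:R * eps.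
Proof. by move=> h; rewrite /pert lamF// add0r. Qed.

Lemma lam_dot A f : (F `<=` A)%fset -> dot A f (app A lam f) = Q f.
Proof.
move=> FA; rewrite /Q /dot -(big_fset_incl _ FA) => [|x _ /negbTE xF]; last first.
  by rewrite /app big1 ?mulr0// => y _; rewrite lamF ?xF// mul0r.
apply: eq_big_seq => x xF; congr (_ * _).
rewrite /app -(big_fset_incl _ FA)// => y _ /negbTE yF.
by rewrite lamF ?yF ?andbF// mul0r.
Qed.

Lemma pert_dot A f : (F `<=` A)%fset ->
  dot A f (app A pert f) = Q f + eps * dot A f f.
Proof.
move=> FA; rewrite -(lam_dot f FA) -dotZr -dotDr; apply: eq_dot => // x xA.
rewrite /app -[LHS](_ : \sum_(y <- A) (lam x y * f y + (x == y)%:R * eps * f y) = _).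
  rewrite big_split; congr (_ + _); rewrite (bigD1_seq x)//= eqxx mul1r big1 ?addr0// => y yx.
  by rewrite eq_sym (negbTE yx) !mul0r.
by apply: eq_bigr => y _; rewrite /pert mulrDl.
Qed.

Lemma pert_herm A f g : dot A (app A pert f) g = dot A f (app A pert g).
Proof.
rewrite dot_madjr; congr (dot _ _ (app _ _ _)); apply/funext => x; apply/funext => y.
rewrite /madj /pert rmorphD rmorphM /= -lam_herm conjC_nat eq_sym.
by rewrite geC0_conj// ltW.
Qed.

Lemma dot_gt0 A f x : x \in A -> f x != 0 -> 0 < dot A f f.
Proof.
move=> xA fx; rewrite /dot (big_rem x)//=.
apply: ltr_wpDr; last by rewrite -normCKC exprn_gt0// normr_gt0.
by apply: sumr_ge0 => y _; rewrite -normCKC exprn_ge0.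
Qed.

Lemma pert_inverse : exists k, (forall A, (F `<=` A)%fset ->
   (forall f, {in A, app A pert (app A k f) =1 f}) /\
   (forall f, {in A, app A k (app A pert f) =1 f})).
Proof.
have [f [x xF fx]|kF [kF1 kF2]] := @posdef_inverse C G F pert.
  rewrite pert_dot// gt_eqF//; apply: ltr_wpDl; first exact: Q_ge0.
  by rewrite mulr_gt0// (dot_gt0 xF).
pose k x y := if (x \in F) && (y \in F) then kF x y else (x == y)%:R * eps^-1.
have k1 x y : x \in F -> y \in F -> k x y = kF x y by rewrite /k => -> ->.
have k2 x y : ~~ ((x \in F) && (y \in F)) -> k x y = (x == y)%:R * eps^-1.
  by rewrite /k => /negbTE ->.
exists k => A FA.
have bp f x : x \in A -> app A pert f x = if x \in F then app F pert f x else eps * f x.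
  by move=> xA; apply: block_app => //; exact: pert_block.
have bk f x : x \in A -> app A k f x = if x \in F then app F kF f x else eps^-1 * f x.
  by move=> xA; exact: block_app.
have FA' x : x \in F -> x \in A by exact: (fsubsetP FA).
split=> f x xA; [rewrite bp//|rewrite bk//]; case: ifPn => xF.
- rewrite -[RHS](kF1 f)//; apply: eq_app => y yF.
  by rewrite bk ?yF// FA'.
- by rewrite bk// (negbTE xF) mulrA mulfV ?mul1r// gt_eqF.
- rewrite -[RHS](kF2 f)//; apply: eq_app => y yF.
  by rewrite bp ?yF// FA'.
- by rewrite bp// (negbTE xF) mulrA mulVf ?mul1r// gt_eqF.
Qed.

(** The inverse of the perturbed form is in [KPsi]: the test functions contract
    both [Q], by hypothesis, and the standard inner product, and [form_duality]
    transfers this to the inverse.  The kernel condition then says that the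
    adjoint of the Toeplitz matrix of [phi] contracts the inverse, and a second
    use of [form_duality] that [phi *] contracts the perturbed form; as
    [phi * delta = phi], evaluate at [delta]. *)
Lemma Q_phi_eps : Q phi + eps * dot F phi phi <=
  Q (@delta R G) + eps * dot F (@delta R G) (@delta R G).
Proof.
have [k hk] := pert_inverse.
have k_herm A : (F `<=` A)%fset ->
    forall f g, dot A (app A k f) g = dot A f (app A k g).
  move=> FA f g; have [h1 h2] := hk A FA.
  have -> : dot A (app A k f) g = dot A (app A k f) (app A pert (app A k g)).
    by apply: eq_dot => // x xA; rewrite h1.
  by rewrite -pert_herm; apply: eq_dot => //; exact: h1.
have k_pos A : (F `<=` A)%fset -> forall f, 0 <= dot A f (app A k f).
  move=> FA f; have [h1 h2] := hk A FA.
  have -> : dot A f (app A k f) = dot A (app A pert (app A k f)) (app A k f).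
    by apply: eq_dot => // x xA; rewrite h1.
  rewrite pert_herm pert_dot// addr_ge0 ?Q_ge0// mulr_ge0 ?dot_ge0//.
  exact: ltW.
have pert_pos A : (F `<=` A)%fset -> forall f, 0 <= dot A f (app A pert f).
  move=> FA f; rewrite pert_dot// addr_ge0 ?Q_ge0// mulr_ge0 ?dot_ge0//.
  exact: ltW.
have kK : KPsi Psi k.
  split=> [|psi hpsi].
    by apply: (@pos_kernel_reduce F) => A _ FA c; exact: k_pos.
  apply: (@pos_kernel_reduce F) => A lA FA c.
  rewrite dot_kone_kself// subr_ge0.
  have [h1 h2] := hk A FA.
  apply: (form_duality (L := pert)) => //; first exact: pert_herm.
  - exact: pert_pos.
  - move=> u; rewrite !pert_dot//.
    have Tu : {in A, app A (toeplitz psi) u =1 star psi u}.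
      by move=> x xA; exact: toeplitz_star.
    have TuF : {in F, app A (toeplitz psi) u =1 star psi u}.
      by move=> x xF; apply: Tu; exact: (fsubsetP FA).
    have -> : Q (app A (toeplitz psi) u) = Q (star psi u).
      rewrite /Q; apply: eq_dot => // x _; exact: eq_app.
    apply: lerD; first exact: Q_decr.
    rewrite ler_pM2l//.
    have := tf_contractive tPsi lA hpsi u; congr (_ <= _); apply: eq_bigr => x _.
      by rewrite normCKC.
    by rewrite normCKC.
have [h1 h2] := hk F (fsubset_refl _).
have hT v : dot F (app F (madj (toeplitz phi)) v) (app F k (app F (madj (toeplitz phi)) v))
    <= dot F v (app F k v).
  rewrite -subr_ge0 -dot_kone_kself// -dot_sum.
  by apply: (hphi kK).
have := form_duality (k_herm _ (fsubset_refl _)) h2 (k_pos _ (fsubset_refl _)) hT.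
have -> : madj (madj (toeplitz phi)) = toeplitz phi.
  by apply/funext => x; apply/funext => y; rewrite /madj conjCK.
move=> /(_ (@delta R G)).
have Td : {in F, app F (toeplitz phi) (@delta R G) =1 phi}.
  by move=> x xF; rewrite -[RHS]star_deltar; exact: toeplitz_star.
rewrite (eq_dot (f' := phi) (g' := app F pert phi)) => //.
  by rewrite !pert_dot.
by move=> x _; exact: eq_app.
Qed.

End Form.

(** A separating functional is a Hermitian form [Q]; being nonnegative on the
    cone means [Q (psi * h) <= Q h], and then [Q_phi_eps] with [eps] tending to
    zero gives [Q phi <= Q delta]. *)
Lemma no_separation (l : G * G -> C) (w : nat -> G * G -> C)
  (kap := fun t : G * G => kone R t.1 t.2 - kself phi t.1 t.2)
  (D := [seq (x, y) | x <- F, y <- F]) :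
  (forall n, elem_cone Psi (fun x : G * G => w n x + kap x)) ->
  (forall t, t \in D -> (fun n => w n t) @ UN --> l t) ->
  (forall v, elem_cone Psi v -> 0 <= rip D l v) -> ~ rip D l kap < 0.
Proof.
move=> wc wl lv.
pose lam x y := if (x \in F) && (y \in F) then l (x, y) else 0.
have lamF x y : ~~ ((x \in F) && (y \in F)) -> lam x y = 0.
  by rewrite /lam => /negbTE ->.
have UNp : ProperFilter UN by exact: (@ultra_proper _ _ UN_ultra).
have kap_herm x y : kap (x, y) = (kap (y, x))^*.
  rewrite /kap /= !kone_kself /kself rmorphB !rmorphM /= !conjCK.
  by congr (_ - _); rewrite mulrC.
have lam_herm x y : lam x y = (lam y x)^*.
  rewrite /lam andbC; case: ifPn => [/andP[yF xF]|_]; last by rewrite conjC0.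
  have xyD : (x, y) \in D by apply/allpairsPdep; exists x, y.
  have yxD : (y, x) \in D by apply/allpairsPdep; exists y, x.
  apply: (cvg_uniqC (wl _ xyD)).
  have h := cvg_conj (wl _ yxD).
  rewrite (_ : (fun n => w n (x, y)) = (fun n => (w n (y, x))^*)); first exact: h.
  apply/funext => n; have [m hm] := wc n.
  have wE t : w n t = elem m t.1 t.2 - kap t.
    by have := congr1 (@^~ t) hm => /= <-; rewrite addrK.
  by rewrite !wE /= rmorphB /= -elem_herm -kap_herm.
pose Q h := dot F h (app F lam h).
have cipE h : cip D l (fun t => kself h t.1 t.2) = Q h.
  rewrite /cip big_allpairs_dep /=; apply: eq_big_seq => x xF.
  rewrite /app mulr_sumr; apply: eq_big_seq => y yF.
  rewrite /lam xF yF /kself rmorphM /= conjCK.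
  by move: (l (x, y)) ((h x)^*) (h y) => a b c; ring.
have Qreal h : (Q h)^* = Q h.
  rewrite /Q -dotC dot_madjr; congr (dot _ _ (app _ _ _)).
  by apply/funext => x; apply/funext => y; rewrite /madj -lam_herm.
have ripE g h : rip D l (fun t => kself g t.1 t.2 - kself h t.1 t.2) = (Q g - Q h) *+ 2.
  have cE : cip D l (fun t => kself g t.1 t.2 - kself h t.1 t.2) = Q g - Q h.
    rewrite -!cipE /cip -sumrB; apply: eq_bigr => t _.
    by rewrite rmorphB /= mulrBr.
  by rewrite /rip cE cipC cE rmorphB /= !Qreal mulr2n.
have Q_decr psi h : Psi psi -> Q (star psi h) <= Q h.
  move=> hpsi; rewrite -subr_ge0.
  have := lv (fun t => elem [:: (h, exist _ psi (mem_set hpsi) : set_type Psi)] t.1 t.2)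
    (ex_intro _ _ erefl).
  have -> : (fun t => elem [:: (h, exist _ psi (mem_set hpsi) : set_type Psi)] t.1 t.2) =
     (fun t => kself h t.1 t.2 - kself (star psi h) t.1 t.2).
    by apply/funext => t; rewrite /elem big_seq1.
  by rewrite ripE pmulrn_lge0.
have -> : kap = (fun t => kself (@delta R G) t.1 t.2 - kself phi t.1 t.2).
  by apply/funext => t; rewrite /kap kone_kself.
rewrite ripE => neg.
suff h : 0 <= Q (@delta R G) - Q phi.
  by have := lt_le_trans neg (mulrn_wge0 2 h); rewrite ltxx.
have c1 : (fun n : nat => (Q (@delta R G) - Q phi) + n.+1%:R^-1 *
    (dot F (@delta R G) (@delta R G) - dot F phi phi)) @ \oo --> Q (@delta R G) - Q phi.
  rewrite -[X in _ --> X]addr0 -[X in _ --> _ + X](mul0r (dot F (@delta R G) (@delta R G) - dot F phi phi)).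
  apply: cvgDC; first exact: cvg_cstC.
  by apply: cvgMC; [exact: harmonicC|exact: cvg_cstC].
apply: (cvg_ge0 c1); apply: nearW => n.
have n0 : (0 : C) < n.+1%:R^-1 by rewrite invr_gt0.
have := Q_phi_eps lamF lam_herm Q_decr n0; rewrite -subr_ge0 -!/(Q _).
congr (0 <= _).
by move: (Q (@delta R G)) (Q phi) (n.+1%:R^-1) (dot F (@delta R G) _) (dot F phi _)
  => a b c d e; ring.
Qed.

Lemma approx_decomp (e : C) : 0 < e ->
  exists2 Gam : G -> G -> dual (Cb R (set_type Psi)), dual_pos_kernel setT Gam &
  forall x y, x \in F -> y \in F ->
    `|kone R x y - kself phi x y - hatstar Gam (oneEE cPsi) x y| <= e.
Proof.
move=> e0; pose kap := fun t : G * G => kone R t.1 t.2 - kself phi t.1 t.2.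
pose D := [seq (x, y) | x <- F, y <- F].
have c0 : elem_cone Psi !=set0 by exists (fun t => @elem R G Psi [::] t.1 t.2), [::].
have [happ|[l [w [h1 h2 h3 h4]]]] := cone_separation D kap c0 (@elem_coneD R G Psi) (@elem_coneZ R G Psi).
  have e2 : 0 < e ^+ 2 by rewrite exprn_gt0.
  have [_ [m ->] hm] := happ _ e2.
  have [Gam Gp GE] := elem_kernel cPsi m.
  exists Gam => // x y xF yF; rewrite GE.
  have xyD : (x, y) \in D by apply/allpairsPdep; exists x, y.
  rewrite -(@ler_pXn2r _ 2%N)// ?nnegrE//; last exact: ltW.
  apply: le_trans hm; rewrite /dist /cip (big_rem _ xyD) /= -normCK distrC lerDl.
  by apply: sumr_ge0 => t _; rewrite -normCK exprn_ge0.
by exfalso; exact: no_separation h1 h2 h3 h4.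
Qed.

End Separation.

(** * Star-inverses of operator-valued functions *)
Section Neumann.
Variables (R : realType) (E : hilbert R).
Local Notation C := (Cplx R).
Implicit Types (f g : E -> E) (v w : E).

(** Star products and [star_inv] are stated for plain functions, whence a
    predicate. *)
Definition bop f := (forall (a : C) v w, f (a *: v + w) = a *: f v + f w) /\
  exists2 M : C, 0 <= M & forall v, `|f v| <= M * `|v|.

Lemma bopP f : bop f -> exists t : bounded_op E E, f = t :> (E -> E).
Proof.
move=> [fl [M M0 fM]].
pose fm := GRing.isLinear.Build C E E _ f fl.
pose F : {linear E -> E} := HB.pack f fm.
have cF : continuous F by apply: (@bounded_continuous C E E F M).
by exists (BoundedOp cF).
Qed.

Lemma bop_id : bop (fun v => v).
Proof. by split=> //; exists 1 => // v; rewrite mul1r. Qed.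

Lemma bop_zero : bop (fun=> 0).
Proof.
split=> [a v w|]; first by rewrite scaler0 addr0.
by exists 0 => // v; rewrite normr0 mul0r.
Qed.

Lemma bop_comp f g : bop f -> bop g -> bop (fun v => f (g v)).
Proof.
move=> [fl [M M0 fM]] [gl [N N0 gN]]; split=> [a v w|]; first by rewrite gl fl.
exists (M * N) => [|v]; first exact: mulr_ge0.
by apply: (le_trans (fM _)); rewrite -mulrA ler_wpM2l.
Qed.

Lemma bop_add f g : bop f -> bop g -> bop (fun v => f v + g v).
Proof.
move=> [fl [M M0 fM]] [gl [N N0 gN]]; split=> [a v w|].
  by rewrite fl gl scalerDr addrACA.
exists (M + N) => [|v]; first exact: addr_ge0.
by rewrite (le_trans (ler_normD _ _))// mulrDl lerD.
Qed.

Lemma bop_scale (c : C) f : bop f -> bop (fun v => c *: f v).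
Proof.
move=> [fl [M M0 fM]]; split=> [a v w|].
  by rewrite fl scalerDr !scalerA mulrC.
exists (`|c| * M) => [|v]; first exact: mulr_ge0.
by rewrite normrZ -mulrA ler_wpM2l.
Qed.

Lemma bop_sum (X : Type) (r : seq X) (P : pred X) (f : X -> E -> E) :
  (forall x, bop (f x)) -> bop (fun v => \sum_(x <- r | P x) f x v).
Proof.
move=> fb; elim: r => [|x r IH].
  by under eq_fun do rewrite big_nil; exact: bop_zero.
under eq_fun do rewrite big_cons.
by case: (P x) => //; exact: bop_add.
Qed.

Lemma bopB f v w : bop f -> f (v - w) = f v - f w.
Proof.
by move=> [fl _]; rewrite -scaleN1r addrC fl scaleN1r addrC.
Qed.

Lemma bop0 f : bop f -> f 0 = 0.
Proof. by move=> fb; have := bopB 0 0 fb; rewrite !subrr. Qed.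

Lemma bop_sumE (X : Type) (r : seq X) (P : pred X) (u : X -> E) f : bop f ->
  f (\sum_(x <- r | P x) u x) = \sum_(x <- r | P x) f (u x).
Proof.
move=> fb; apply: (big_morph f); last exact: bop0.
by move=> v w; case: fb => fl _; rewrite -[v]scale1r fl !scale1r.
Qed.

(** The solution of [u - K u = w] is the limit of the iterates of
    [u |-> w + K u]. *)
Lemma neumann (K : E -> E) (r : C) : bop K -> 0 <= r -> r < 1 ->
  (forall v, `|K v| <= r * `|v|) ->
  exists I, [/\ bop I, forall w, I w - K (I w) = w & forall w, I (w - K w) = w].
Proof.
move=> Kb r0 r1 Kr.
have r1' : 0 < 1 - r by rewrite subr_gt0.
have sol w : exists u, u - K u = w.
  pose y n := iter n (fun u => w + K u) 0.
  have yS n : y n.+1 = w + K (y n) by [].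
  have d1 n : `|y n.+1 - y n| <= r ^+ n * `|w|.
    elim: n => [|n IH]; first by rewrite yS /= bop0// addr0 subr0 mul1r.
    have -> : y n.+2 - y n.+1 = K (y n.+1 - y n).
      by rewrite bopB// (yS n.+1) {2}(yS n) opprD addrACA subrr add0r.
    by apply: (le_trans (Kr _)); rewrite exprS -mulrA ler_wpM2l.
  pose c := `|w| / (1 - r).
  have c0 : 0 <= c by rewrite divr_ge0// ltW.
  have dn n m : `|y (n + m)%N - y n| <= r ^+ n * c.
    have : `|y (n + m)%N - y n| <= r ^+ n * c * (1 - r ^+ m).
      elim: m => [|m IH]; first by rewrite addn0 subrr normr0 expr0 subrr mulr0.
      have -> : y (n + m.+1)%N - y n = (y (n + m).+1 - y (n + m)%N) + (y (n + m)%N - y n).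
        by rewrite addnS addrA subrK.
      apply: (le_trans (ler_normD _ _)).
      apply: le_trans (lerD (d1 _) IH) _.
      rewrite le_eqVlt; apply/orP; left; apply/eqP.
      have -> : `|w| = c * (1 - r) by rewrite /c divfK// gt_eqF.
      by rewrite exprD exprS; ring.
    move/le_trans; apply; apply: ler_piMr; last by rewrite gerBl exprn_ge0.
    by apply: mulr_ge0 => //; exact: exprn_ge0.
  have gc : (fun n => r ^+ n * c) @ \oo --> (0 : C).
    rewrite -(mul0r c); apply: cvgMC; [exact: cvg_geoC|exact: cvg_cstC].
  have cy : cvg (y @ \oo).
    apply: cauchy_cvg; apply/cauchyP => e e0.
    have /cvgrPdist_lt/(_ e e0)[N _ hN] := gc.
    exists (y N), N => // n /= Nn; rewrite -ball_normE /ball_ /= distrC.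
    rewrite -(subnKC Nn); apply: le_lt_trans (dn _ _) _.
    have := hN N (leqnn _); rewrite /= sub0r normrN ger0_norm//.
    by rewrite mulr_ge0// exprn_ge0.
  have [u yu] : exists u : E, y @ \oo --> u by exists (lim (y @ \oo)); exact: cy.
  exists u; apply/eqP; rewrite subr_eq; apply/eqP.
  have yu' : (fun n => y n.+1) @ \oo --> u by rewrite cvg_shiftS.
  apply: (cvg_unique _ yu'); first exact: norm_hausdorff.
  have Kc : (fun n => K (y n)) @ \oo --> K u.
    apply/cvgrPdist_lt => e e0.
    have /cvgrPdist_lt/(_ e e0) := yu; apply: filterS => n h.
    rewrite -bopB//; apply: le_lt_trans (Kr _) _; apply: le_lt_trans h.
    by rewrite ler_piMl// ltW.
  apply: (@cvgD _ _ _ _ _ (fun=> w)); [exact: cvg_cst|exact: Kc].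
have [I hI] := choice sol.
have uniq u u' : u - K u = u' - K u' -> u = u'.
  move=> h; apply/eqP; rewrite -subr_eq0 -normr_le0.
  have e : u - u' = K (u - u').
    move/eqP: h; rewrite subr_eq => /eqP h.
    by rewrite bopB// {1}h addrAC [u' - _ - _]addrAC subrr sub0r addrC.
  have := Kr (u - u'); rewrite -e => h2.
  by rewrite -(pmulr_rle0 _ r1') mulrBl mul1r subr_le0.
exists I; split=> //.
- split=> [a v w|].
    apply: uniq; rewrite hI; case: Kb => Kl _; rewrite Kl.
    by rewrite opprD addrACA -scalerBr !hI.
  exists (1 - r)^-1 => [|w]; first by rewrite invr_ge0 ltW.
  have e : I w = w + K (I w) by rewrite -{2}(hI w) subrK.
  rewrite mulrC ler_pdivlMr// mulrBr mulr1 lerBlDr {1}e.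
  by rewrite (le_trans (ler_normD _ _))// lerD2l mulrC.
- by move=> w; apply: uniq; rewrite hI.
Qed.

End Neumann.

Section StarInverse.
Variables (R : realType) (G : semigroupoid).
Local Notation C := (Cplx R).
Implicit Types x y : G.

Lemma opstarE (U V W : lmodType C) (S : G -> V -> W) (T : G -> U -> V) x v :
  opstar S T x v = \sum_(p <- fac x) S p.1 (T p.2 v).
Proof. by rewrite /opstar sum_fsbig fct_sumE. Qed.

Variable E : hilbert R.
Implicit Types S T : G -> E -> E.
Local Notation opd := (@opdelta R G E).

Lemma opdeltaE x (v : E) : opd x v = if x \in @Ge G then v else 0.
Proof. by rewrite /opdelta /delta; case: (_ \in _); rewrite ?scale1r// scale0r. Qed.

Lemma bop_opdelta x : bop (opd x).
Proof. by apply: bop_scale; exact: bop_id. Qed.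

Lemma opstar_deltar (W : lmodType C) (S : G -> E -> W) : (forall x, S x 0 = 0) ->
  opstar S opd = S.
Proof.
move=> S0; apply/funext => x; apply/funext => v; rewrite opstarE.
transitivity (\sum_(p <- fac x | p.2 \in @Ge G) S p.1 v); last by rewrite fac_runit.
rewrite [RHS]big_mkcond; apply: eq_bigr => p _; rewrite opdeltaE.
by case: ifP.
Qed.

Lemma opstar_deltal (V : lmodType C) (T : G -> V -> E) : opstar opd T = T.
Proof.
apply/funext => x; apply/funext => v; rewrite opstarE.
transitivity (\sum_(p <- fac x | p.1 \in @Ge G) T p.2 v); last by rewrite fac_lunit.
by rewrite [RHS]big_mkcond; apply: eq_bigr => p _; rewrite opdeltaE.
Qed.

Lemma opstarA (U V : lmodType C) (S : G -> E -> V) (T : G -> E -> E) (T' : G -> U -> E) :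
  (forall x (X : Type) (r : seq X) (u : X -> E),
     S x (\sum_(i <- r) u i) = \sum_(i <- r) S x (u i)) ->
  opstar (opstar S T) T' = opstar S (opstar T T').
Proof.
move=> Sadd; apply/funext => x; apply/funext => v; rewrite !opstarE.
under eq_bigr do rewrite opstarE.
rewrite (fac_assoc x (fun a b c => S a (T b (T' c v)))).
by apply: eq_bigr => p _; rewrite opstarE Sadd.
Qed.

(** A function is star-invertible as soon as its values at idempotents are
    invertible, like a triangular matrix. *)
Definition invertible_at S := forall e, Ge e -> exists I,
  [/\ bop I, forall w, S e (I w) = w & forall w, I (S e w) = w].

(** The equation [S * T = delta] determines [T x] from the values of [T] at the
    proper right factors of [x]. *)
Lemma star_right_inverse S : (forall x, bop (S x)) -> invertible_at S ->
  exists T, [/\ forall x, bop (T x), opstar S T = opd & invertible_at T].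
Proof.
move=> Sb Sinv.
have Iex x : exists I, [/\ bop I, forall w, S (left_unit x) (I w) = w & forall w, I (S (left_unit x) w) = w].
  exact: Sinv (left_unitP x).1.
have [I hI] := choice Iex.
pose step (T : G -> E -> E) x v :=
  I x (opd x v - \sum_(p <- fac x | p.2 != x) S p.1 (T p.2 v)).
(* After [n] rounds the values at heights below [n] are final. *)
pose Tn n := iter n step (fun _ _ => 0).
have Tb n x : bop (Tn n x).
  elim: n x => [|n IH] x; first exact: bop_zero.
  have [Ib _ _] := hI x; apply: bop_comp => //.
  have -> : (fun v => opd x v - \sum_(p <- fac x | p.2 != x) S p.1 (Tn n p.2 v)) =
      (fun v => opd x v + -1 *: \sum_(p <- fac x | p.2 != x) S p.1 (Tn n p.2 v)).
    by apply/funext => v; rewrite scaleN1r.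
  apply: bop_add; first exact: bop_opdelta.
  by apply: bop_scale; apply: bop_sum => p; exact: bop_comp.
have stepE (T T' : G -> E -> E) x : (forall p q, sg_mul p q = Some x -> q <> x -> T q = T' q) ->
    step T x = step T' x.
  move=> TT; apply/funext => v; rewrite /step; congr (I x (_ - _)).
  rewrite -!(big_filter _ (fun p => p.2 != x)).
  apply: eq_big_seq => p; rewrite mem_filter => /andP[/eqP px /facP pp].
  by rewrite (TT p.1 p.2).
have stable n x : (height x < n)%N -> Tn n.+1 x = Tn n x.
  elim: n x => // n IH x hx; rewrite /Tn iterS [in RHS]iterS; apply: stepE => p q pq qx.
  apply: IH; rewrite ltnS in hx; exact: leq_trans (height_lt pq qx) hx.
have stable2 n m x : (height x < n)%N -> Tn (n + m)%N x = Tn n x.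
  move=> hx; elim: m => [|m IH]; first by rewrite addn0.
  by rewrite addnS stable// (leq_trans hx)// leq_addr.
pose T x := Tn (height x).+1 x.
have TE x : T x = step T x.
  rewrite {1}/T /Tn iterS; apply: stepE => p q pq qx.
  by rewrite -/(Tn _) -(subnKC (height_lt pq qx)) stable2.
exists T; split.
- by move=> x; exact: Tb.
- apply/funext => x; apply/funext => v; rewrite opstarE fac_split /= TE /step.
  by have [_ -> _] := hI x; rewrite subrK.
- move=> e he.
  have left_unitE : left_unit e = e by apply: left_unit_uniq (left_unitP e).1 he (left_unitP e).2 (idem_sq he).
  have TeE v : T e v = I e v.
    rewrite TE /step; congr (I e _); rewrite opdeltaE mem_set//.
    rewrite -big_filter big1_seq ?subr0// => p; rewrite mem_filter => /andP[_ /andP[/eqP pe /facP pp]].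
    by case: pe; have [_ ->] := sg_noinv pp he.
  have [_ h1 h2] := hI e; rewrite left_unitE in h1 h2.
  by exists (S e); split=> // w; rewrite TeE.
Qed.

(** A right inverse of the right inverse is the given function. *)
Lemma star_two_sided_inverse S : (forall x, bop (S x)) -> invertible_at S ->
  exists T, [/\ forall x, bop (T x), opstar S T = opd & opstar T S = opd].
Proof.
move=> Sb Sinv.
have [T [Tb ST Tinv]] := star_right_inverse Sb Sinv.
have [T' [Tb' TT' _]] := star_right_inverse Tb Tinv.
exists T; split=> //.
rewrite -[S in opstar T S](opstar_deltar (S := S)) => [|x]; last exact: bop0.
rewrite -TT' -[opstar S _]opstarA => [|x X r u]; last exact: bop_sumE.
by rewrite ST opstar_deltal TT'.
Qed.

Lemma star_invP S : (forall x, bop (S x)) -> invertible_at S ->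
  [/\ forall x, bop (star_inv S x), opstar S (star_inv S) = opd &
      opstar (star_inv S) S = opd].
Proof.
move=> Sb Sinv; have [T [Tb ST TS]] := star_two_sided_inverse Sb Sinv.
have hT : [set T : G -> E -> E |
    [/\ forall x, exists t : bounded_op E E, T x = t :> (E -> E),
      opstar S T = opd & opstar T S = opd]] T.
  by split=> // x; exact: bopP.
have [hb h1 h2] := xgetI S hT.
have -> : star_inv S = T.
  rewrite -[LHS]opstar_deltal -TS opstarA => [|x X r u]; last exact: bop_sumE.
  rewrite [X in opstar T X = _]h1; apply: opstar_deltar => x; exact: bop0.
by split.
Qed.

End StarInverse.

(** * Kernels given by a semi-inner product *)
Lemma rk_null (R : realType) (S : Type) (k : pkernel (Cplx R) S) (f : rkhs k) l :
  sform k l l = 0 -> ev f l = 0.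
Proof.
move=> l0; have [M M0 fM] := rk_bounded f.
by have := fM l; rewrite l0 mulr0 -normrX normr_le0 sqrf_eq0 => /eqP.
Qed.

(** The adjoint of a pullback is a pullback as soon as this holds on points. *)
Lemma pull_adjoint (R : realType) (S1 S2 : Type) (k1 : pkernel (Cplx R) S1)
    (k2 : pkernel (Cplx R) S2) (Z : S1 -> seq (Cplx R * S2)) (Z' : S2 -> seq (Cplx R * S1))
    (Zb : zbounded k1 k2 Z) (Zb' : zbounded k2 k1 Z') :
  (forall s1 s2, sform k1 [:: (1, s1)] (Z' s2) = sform k2 (Z s1) [:: (1, s2)]) ->
  forall f g, rk_ip (pull Zb f) g = rk_ip f (pull Zb' g).
Proof.
move=> h f g.
have [K K0 hK] := pull_bound Zb; have [K' K0' hK'] := pull_bound Zb'.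
have cs (S : Type) (k : pkernel (Cplx R) S) (a b : rkhs k) : `|rk_ip a b| <= `|a| * `|b|.
  exact: (@hs_cs_norm R (rk_hilbert k)).
apply: (@rk_dense_eq _ _ k1 (fun g => rk_ip (pull Zb f) g) (fun g => rk_ip f (pull Zb' g))
  ((K + K') * `|f|)).
- by move=> x y; exact: (@linearBr _ _ _ _ _ _ (@rk_dot R S1 k1)).
- move=> x y; rewrite linearB; exact: (@linearBr _ _ _ _ _ _ (@rk_dot R S2 k2)).
- move=> x; apply: (le_trans (cs _ _ _ _)); rewrite ler_wpM2r//.
  by apply: (le_trans (hK _)); rewrite ler_wpM2r// lerDl.
- move=> x; apply: (le_trans (cs _ _ _ _)); rewrite [X in _ <= X * _]mulrC -mulrA ler_wpM2l//.
  by apply: (le_trans (hK' _)); rewrite ler_wpM2r// lerDr.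
- move=> l; rewrite rk_ipJ ev_pull.
  have -> : pull Zb' (rkJ k1 l) = rkJ k2 (zmap Z l).
    apply: rkP => s2 /=.
    have -> : comb k2 (zmap Z l) s2 = sform k2 (zmap Z l) [:: (1, s2)].
      by rewrite /sform ev_single conjC1 mul1r.
    rewrite -/(sform k1 l (Z' s2)).
    elim: l => [|p l IH].
      rewrite /sform /comb /ev !big1 // => q _; by rewrite big_nil mulr0.
    rewrite -[zmap Z (p :: l)]/(scomb p.1 (Z p.2) ++ zmap Z l).
    rewrite -cat1s !sform_catl IH; congr (_ + _).
    rewrite sform_scalel -h -sform_scalel /scomb /= mulr1.
    by case: p.
  by rewrite rk_ipJ.
Qed.

Section InnerKernel.
Variables (R : realType) (V : lmodType (Cplx R)).
Local Notation C := (Cplx R).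

(** A vector space with a degenerate form yields a Hilbert space by taking the
    form as a kernel on its vectors; the elements are antilinear functions. *)
Record semi_inner := SemiInner {
  si_form :> V -> V -> C;
  si_linl : forall (a : C) u v w, si_form (a *: u + v) w = a * si_form u w + si_form v w;
  si_herm : forall u v, si_form u v = (si_form v u)^*;
  si_ge0 : forall u, 0 <= si_form u u
}.

Variable s : semi_inner.

Lemma si_0l w : s 0 w = 0.
Proof. by have := si_linl s (-1) 0 0 w; rewrite scaler0 addr0 mulN1r addNr. Qed.

Lemma si_Zl a u w : s (a *: u) w = a * s u w.
Proof. by rewrite -[a *: u]addr0 si_linl si_0l addr0. Qed.

Lemma si_Dl u v w : s (u + v) w = s u w + s v w.
Proof. by rewrite -[u]scale1r si_linl mul1r scale1r. Qed.

Lemma si_Zr a u w : s w (a *: u) = a^* * s w u.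
Proof. by rewrite si_herm si_Zl rmorphM /= -si_herm. Qed.

Lemma si_Dr u v w : s w (u + v) = s w u + s w v.
Proof. by rewrite si_herm si_Dl rmorphD /= -!si_herm. Qed.

Definition lincomb (l : seq (C * V)) : V := \sum_(p <- l) p.1 *: p.2.

Definition ikernel (t u : V) : C := s u t.

Lemma ikernel_sform l m : sform ikernel l m = s (lincomb l) (lincomb m).
Proof.
rewrite /sform /ev /lincomb.
have suml u : comb ikernel l u = s (\sum_(p <- l) p.1 *: p.2) u.
  rewrite /comb; elim: l => [|p l IH]; first by rewrite !big_nil si_0l.
  by rewrite !big_cons IH si_Dl si_Zl.
elim: m => [|q m IH]; first by rewrite !big_nil si_herm si_0l conjC0.
by rewrite !big_cons IH si_Dr si_Zr suml.
Qed.

Lemma ikernel_pos : kpos ikernel.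
Proof. by move=> l; rewrite ikernel_sform si_ge0. Qed.

Definition ipk : pkernel C V := PKernel ikernel_pos.

Lemma rk_antilinear (f : rkhs ipk) (a : C) u v : f (a *: u + v) = a^* * f u + f v.
Proof.
have := rk_null f (l := [:: (1, a *: u + v); (- a, u); (-1, v)]).
rewrite [sform _ _ _]ikernel_sform /lincomb !big_cons big_nil /= !scale1r addr0 scaleN1r scaleNr.
rewrite addrA addrAC [a *: u + v + - v]addrK subrr si_0l => /(_ erefl).
rewrite /ev !big_cons big_nil addr0 /= conjC1 mul1r !rmorphN /= conjC1 mulN1r mulNr.
by rewrite -opprD => /eqP; rewrite subr_eq0 => /eqP.
Qed.

Lemma rk_at0 (f : rkhs ipk) : f 0 = 0.
Proof.
have := rk_antilinear f (-1) 0 0; rewrite scaler0 addr0 rmorphN /= conjC1 mulN1r.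
by rewrite addNr.
Qed.

(** The image of a vector in the completion. *)
Definition jv (v : V) : rkhs ipk := rkJ ipk [:: (1, v)].

Lemma jvE v w : jv v w = s v w.
Proof. by rewrite /jv /= /comb big_seq1 mul1r. Qed.

Lemma jv_lin a u v : jv (a *: u + v) = a *: jv u + jv v.
Proof.
apply: rkP => w; rewrite jvE si_linl.
have -> : (a *: jv u + jv v : rkhs _) w = a * jv u w + jv v w by [].
by rewrite !jvE.
Qed.

Lemma rk_ip_jv f v : rk_ip f (jv v) = f v.
Proof. by rewrite rk_ipJ ev_single conjC1 mul1r. Qed.

End InnerKernel.

Section InnerMaps.
Variables (R : realType) (V W : lmodType (Cplx R)).
Local Notation C := (Cplx R).
Variables (s : semi_inner V) (t : semi_inner W).

(** A linear map [r], as a map from points to combinations: pulling back along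
    it is composition with [r]. *)
Definition pt (r : V -> W) (v : V) : seq (C * W) := [:: (1, r v)].

Lemma zmap_pt r l : zmap (pt r) l = [seq (p.1, r p.2) | p <- l].
Proof. by rewrite /zmap /pt; elim: l => //= p l ->; rewrite mulr1. Qed.

Lemma pt_zbounded (r : V -> W) (M : C) : 0 <= M ->
  (forall (a : C) u v, r (a *: u + v) = a *: r u + r v) ->
  (forall v, t (r v) (r v) <= M * s v v) -> zbounded (ipk s) (ipk t) (pt r).
Proof.
move=> M0 rl rM; exists M => // l.
rewrite zmap_pt ![sform _ _ _]ikernel_sform.
have -> : lincomb [seq (p.1, r p.2) | p <- l] = r (lincomb l); last exact: rM.
rewrite /lincomb; elim: l => [|p l IH].
  by rewrite !big_nil; have := rl (-1) 0 0; rewrite scaler0 addr0 scaleN1r addNr.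
by rewrite !big_cons IH rl.
Qed.

Lemma pull_ptE (r : V -> W) (Zb : zbounded (ipk s) (ipk t) (pt r)) f v :
  pull Zb f v = f (r v).
Proof. by rewrite /= ev_single conjC1 mul1r. Qed.

End InnerMaps.

Lemma pt_adjoint (R : realType) (V W : lmodType (Cplx R)) (s : semi_inner V)
    (t : semi_inner W) (r : V -> W) (r' : W -> V)
    (Zb : zbounded (ipk s) (ipk t) (pt r)) (Zb' : zbounded (ipk t) (ipk s) (pt r')) :
  (forall v w, s v (r' w) = t (r v) w) ->
  forall f g, rk_ip (pull Zb f) g = rk_ip f (pull Zb' g).
Proof.
move=> h; apply: pull_adjoint => v w.
by rewrite ![sform _ _ _]ikernel_sform /lincomb !big_seq1 /= !scale1r h.
Qed.

(** * Reflections *)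
Section Reflection.
Variables (R : realType) (V : lmodType (Cplx R)) (s : semi_inner V).
Variables (I : Type) (z : I -> V).
Local Notation C := (Cplx R).
Local Notation H := (rkhs (ipk s)).

(** The Gram kernel of the family [z]; restriction to the family maps onto its
    space, and is the adjoint of an isometry onto the closed span of [z]. *)
Definition refl_kernel (j i : I) : C := s (z i) (z j).

Definition zc (i : I) : seq (C * V) := [:: (1, z i)].

Lemma refl_sform l m : sform refl_kernel l m = sform (ipk s) (zmap zc l) (zmap zc m).
Proof.
have zE n : zmap zc n = [seq (p.1, z p.2) | p <- n].
  by rewrite /zmap /zc; elim: n => //= p n ->; rewrite mulr1.
rewrite !zE /sform /ev big_map; apply: eq_bigr => p _ /=.
by rewrite /comb big_map.
Qed.

Lemma refl_pos : kpos refl_kernel.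
Proof. by move=> l; rewrite refl_sform; exact: pkP. Qed.

Definition refl_pk : pkernel C I := PKernel refl_pos.

Lemma zc_bounded : zbounded refl_pk (ipk s) zc.
Proof. by exists 1 => // l; rewrite mul1r [sform refl_pk l l]refl_sform. Qed.

Let down : H -> rkhs refl_pk := pull zc_bounded.

Lemma down_jv v i : down (jv s v) i = s v (z i).
Proof.
transitivity (ev (jv s v) (zc i)); first by [].
by rewrite ev_single conjC1 mul1r jvE.
Qed.

Lemma up_mem (g : rkhs refl_pk) : (fun v => rk_ip g (down (jv s v))) \in rk_pred (ipk s).
Proof.
have [K K0 hK] := pull_bound zc_bounded.
have evE l : ev (fun v => rk_ip g (down (jv s v))) l = rk_ip g (down (rkJ (ipk s) l)).
  elim: l => [|p l IH].
    rewrite ev_nil; have -> : rkJ (ipk s) [::] = 0.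
      by apply: rkP => v /=; rewrite /comb big_nil.
    by rewrite /down linear0 rk_ipC rk_ip0l conjC0.
  have -> : rkJ (ipk s) (p :: l) = p.1 *: jv s p.2 + rkJ (ipk s) l.
    apply: rkP => v; transitivity (p.1 * jv s p.2 v + comb (ipk s) l v); last by [].
    by rewrite jvE /= /comb big_cons.
  rewrite -cat1s ev_cat IH.
  rewrite /down linearP rk_ipDr; congr (_ + _).
  by rewrite [RHS]rk_ipC rk_ipZl rmorphM /= -rk_ipC /ev big_seq1.
apply/asboolP; exists (rk_ip g g * K ^+ 2) => [|l].
  by rewrite mulr_ge0 ?rk_ip_ge0// exprn_ge0.
rewrite evE; apply: (le_trans (rk_cs _ _)); rewrite -mulrA ler_wpM2l ?rk_ip_ge0//.
rewrite -(rk_sq (down _)).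
have -> : sform (ipk s) l l = `|rkJ (ipk s) l| ^+ 2.
  by rewrite (rk_sq (rkJ (ipk s) l)) rk_ipJ.
rewrite -exprMn ler_pXn2r// ?nnegrE ?mulr_ge0//.
Qed.

Definition up (g : rkhs refl_pk) : H := MkRkhs (up_mem g).

Lemma up_lin (a : C) g h : up (a *: g + h) = a *: up g + up h.
Proof. by apply: rkP => v /=; exact: rk_ip_linl. Qed.

(** So [up] is isometric and the composite of [down] and [up] is the orthogonal
    projection on the closed span of the family. *)
Lemma down_up g : down (up g) = g.
Proof.
apply: rkP => i; rewrite /down /= ev_single conjC1 mul1r /=.
have -> : down (jv s (z i)) = rkJ refl_pk [:: (1, i)].
  by apply: rkP => j; rewrite down_jv /= /comb big_seq1 mul1r.
by rewrite rk_ipJ ev_single conjC1 mul1r.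
Qed.

Lemma up_adjoint g f : rk_ip (up g) f = rk_ip g (down f).
Proof.
have [K K0 hK] := pull_bound zc_bounded.
have cs (T : Type) (k : pkernel (Cplx R) T) (a b : rkhs k) : `|rk_ip a b| <= `|a| * `|b|.
  exact: (@hs_cs_norm R (rk_hilbert k)).
apply: (@rk_dense_eq _ _ (ipk s) (fun f => rk_ip (up g) f) (fun f => rk_ip g (down f))
  (`|up g| + `|g| * K)).
- by move=> x y; exact: (@linearBr _ _ _ _ _ _ (@rk_dot R V (ipk s))).
- move=> x y; rewrite /down linearB; exact: (@linearBr _ _ _ _ _ _ (@rk_dot R I refl_pk)).
- move=> x; apply: (le_trans (cs _ _ _ _)); rewrite mulrDl lerDl.
  by rewrite !mulr_ge0.
- move=> x; apply: (le_trans (cs _ _ _ _)); rewrite mulrDl -mulrA.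
  rewrite (le_trans (ler_wpM2l _ (hK x)))// lerDr mulr_ge0//.
- move=> l; rewrite rk_ipJ.
  elim: l => [|p l IH].
    rewrite ev_nil; have -> : rkJ (ipk s) [::] = 0.
      by apply: rkP => v /=; rewrite /comb big_nil.
    by rewrite /down linear0 rk_ipC rk_ip0l conjC0.
  have -> : rkJ (ipk s) (p :: l) = p.1 *: jv s p.2 + rkJ (ipk s) l.
    apply: rkP => v; transitivity (p.1 * jv s p.2 v + comb (ipk s) l v); last by [].
    by rewrite jvE /= /comb big_cons.
  rewrite -cat1s ev_cat IH /down linearP rk_ipDr; congr (_ + _).
  rewrite [RHS]rk_ipC rk_ipZl rmorphM /= -rk_ipC /ev big_seq1.
  by [].
Qed.

(** The reflection that fixes the orthogonal complement of the vectors [z i]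
    and changes the sign of each of them. *)
Definition refl (f : H) : H := f - (up (down f)) *+ 2.

Lemma refl_lin (a : C) f g : refl (a *: f + g) = a *: refl f + refl g.
Proof.
rewrite /refl /down linearP up_lin mulrnDl opprD addrACA; congr (_ + _).
by rewrite scalerBr scalerMnr.
Qed.

Lemma reflK f : refl (refl f) = f.
Proof.
have e : down (refl f) = - down f.
  rewrite /refl /down linearB /= linearMn /= -!/(down _) down_up mulr2n opprD addrA.
  by rewrite subrr sub0r.
rewrite {1}/refl e.
have -> : up (- down f) = - up (down f).
  have up0 : up 0 = 0.
    by apply: rkP => v; rewrite [LHS]rk_ip0l.
  by have := up_lin (-1) (down f) 0; rewrite !scaleN1r up0 !addr0.
by rewrite /refl mulNrn opprK subrK.
Qed.

Lemma refl_isom f g : rk_ip (refl f) (refl g) = rk_ip f g.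
Proof.
have dotB (a b c : H) : rk_ip (a - b) c = rk_ip a c - rk_ip b c.
  by rewrite rk_ipDl -scaleN1r rk_ipZl mulN1r.
have dotBr (a b c : H) : rk_ip c (a - b) = rk_ip c a - rk_ip c b.
  by rewrite rk_ipC dotB rmorphB /= -!rk_ipC.
have dot2 (a c : H) : rk_ip (a *+ 2) c = rk_ip a c *+ 2 by rewrite !mulr2n rk_ipDl.
have dot2r (a c : H) : rk_ip c (a *+ 2) = rk_ip c a *+ 2 by rewrite !mulr2n rk_ipDr.
have e1 : rk_ip (up (down f)) g = rk_ip (down f) (down g) by rewrite up_adjoint.
have e2 : rk_ip f (up (down g)) = rk_ip (down f) (down g).
  by rewrite rk_ipC up_adjoint -rk_ipC.
have e3 : rk_ip (up (down f)) (up (down g)) = rk_ip (down f) (down g).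
  by rewrite up_adjoint down_up.
rewrite /refl dotB !dotBr !dot2 !dot2r e1 e2 e3.
move: (rk_ip f g) (rk_ip (down f) (down g)) => a b; ring.
Qed.

(** Such a vector is the sum of half of [z i] and of a vector orthogonal to the
    whole family. *)
Lemma refl_half i v : (forall j, s v (z j) *+ 2 = s (z i) (z j)) ->
  refl (jv s v) = jv s v - jv s (z i).
Proof.
move=> h; rewrite /refl; congr (_ - _); apply: rkP => w.
have -> : (up (down (jv s v)) *+ 2) = up (down (jv s v) *+ 2).
  rewrite !mulr2n; have := up_lin 1 (down (jv s v)) (down (jv s v)).
  by rewrite !scale1r => <-.
have -> : down (jv s v) *+ 2 = rkJ refl_pk [:: (1, i)].
  apply: rkP => j; transitivity (down (jv s v) j *+ 2); first by [].
  by rewrite down_jv h /= /comb big_seq1 mul1r.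
rewrite jvE; transitivity (rk_ip (rkJ refl_pk [:: (1, i)]) (down (jv s w))); first by [].
by rewrite rk_ipC rk_ipJ ev_single conjC1 mul1r down_jv -si_herm.
Qed.

End Reflection.

(** * A unitary extending a given isometric correspondence *)
(** The space [E0 + C] of the two families is enlarged by a copy of [E0] and one
    of [C], and [flip] exchanges the old coordinates with the new ones.  The
    families [P] and [flip Q] are then orthogonal with equal Gram matrices, so
    that the reflection along the differences [P - flip Q] exchanges them;
    followed by [flip] it maps [P] to [Q]. *)
Section UnitaryExtension.
Variables (R : realType) (G : semigroupoid) (Psi : set {ptws G -> Cplx R}).
Local Notation C := (Cplx R).
Local Notation B := (Cb R (set_type Psi)).
Variables (E0 : hilbert R) (rho0 : star_rep Psi E0) (psi0 : set_type Psi).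
Local Notation ip := (hs_inner E0).

Let V1 : lmodType C := (E0 * (E0 * C))%type.
Let V2 : lmodType C := (V1 * C)%type.

Let form1 (v w : V1) : C := ip v.1 w.1 + (ip v.2.1 w.2.1 + v.2.2 * (w.2.2)^*).

Lemma form1_linl (a : C) u v w : form1 (a *: u + v) w = a * form1 u w + form1 v w.
Proof.
rewrite /form1.
have -> : (a *: u + v).1 = a *: u.1 + v.1 by [].
have -> : (a *: u + v).2.1 = a *: u.2.1 + v.2.1 by [].
have -> : (a *: u + v).2.2 = a * u.2.2 + v.2.2 by [].
have ipl x y t : ip (a *: x + y) t = a * ip x t + ip y t by exact: linearPl.
rewrite !ipl.
have alg (p q r t x y z : C) :
  a * p + q + (a * r + t + (a * x + y) * z) = a * (p + (r + x * z)) + (q + (t + y * z)).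
  by ring.
exact: alg.
Qed.

Lemma form1_herm u v : form1 u v = (form1 v u)^*.
Proof.
rewrite /form1 !rmorphD /= rmorphM /= conjCK -!hs_ipC; congr (_ + (_ + _)).
by rewrite mulrC.
Qed.

Lemma form1_ge0 u : 0 <= form1 u u.
Proof. by rewrite /form1 !addr_ge0 ?hs_ip_ge0// mul_conjC_ge0. Qed.

Let s1 : semi_inner V1 := SemiInner form1_linl form1_herm form1_ge0.

Let form2 (v w : V2) : C := s1 v.1 w.1 + v.2 * (w.2)^*.

Lemma form2_linl (a : C) u v w : form2 (a *: u + v) w = a * form2 u w + form2 v w.
Proof.
rewrite /form2.
have -> : (a *: u + v).1 = a *: u.1 + v.1 by [].
have -> : (a *: u + v).2 = a * u.2 + v.2 by [].
rewrite si_linl.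
have alg (p q x y z : C) :
  a * p + q + (a * x + y) * z = a * (p + x * z) + (q + y * z) by ring.
exact: alg.
Qed.

Lemma form2_herm u v : form2 u v = (form2 v u)^*.
Proof.
have -> : (form2 v u)^* = (s1 v.1 u.1)^* + (v.2)^* * u.2.
  have alg (p x y : C) : (p + x * y^*)^* = p^* + x^* * y by rewrite rmorphD rmorphM /= conjCK.
  exact: alg.
by rewrite /form2 -si_herm [u.2 * _]mulrC.
Qed.

Lemma form2_ge0 u : 0 <= form2 u u.
Proof. by rewrite /form2 addr_ge0 ?si_ge0// mul_conjC_ge0. Qed.

Let s2 : semi_inner V2 := SemiInner form2_linl form2_herm form2_ge0.

Let E : hilbert R := rk_hilbert (ipk s1).
Let H2 := rkhs (ipk s2).

Let inl (v : V1) : V2 := (v, 0).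

Lemma fst_zb : zbounded (ipk s2) (ipk s1) (pt (fun v : V2 => v.1)).
Proof.
apply: (@pt_zbounded _ _ _ _ _ _ 1) => // v.
by rewrite mul1r [s2 v v]/(form2 v v) /form2 lerDl mul_conjC_ge0.
Qed.

Lemma inl_zb : zbounded (ipk s1) (ipk s2) (pt inl).
Proof.
apply: (@pt_zbounded _ _ _ _ _ _ 1) => // [a u v|v].
  have e : (0 : C) = a * 0 + 0 by rewrite mulr0 addr0.
  by rewrite /inl {1}e.
by rewrite mul1r [s2 _ _]/(form2 _ _) /form2 /inl /= mul0r addr0.
Qed.

Let iota (v : E * C) : H2 := pull fst_zb v.1 + v.2 *: jv s2 (0, 1).
Let proj (g : H2) : E * C := (pull inl_zb g : E, g (0, 1)).

Lemma iotaE v w : iota v w = (v.1 : rkhs (ipk s1)) w.1 + v.2 * (w.2)^*.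
Proof.
transitivity (pull fst_zb v.1 w + v.2 * jv s2 (0, 1) w); first by [].
rewrite pull_ptE jvE [s2 _ _]/(form2 _ _) /form2 /= mul1r.
have -> : form1 0 w.1 = 0 by exact: (si_0l s1 w.1).
by rewrite add0r.
Qed.

Lemma projK g : iota (proj g) = g.
Proof.
apply: rkP => w; rewrite iotaE [(proj g).1 w.1]pull_ptE /= mulrC.
rewrite addrC -(rk_antilinear (s := s2) g w.2 (0, 1) (inl w.1)); congr (g _).
case: w => u c; transitivity ((c *: 0 + u, c * 1 + 0) : V2); first by [].
by rewrite scaler0 add0r mulr1 addr0.
Qed.

Lemma iotaK v : proj (iota v) = v.
Proof.
case: v => f z; rewrite /proj; congr (_, _).
  by apply: rkP => w; rewrite pull_ptE iotaE /= conjC0 mulr0 addr0.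
by rewrite iotaE /= rk_at0 conjC1 mulr1 add0r.
Qed.

Lemma iota_isom u v : rk_ip (iota u) (iota v) = dsum_inner (E := E) u v.
Proof.
rewrite {1}/iota rk_ipDl rk_ipZl.
rewrite (pt_adjoint fst_zb inl_zb) => [|a b]; last first.
  by rewrite [LHS]/(form2 _ _) /form2 /inl /= conjC0 mulr0 addr0.
rewrite [rk_ip (jv _ _) _]rk_ipC rk_ip_jv.
have [e1 e2] : pull inl_zb (iota v) = v.1 /\ iota v (0, 1) = v.2.
  by rewrite -[in RHS](iotaK v) -[in X in _ /\ _ = X](iotaK v).
by rewrite e1 e2.
Qed.

Lemma iota_lin (a : C) (u v : E * C) : iota (a *: u + v) = a *: iota u + iota v.
Proof.
case: u v => p x [q y].
rewrite /iota -[(a *: (p, x) + (q, y)).1]/(a *: p + q) -[(a *: (p, x) + (q, y)).2]/(a * x + y) /=.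
by rewrite linearP scalerDl scalerDr scalerA addrACA.
Qed.

Lemma proj_lin (a : C) g h : proj (a *: g + h) = a *: proj g + proj h.
Proof. by rewrite /proj linearP. Qed.

Let swap (v : V2) : V2 := ((v.1.2.1, (v.1.1, v.2)), v.1.2.2).

Lemma swap_form v w : s2 (swap v) w = s2 v (swap w).
Proof.
rewrite [LHS]/(form2 _ _) [RHS]/(form2 _ _) /form2 /= /form1 /=.
rewrite -!addrA addrCA; congr (_ + (_ + _)); exact: addrC.
Qed.

Lemma swap_lin (a : C) u v : swap (a *: u + v) = a *: swap u + swap v.
Proof. by case: u v => -[u1 [u2 c]] d [[v1 [v2 c']] d']. Qed.

Lemma swap_zb : zbounded (ipk s2) (ipk s2) (pt swap).
Proof.
apply: (@pt_zbounded _ _ _ _ _ _ 1); [exact: ler01|exact: swap_lin|] => v.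
rewrite mul1r swap_form; suff -> : swap (swap v) = v by [].
by case: v => -[a [b c]] d.
Qed.

Let flip : H2 -> H2 := pull swap_zb.

Lemma flipK g : flip (flip g) = g.
Proof.
apply: rkP => v; rewrite [LHS]pull_ptE pull_ptE; congr (g _).
by case: v => -[a [b c]] d.
Qed.

Lemma flip_isom f g : rk_ip (flip f) (flip g) = rk_ip f g.
Proof.
rewrite (pt_adjoint swap_zb swap_zb) -/flip ?flipK// => v w.
by rewrite swap_form.
Qed.

Lemma flip_jv v : flip (jv s2 v) = jv s2 (swap v).
Proof. by apply: rkP => w; rewrite [LHS]pull_ptE !jvE swap_form. Qed.

Let act (b : B) (v : V1) : V1 :=
  (rho0 (cb_conj b) v.1, (rho0 (cb_conj b) v.2.1, (b psi0)^* * v.2.2)).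

Lemma act_zb b : zbounded (ipk s1) (ipk s1) (pt (act b)).
Proof.
have M0 : 0 <= cb_norm b by exact: cb_norm_ge0.
apply: (@pt_zbounded _ _ _ _ _ _ (cb_norm b ^+ 2)) => [|a u v|v].
- exact: exprn_ge0.
- rewrite /act.
  have -> : (a *: u + v).1 = a *: u.1 + v.1 by [].
  have -> : (a *: u + v).2.1 = a *: u.2.1 + v.2.1 by [].
  have -> : (a *: u + v).2.2 = a * u.2.2 + v.2.2 by [].
  rewrite !linearP mulrDr [_ * (a * _)]mulrCA.
  by [].
- have h (x : E0) : ip (rho0 (cb_conj b) x) (rho0 (cb_conj b) x) <= cb_norm b ^+ 2 * ip x x.
    rewrite !hs_norm -exprMn ler_pXn2r ?nnegrE ?mulr_ge0//.
    by apply: rep_norm_le => // t; rewrite cb_conjE norm_conjC cb_norm_ub.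
  rewrite [s1 _ _]/(form1 _ _) [s1 v v]/(form1 _ _) /form1 /= !mulrDr.
  rewrite lerD// lerD// -!normCK normrM norm_conjC exprMn ler_wpM2r// ?exprn_ge0//.
  by rewrite ler_pXn2r ?nnegrE// cb_norm_ub.
Qed.

Lemma act_continuous b : continuous (pull (act_zb b) : E -> E).
Proof. have [M M0 hM] := pull_bound (act_zb b); exact: bounded_continuous hM. Qed.

Let rop b : bounded_op E E := @BoundedOp _ E E (pull (act_zb b)) (@act_continuous b).

Lemma ropE b (f : E) v : (rop b f : rkhs (ipk s1)) v = (f : rkhs (ipk s1)) (act b v).
Proof. exact: pull_ptE. Qed.

Definition ext_rep : star_rep Psi E.
Proof.
refine (@StarRep R G Psi E rop _ _ _ _).
- move=> c b b' f; apply: rkP => v.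
  transitivity (c * (rop b f : rkhs (ipk s1)) v + (rop b' f : rkhs (ipk s1)) v); last by [].
  have h := rk_antilinear (s := s1) f c^* (act b v) (act b' v).
  rewrite conjCK in h; rewrite !ropE -h; congr ((f : rkhs _) _).
  rewrite /act !cb_conjD !cb_conjZ !repD !repZ.
  have -> : (c *: b + b') psi0 = c * b psi0 + b' psi0 by [].
  by rewrite rmorphD rmorphM /= mulrDl -mulrA.
- move=> b b' f; apply: rkP => v; rewrite !ropE; congr ((f : rkhs _) _).
  have e : (b * b') psi0 = b psi0 * b' psi0 by [].
  rewrite /act /=; congr (_, (_, _)).
  + by rewrite cb_conjM mulrC rep_mul.
  + by rewrite cb_conjM mulrC rep_mul.
  + have alg (x y t : C) : (x * y)^* * t = y^* * (x^* * t).
      by rewrite rmorphM /= mulrA [y^* * _]mulrC.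
    by rewrite -alg -e.
- move=> f; apply: rkP => v; rewrite !ropE; congr ((f : rkhs _) _).
  have e : (1 : B) psi0 = 1 by [].
  rewrite /act cb_conj1 !rep_unit; case: v => v0 [v1 c] /=; congr (_, (_, _)).
  by rewrite -[RHS]mul1r -conjC1 -e.
- move=> b f g; apply: (pt_adjoint (act_zb b) (act_zb (cb_conj b))) => v w.
  rewrite [LHS]/(form1 _ _) [RHS]/(form1 _ _) /form1 /= !rep_conjr !cb_conjK.
  by rewrite rmorphM /= conjCK mulrCA -mulrA.
Defined.

Definition ext_inj (w : E0) : E := jv s1 (w, (0, 0)).

Lemma ext_inj_lin (a : C) u v : ext_inj (a *: u + v) = a *: ext_inj u + ext_inj v.
Proof.
rewrite /ext_inj -jv_lin; congr (jv _ _).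
transitivity ((a *: u + v, (a *: 0 + 0, a * 0 + 0)) : V1); last by [].
by rewrite scaler0 mulr0 !addr0.
Qed.

Lemma ext_inj_rep b w : ext_rep b (ext_inj w) = ext_inj (rho0 b w).
Proof.
apply: rkP => v; transitivity ((ext_inj w : rkhs (ipk s1)) (act b v)); first exact: ropE.
rewrite !jvE.
rewrite [LHS]/(form1 _ _) [RHS]/(form1 _ _) /form1 /= !mul0r !addr0.
rewrite rep_conjr cb_conjK; congr (_ + _).
by rewrite !hs_ip0l.
Qed.

Variables (I : Type) (u g : I -> E0) (d f : I -> C).
Hypothesis gram : forall i j, ip (u i) (u j) + d i * (d j)^* = ip (g i) (g j) + f i * (f j)^*.

Let P i : V2 := ((u i, (0, 0)), d i).
Let Q i : V2 := ((g i, (0, 0)), f i).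
Let z i : V2 := P i - swap (Q i).

Lemma z_half i j : s2 (P i) (z j) *+ 2 = s2 (z i) (z j).
Proof.
have sB a b c : s2 (a - b) c = s2 a c - s2 b c.
  by rewrite si_Dl -scaleN1r si_Zl mulN1r.
have sBr a b c : s2 c (a - b) = s2 c a - s2 c b.
  have cN : (-1 : C)^* = -1 by rewrite rmorphN /= conjC1.
  by rewrite si_Dr -scaleN1r si_Zr cN mulN1r.
have PQ a b : s2 (P a) (swap (Q b)) = 0.
  by rewrite [LHS]/(form2 _ _) /form2 /= /form1 /= hs_ip0l hs_ip0r !mul0r conjC0 mulr0 !addr0.
have QP a b : s2 (swap (Q b)) (P a) = 0 by rewrite si_herm PQ conjC0.
have QQ : s2 (swap (Q i)) (swap (Q j)) = s2 (P i) (P j).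
  rewrite -swap_form [LHS]/(form2 _ _) [RHS]/(form2 _ _) /form2 /= /form1 /=.
  by rewrite hs_ip0l !mul0r !addr0 gram.
by rewrite /z sB !sBr PQ QP QQ subr0 sub0r opprK mulr2n.
Qed.

Let Ufun (v : E * C) : E * C := proj (flip (refl z (iota v))).

Lemma Ufun_linear : linear Ufun.
Proof. by move=> a v w; rewrite /Ufun iota_lin refl_lin /flip linearP proj_lin. Qed.

Let Um := GRing.isLinear.Build C (E * C)%type (E * C)%type _ Ufun Ufun_linear.
Definition ext_U : {linear (E * C)%type -> (E * C)%type} := HB.pack Ufun Um.

Lemma ext_UE v : ext_U v = Ufun v.
Proof. by []. Qed.

Lemma ext_U_unitary : unitary ext_U.
Proof.
split=> [v|v w].
  exists (proj (refl z (flip (iota v)))).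
  by rewrite ext_UE /Ufun projK reflK flipK iotaK.
have hU t : iota (Ufun t) = flip (refl z (iota t)) by exact: projK.
rewrite !ext_UE; transitivity (rk_ip (iota (Ufun v)) (iota (Ufun w))).
  by symmetry; exact: iota_isom.
have e1 := flip_isom (refl z (iota v)) (refl z (iota w)).
have e2 := refl_isom z (iota v) (iota w).
exact (etrans (f_equal2 (fun a b : H2 => rk_ip a b) (hU v) (hU w))
  (etrans e1 (etrans e2 (iota_isom v w)))).
Qed.

Lemma ext_U_spec i : ext_U (ext_inj (u i), d i) = (ext_inj (g i), f i).
Proof.
have iota_j0 w c : iota (ext_inj w, c) = jv s2 ((w, (0, 0)), c).
  apply: rkP => v; transitivity (jv s1 (w, (0, 0)) v.1 + c * (v.2)^*); first exact: iotaE.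
  by rewrite !jvE.
rewrite ext_UE /Ufun iota_j0.
have -> : refl z (jv s2 (u i, (0, 0), d i)) = jv s2 (swap (Q i)).
  rewrite (refl_half (i := i)); last exact: z_half.
  apply: rkP => v.
  have -> : (jv s2 (u i, (0, 0), d i) - jv s2 (z i) : H2) v =
     jv s2 (P i) v - jv s2 (z i) v by [].
  rewrite !jvE -[s2 (P i) v - _]/(_) /z.
  by rewrite si_Dl opprD addrA subrr add0r -scaleN1r si_Zl mulN1r opprK.
rewrite flip_jv -[swap (swap (Q i))]/(Q i) -iota_j0 iotaK.
by [].
Qed.

End UnitaryExtension.

(** The space has to be enlarged, since the closed spans of the two families in
    [E0 + C] may have orthogonal complements of different dimensions. *)
Lemma unitary_extension (R : realType) (G : semigroupoid) (Psi : set {ptws G -> Cplx R})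
    (E0 : hilbert R) (rho0 : star_rep Psi E0) (I : Type) (u g : I -> E0) (d f : I -> Cplx R) :
  Psi !=set0 ->
  (forall i j, hs_inner E0 (u i) (u j) + d i * (d j)^* =
               hs_inner E0 (g i) (g j) + f i * (f j)^*) ->
  exists (E : hilbert R) (rho : star_rep Psi E)
    (U : {linear (E * Cplx R)%type -> (E * Cplx R)%type}) (j : E0 -> E),
  [/\ unitary U, forall (a : Cplx R) v w, j (a *: v + w) = a *: j v + j w,
      forall b v, rho b (j v) = j (rho0 b v) &
      forall i, U (j (u i), d i) = (j (g i), f i)].
Proof.
move=> [psi0 hpsi0] gram.
have p0 : set_type Psi by exists psi0; exact: mem_set.
exists _, (ext_rep rho0 p0), (ext_U u g d f), (@ext_inj R E0); split.
- exact: ext_U_unitary.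
- exact: ext_inj_lin.
- exact: ext_inj_rep.
- exact: ext_U_spec.
Qed.

(** * Transfer functions *)
Section ColligationFacts.
Variables (R : realType) (G : semigroupoid) (Psi : set {ptws G -> Cplx R}).
Hypothesis tPsi : test_functions Psi.
Hypothesis cPsi : compact Psi.
Local Notation C := (Cplx R).
Variable Sigma : colligation Psi.
Local Notation E := (col_space Sigma).
Local Notation A := (@colA _ _ _ Sigma).
Local Notation B := (@colB _ _ _ Sigma).
Local Notation Cc := (@colC _ _ _ Sigma).
Local Notation D := (@colD _ _ _ Sigma).
Local Notation U := (col_U Sigma).
Local Notation rE := (@rhoE R G Psi cPsi Sigma).

Lemma col_UE v z : U (v, z) = (A v + B z, Cc v + D z).
Proof.
have -> : (v, z) = (1 : C) *: (v, 0) + (0, z) :> (E * C)%type.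
  rewrite scale1r; transitivity ((v + 0, 0 + z) : (E * C)%type); last by [].
  by rewrite addr0 add0r.
by rewrite linearP scale1r.
Qed.

Lemma colA_lin (a : C) v w : A (a *: v + w) = a *: A v + A w.
Proof.
rewrite /colA; have -> : (a *: v + w, 0) = a *: (v, 0) + (w, 0) :> (E * C)%type.
  transitivity ((a *: v + w, a * 0 + 0) : (E * C)%type); last by [].
  by rewrite mulr0 addr0.
by rewrite linearP.
Qed.

Lemma colC_lin (a : C) v w : Cc (a *: v + w) = a * Cc v + Cc w.
Proof.
rewrite /colC; have -> : (a *: v + w, 0) = a *: (v, 0) + (w, 0) :> (E * C)%type.
  transitivity ((a *: v + w, a * 0 + 0) : (E * C)%type); last by [].
  by rewrite mulr0 addr0.
by rewrite linearP.
Qed.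

Lemma colB_lin (a : C) z w : B (a * z + w) = a *: B z + B w.
Proof.
rewrite /colB; have -> : (0, a * z + w) = a *: (0, z) + (0, w) :> (E * C)%type.
  transitivity ((a *: 0 + 0, a * z + w) : (E * C)%type); last by [].
  by rewrite scaler0 addr0.
by rewrite linearP.
Qed.

Lemma colBE z : B z = z *: B 1.
Proof.
have B0 : B 0 = 0 by rewrite /colB (_ : (0, 0) = 0 :> (E * C)%type)// linear0.
by have := colB_lin z 1 0; rewrite mulr1 !addr0 B0 addr0.
Qed.

Lemma colDE z : D z = z * D 1.
Proof.
rewrite /colD; have -> : (0, z) = z *: (0, 1) :> (E * C)%type.
  transitivity ((z *: 0, z * 1) : (E * C)%type); last by [].
  by rewrite scaler0 mulr1.
by rewrite linearZ.
Qed.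

(** The first column of a unitary is an isometry. *)
Lemma col_norm v : `|A v| ^+ 2 + `|Cc v| ^+ 2 = `|v| ^+ 2.
Proof.
have [_ /(_ (v, 0) (v, 0)) h] := col_unitary Sigma.
transitivity (dsum_inner (U (v, 0)) (U (v, 0))).
  by rewrite /dsum_inner hs_norm -normCK.
by rewrite h /dsum_inner hs_norm mul0r addr0.
Qed.

Lemma colA_le v : `|A v| <= `|v|.
Proof.
have h : `|A v| ^+ 2 <= `|v| ^+ 2 by rewrite -(col_norm v) lerDl exprn_ge0.
by rewrite -(@ler_pXn2r _ 2) ?nnegrE.
Qed.

Lemma colC_le v : `|Cc v| <= `|v|.
Proof.
have h : `|Cc v| ^+ 2 <= `|v| ^+ 2 by rewrite -(col_norm v) lerDr exprn_ge0.
by rewrite -(@ler_pXn2r _ 2) ?nnegrE.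
Qed.

Lemma bop_colA : bop A.
Proof. by split; [exact: colA_lin|exists 1 => // v; rewrite mul1r colA_le]. Qed.

Lemma bop_rep (b : Cb R (set_type Psi)) : bop (col_rep Sigma b).
Proof.
split=> [a v w|]; first exact: linearP.
exists (cb_norm b) => [|v]; first exact: cb_norm_ge0.
by apply: rep_norm_le => [|t]; [exact: cb_norm_ge0|exact: cb_norm_ub].
Qed.

(** Convertible to the argument of [star_inv] in [transfer]. *)
Definition resolvent (y : G) : E -> E := @opdelta R G E y \- (A \o rE y).

Lemma bop_resolvent y : bop (resolvent y).
Proof.
have -> : resolvent y = (fun v => @opdelta R G E y v + -1 *: A (rE y v)).
  by apply/funext => v; rewrite scaleN1r.
apply: bop_add; first exact: bop_opdelta.
by apply: bop_scale; apply: bop_comp; [exact: bop_colA|exact: bop_rep].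
Qed.

(** At an idempotent the value is [1 - A rho (E e)], and [|A rho (E e)| <= r < 1]. *)
Lemma resolvent_invertible : invertible_at resolvent.
Proof.
move=> e he; have [r [r0 r1 hr]] := idem_norm_lt1 tPsi cPsi he.
have Kb : bop (fun v => A (rE e v)) by apply: bop_comp; [exact: bop_colA|exact: bop_rep].
have [v|I [Ib h1 h2]] := neumann Kb r0 r1.
  by apply: (le_trans (colA_le _)); apply: rep_norm_le.
have RE v : resolvent e v = v - A (rE e v).
  by transitivity (@opdelta R G E e v - A (rE e v)); rewrite // opdeltaE mem_set.
by exists I; split=> // w; rewrite RE ?h1// h2.
Qed.

Lemma resolvent_inv :
  [/\ forall x, bop (star_inv resolvent x),
      opstar resolvent (star_inv resolvent) = @opdelta R G E &
      opstar (star_inv resolvent) resolvent = @opdelta R G E].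
Proof. exact: (star_invP bop_resolvent resolvent_invertible). Qed.

(** The transfer function is computed from the solution [gam] of
    [gam = A (rhoE * gam) + B delta], which is unique. *)
Lemma transfer_eq (gam : G -> E) (phi : G -> C) :
  (forall x, U (\sum_(p <- fac x) rE p.1 (gam p.2), delta R x) = (gam x, phi x)) ->
  phi = transfer cPsi Sigma.
Proof.
move=> h; have [Tb ST TS] := resolvent_inv.
set T := star_inv resolvent in Tb ST TS.
(* Vectors are viewed as operators from [C], to which [opstar] applies. *)
pose g' (x : G) (z : C) := z *: gam x.
pose Bd (y : G) (z : C) := delta R y *: B z.
have Sg : opstar resolvent g' = Bd.
  apply/funext => x; apply/funext => z.
  transitivity (opstar (@opdelta R G E) g' x z - A (\sum_(p <- fac x) rE p.1 (z *: gam p.2))).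
    rewrite !opstarE (bop_sumE _ _ _ bop_colA) -sumrB.
    by apply: eq_bigr => p _.
  rewrite opstar_deltal.
  have -> : \sum_(p <- fac x) rE p.1 (z *: gam p.2) =
      z *: \sum_(p <- fac x) rE p.1 (gam p.2).
    by rewrite scaler_sumr; apply: eq_bigr => p _; exact: linearZ.
  have := h x; rewrite col_UE => -[hx _].
  rewrite /g' -hx /Bd scalerDr -scaleN1r.
  have -> : A (z *: \sum_(p <- fac x) rE p.1 (gam p.2)) =
      z *: A (\sum_(p <- fac x) rE p.1 (gam p.2)).
    have := colA_lin z (\sum_(p <- fac x) rE p.1 (gam p.2)) 0.
    by rewrite (bop0 bop_colA) !addr0.
  rewrite scaleN1r addrAC subrr add0r colBE [B z]colBE !scalerA; congr (_ *: _).
  exact: mulrC.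
have Tg : opstar T Bd = g'.
  rewrite -Sg -opstarA => [|x X r u]; last exact: bop_sumE.
  by rewrite TS opstar_deltal.
apply/funext => x; rewrite /transfer -/T -/Bd.
have -> : opstar (opstar rE T) Bd x 1 = \sum_(p <- fac x) rE p.1 (gam p.2).
  rewrite opstarA => [|y X r u]; last exact: (bop_sumE _ _ _ (bop_rep _)).
  rewrite Tg opstarE; apply: eq_bigr => p _.
  by rewrite /g' scale1r.
have := h x; rewrite col_UE => -[_ <-].
by rewrite colDE addrC.
Qed.

End ColligationFacts.

Lemma kernel_transfer (R : realType) (G : semigroupoid) (Psi : set {ptws G -> Cplx R})
    (tPsi : test_functions Psi) (cPsi : compact Psi) (phi : G -> Cplx R)
    (Gam : G -> G -> dual (Cb R (set_type Psi))) :
  dual_pos_kernel setT Gam ->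
  (forall x y, kone R x y - kself phi x y = hatstar Gam (oneEE cPsi) x y) ->
  exists Sigma : colligation Psi, phi = transfer cPsi Sigma.
Proof.
move=> Gp hGam.
pose E0 := gns_space Gp; pose gam := gns_vec Gp.
pose es x : E0 := \sum_(p <- fac x) gns_rep Gp (evalB cPsi p.1) (gam p.2).
have gram x y : hs_inner E0 (es x) (es y) + delta R x * (delta R y)^* =
    hs_inner E0 (gam x) (gam y) + phi x * (phi y)^*.
  have := hatstar_gram cPsi (gns_spec Gp) x y.
  rewrite -hGam kone_kself /kself -/(es x) -/(es y).
  have alg (a b c d : Cplx R) : a - b = c - d -> d + a = c + b.
    by move=> h; rewrite -[a](subrK b) h addrA [d + _]addrC subrK.
  exact: alg.
have [E [rho [U [j [uU jl jr hU]]]]] :=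
  unitary_extension (gns_rep Gp) (tf_nonempty tPsi) gram.
exists (Colligation uU rho).
apply: (@transfer_eq R G Psi tPsi cPsi (Colligation uU rho) (fun x => j (gam x))) => x.
rewrite -hU; congr (U (_, _)).
have j0 : j 0 = 0 by have := jl (-1) 0 0; rewrite scaler0 addr0 scaleN1r addNr.
rewrite (big_morph j (id1 := 0) (op1 := +%R)) => [|v w|//].
  by apply: eq_bigr => p _; rewrite -jr.
by have := jl 1 v w; rewrite !scale1r.
Qed.

(** * Positive matrices of functions *)
Section PositiveMatrices.
Variables (R : realType) (G : semigroupoid) (Psi : set {ptws G -> Cplx R}).
Local Notation C := (Cplx R).
Local Notation B := (Cb R (set_type Psi)).
Variables (E : hilbert R) (rho : star_rep Psi E).
Local Notation ip := (hs_inner E).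

Lemma cb_sumE (I : Type) (r : seq I) (f : I -> B) t :
  (\sum_(i <- r) f i) t = \sum_(i <- r) f i t.
Proof. exact: (big_morph (fun b : B => b t)). Qed.

(** Gaussian elimination: subtracting the square of the first row leaves a
    positive matrix with one row less, both for the scalar matrices at the
    points [t] and for the form defined through [rho]. *)
Lemma pos_matrix_strict (X : eqType) (e : C) (l : seq X) (K : X -> X -> B) (m : X -> E) :
  uniq l -> 0 < e -> (forall i j, K j i = cb_conj (K i j)) ->
  (forall t (z : X -> C), e * \sum_(i <- l) `|z i| ^+ 2 <=
     \sum_(i <- l) \sum_(j <- l) (z i)^* * (K i j t * z j)) ->
  0 <= \sum_(i <- l) \sum_(j <- l) ip (rho (K i j) (m j)) (m i).
Proof.
move=> + e0; elim: l K => [|a l IH] K; first by rewrite big_nil.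
rewrite cons_uniq => /andP[al ul] Kh hyp.
pose s t (z : X -> C) := \sum_(j <- l) K a j t * z j.
pose q t (z : X -> C) := \sum_(i <- l) \sum_(j <- l) (z i)^* * (K i j t * z j).
have hyp' t (c : C) (z : X -> C) : e * (`|c| ^+ 2 + \sum_(i <- l) `|z i| ^+ 2) <=
    c^* * (K a a t * c) + c^* * s t z + ((s t z)^* * c + q t z).
  have := hyp t (fun i => if i == a then c else z i).
  have ll (V : zmodType) (F F' : X -> V) : (forall x, x != a -> F x = F' x) ->
      \sum_(i <- l) F i = \sum_(i <- l) F' i.
    move=> FF; apply: eq_big_seq => i il; apply: FF; apply: contraNneq al => <-.
    by [].
  congr (e * _ <= _).
    rewrite big_cons eqxx; congr (_ + _); apply: (ll C) => x /negPf -> //.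
  rewrite big_cons big_cons eqxx; congr (_ + _ + _).
    by rewrite /s mulr_sumr; apply: (ll C) => x /negPf ->.
  have -> : (s t z)^* * c = \sum_(i <- l) (z i)^* * (K i a t * c).
    rewrite /s rmorph_sum mulr_suml; apply: eq_bigr => i _.
    rewrite rmorphM /= (Kh a i) cb_conjE.
    by rewrite mulrA [_ * (z i)^*]mulrC.
  rewrite -big_split /=; apply: (ll C) => i /negPf ->.
  by rewrite big_cons eqxx; congr (_ + _); apply: (ll C) => j /negPf ->.
have Kaa t : e <= K a a t.
  have := hyp' t 1 (fun=> 0).
  have -> : q t (fun=> 0) = 0.
    by rewrite /q big1// => i _; rewrite big1// => j _; rewrite conjC0 mul0r.
  have -> : s t (fun=> 0) = 0 by rewrite /s big1// => j _; rewrite mulr0.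
  rewrite big1 => [|i _]; last by rewrite normr0 expr0n.
  by rewrite normr1 expr1n conjC0 !addr0 conjC1 !mul1r mul0r !mulr1 !addr0.
have [b [b0 bK]] := cb_inv e0 Kaa.
have [r [rr rb]] := cb_sqrt b0.
have rc : cb_conj r = r by apply: cb_ext => t; rewrite cb_conjE rr.
have bc : cb_conj b = b by rewrite -rb cb_conjM rc.
pose K' i j := K i j - K i a * b * K a j.
have h1 i j : K' j i = cb_conj (K' i j).
  rewrite /K' cb_conjB !cb_conjM bc -!Kh; congr (_ - _).
  by rewrite [RHS]mulrC mulrA [RHS]mulrAC -mulrA [b * _]mulrC mulrA mulrAC.
have h2 : 0 <= \sum_(i <- l) \sum_(j <- l) ip (rho (K' i j) (m j)) (m i).
  apply: IH => // t z.
  have bKt : b t * K a a t = 1.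
    have -> : b t * K a a t = (b * K a a) t by [].
    by rewrite bK.
  have bt : (b t)^* = b t by rewrite -cb_conjE bc.
  have := hyp' t (- (b t * s t z)) z.
  have -> : (- (b t * s t z))^* * (K a a t * - (b t * s t z)) +
      (- (b t * s t z))^* * s t z + ((s t z)^* * - (b t * s t z) + q t z) =
      q t z - (s t z)^* * (b t * s t z).
    rewrite rmorphN rmorphM /= bt.
    have alg (x y k u v : C) : x * k = 1 -> - (x * u) * (k * - (x * v)) +
       - (x * u) * v + (u * - (x * v) + y) = y - u * (x * v).
      move=> xk; have -> : - (x * u) * (k * - (x * v)) = (x * k) * (u * (x * v)) by ring.
      by rewrite xk; ring.
    exact: alg.
  have -> : q t z - (s t z)^* * (b t * s t z) =
      \sum_(i <- l) \sum_(j <- l) (z i)^* * (K' i j t * z j).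
    rewrite {2}/s rmorph_sum mulr_suml -sumrB; apply: eq_bigr => i _.
    rewrite /s mulr_sumr mulr_sumr -sumrB; apply: eq_bigr => j _.
    have -> : K' i j t = K i j t - K i a t * b t * K a j t by [].
    rewrite rmorphM /= (Kh a i) cb_conjE.
    move: (K i j t) (z i)^* (z j) (K a j t) (b t) (K a i t)^* => k1 k2 k3 k4 k5 k6.
    by ring.
  apply: le_trans; rewrite ler_pM2l// lerDr.
  exact: exprn_ge0.
(* The first row applied to [m]; the eliminated square is the squared norm of
   [rho r w], where [r] is the inverse square root of the pivot. *)
pose w := rho (K a a) (m a) + \sum_(j <- l) rho (K a j) (m j).
have := addr_ge0 (hs_ip_ge0 (rho r w)) h2.
congr (0 <= _).
have swap u v c d : ip (rho c u) (rho d v) = ip (rho (cb_conj d * c) u) v.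
  by rewrite rep_conjr -rep_mul.
have bw : rho b w = m a + \sum_(j <- l) rho (b * K a j) (m j).
  rewrite /w linearD /= -rep_mul bK rep_unit linear_sum; congr (_ + _).
  by apply: eq_bigr => j _; rewrite rep_mul.
rewrite swap rc rb bw {bw} /w.
rewrite hs_ipDl !hs_ipDr hs_ip_suml hs_ip_sumr.
rewrite big_cons big_cons -!addrA; congr (_ + _).
  by rewrite rep_conjr -Kh.
rewrite addrCA; congr (_ + _).
  apply: eq_bigr => j _.
  by rewrite swap -Kh mulrA [K a a * b]mulrC bK mul1r.
rewrite hs_ip_sumr -!big_split /=; apply: eq_bigr => i _.
rewrite big_cons rep_conjr -Kh; congr (_ + _).
rewrite hs_ip_suml -big_split; apply: eq_bigr => j _ /=.
rewrite swap -Kh mulrA -hs_ipDl -repD; congr (ip (rho _ _) _).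
by rewrite /K' addrC subrK.
Qed.

(** A multiple [e] of the identity is added to allow elimination; then [e] tends
    to zero. *)
Lemma pos_matrix (X : Type) (l : seq X) (K : X -> X -> B) (m : X -> E) :
  (forall t, kpos (fun x y => K x y t)) ->
  0 <= \sum_(x <- l) \sum_(y <- l) ip (rho (K x y) (m y)) (m x).
Proof.
case: l => [|x0 l'] kp; first by rewrite big_nil.
set l := x0 :: l'.
have Kh x y : K y x = cb_conj (K x y).
  apply: cb_ext => t; rewrite cb_conjE.
  have := sform_herm (kp t) [:: (1, x)] [:: (1, y)].
  by rewrite /sform !ev_single conjC1 !mul1r /comb !big_seq1 /= !mul1r.
pose S := \sum_(x <- l) ip (m x) (m x).
set Q := \sum_(x <- l) _.
have h (e : C) : 0 < e -> 0 <= Q + e * S.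
  move=> e0.
  pose Ke (i j : nat) : B := K (nth x0 l i) (nth x0 l j) + (if i == j then e else 0) *: (1 : B).
  have iE : iota 0 (size l) = index_iota 0 (size l) by rewrite /index_iota subn0.
  have split (V : nmodType) (F : nat -> V) i : i \in iota 0 (size l) ->
      \sum_(j <- iota 0 (size l)) (if i == j then F j else 0) = F i.
    move=> il; rewrite -big_mkcond /= -big_filter.
    rewrite (eq_filter (a2 := @pred1 nat i)) => [|j]; last by rewrite /= eq_sym.
    by rewrite (filter_pred1_uniq (iota_uniq _ _) il) big_seq1.
  have : 0 <= \sum_(i <- iota 0 (size l)) \sum_(j <- iota 0 (size l))
      ip (rho (Ke i j) (m (nth x0 l j))) (m (nth x0 l i)).
    apply: (@pos_matrix_strict nat e (iota 0 (size l)) Ke (fun i => m (nth x0 l i)));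
      [exact: iota_uniq|exact: e0|move=> i j|move=> t z].
  - rewrite /Ke cb_conjD cb_conjZ cb_conj1 -Kh eq_sym; congr (_ + _ *: _).
    case: (_ == _); last by rewrite conjC0.
    by rewrite geC0_conj// ltW.
  - have -> : \sum_(i <- iota 0 (size l)) \sum_(j <- iota 0 (size l))
        (z i)^* * (Ke i j t * z j) =
      \sum_(i <- iota 0 (size l)) \sum_(j <- iota 0 (size l))
        (z i)^* * (K (nth x0 l i) (nth x0 l j) t * z j) +
      e * \sum_(i <- iota 0 (size l)) `|z i| ^+ 2.
      rewrite mulr_sumr -big_split; apply: eq_big_seq => i il /=.
      rewrite -(split _ (fun j => e * `|z j| ^+ 2) i il) -big_split; apply: eq_bigr => j _ /=.
      transitivity ((z i)^* * ((K (nth x0 l i) (nth x0 l j) t + (if i == j then e else 0) * 1) * z j)).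
        by [].
      rewrite mulr1 mulrDl mulrDr; congr (_ + _); case: eqP => [->|_]; last by rewrite mul0r mulr0.
      by rewrite normCK mulrCA [z j * _]mulrC.
    rewrite lerDr; have := kp t [seq (z i, nth x0 l i) | i <- iota 0 (size l)].
    congr (0 <= _); rewrite /sform /ev /comb big_map; apply: eq_bigr => i _.
    rewrite big_map mulr_sumr; apply: eq_bigr => j _.
    by rewrite /= [z j * _]mulrC.
  - congr (0 <= _); rewrite /Q /S.
    rewrite [in RHS](big_nth x0) [X in _ + _ * X](big_nth x0) -iE mulr_sumr -big_split.
    apply: eq_big_seq => i il /=; rewrite (big_nth x0) -iE.
    rewrite -(split _ (fun j => e * ip (m (nth x0 l j)) (m (nth x0 l j))) i il) -big_split.
    apply: eq_bigr => j _ /=; rewrite /Ke repD repZ rep_unit hs_ipDl hs_ipZl; congr (_ + _).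
    by case: eqP => [->|_]; rewrite ?mul0r.
have c1 : (fun n : nat => Q + n.+1%:R^-1 * S) @ \oo --> (Q + 0 * S : C).
  apply: cvgDC; first exact: cvg_cstC.
  by apply: cvgMC; [exact: harmonicC|exact: cvg_cstC].
rewrite mul0r addr0 in c1; apply: (cvg_ge0 c1); apply: nearW => n.
by apply: h; rewrite invr_gt0 ltr0n.
Qed.

End PositiveMatrices.

(** * The kernel condition for transfer functions *)

(** Riesz representation: the conjugate of a bounded functional belongs to the
    function space whose kernel is the inner product. *)
Lemma riesz (R : realType) (E : hilbert R) (f : E -> Cplx R) (M : Cplx R) :
  (forall (a : Cplx R) v w, f (a *: v + w) = a * f v + f w) ->
  0 <= M -> (forall v, `|f v| <= M * `|v|) -> exists w, forall v, f v = hs_inner E v w.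
Proof.
move=> fl M0 fM.
have ipl (a : Cplx R) (u v w : E) : hs_inner E (a *: u + v) w = a * hs_inner E u w + hs_inner E v w.
  exact: linearPl.
pose s : semi_inner E := SemiInner ipl (@hs_ipC R E) (@hs_ip_ge0 R E).
have f0 : f 0 = 0 by have := fl (-1) 0 0; rewrite scaler0 addr0 mulN1r addNr.
have evF l : ev (fun v => (f v)^*) l = (f (lincomb l))^*.
  rewrite /ev /lincomb; elim: l => [|p l IH]; first by rewrite !big_nil f0 conjC0.
  by rewrite !big_cons IH fl rmorphD rmorphM.
have FP : (fun v => (f v)^*) \in rk_pred (ipk s).
  apply/asboolP; exists (M ^+ 2) => [|l]; first exact: exprn_ge0.
  rewrite evF norm_conjC [sform _ _ _]ikernel_sform [s _ _]hs_norm -exprMn.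
  by rewrite ler_pXn2r ?nnegrE ?mulr_ge0.
pose F : rkhs (ipk s) := MkRkhs FP.
have jn v w : `|jv s v - jv s w| = `|v - w|.
  have -> : jv s v - jv s w = jv s (v - w).
    have := jv_lin s (-1) w v; rewrite !scaleN1r [- w + v]addrC => ->.
    by rewrite addrC.
  apply/eqP; rewrite -(@eqrXn2 _ 2)// (rk_sq (jv s _)) rk_ip_jv jvE.
  by rewrite [s _ _]hs_norm.
have near (n : nat) : exists v : E, `|F - jv s v| <= n.+1%:R^-1.
  have [|l hl] := @rk_dense _ _ (ipk s) F n.+1%:R^-1; first by rewrite invr_gt0 ltr0n.
  exists (lincomb l); have <- : rkJ (ipk s) l = jv s (lincomb l); last exact: hl.
  apply: rkP => t; rewrite jvE; have := ikernel_sform s l [:: (1, t)].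
  by rewrite /sform ev_single conjC1 mul1r {2}/lincomb big_seq1 scale1r.
have [v hv] := choice near.
have cn : (fun n : nat => n.+1%:R^-1 : Cplx R) @ \oo --> (0 : Cplx R) by exact: harmonicC.
have cv : cvg (v @ \oo).
  apply: cauchy_cvg; apply/cauchyP => e e0.
  have e2 : 0 < e / 2 by rewrite divr_gt0.
  have /cvgrPdist_lt/(_ _ e2)[N _ hN] := cn.
  exists (v N), N => // n /= Nn; rewrite -ball_normE /ball_ /= -jn.
  have hh k : (N <= k)%N -> `|F - jv s (v k)| < e / 2.
    move=> Nk; apply: le_lt_trans (hv k) _; have := hN k Nk.
    by rewrite /= sub0r normrN ger0_norm// invr_ge0 ler0n.
  rewrite -(subrK F (jv s (v N))) -addrA (splitr e).
  apply: (le_lt_trans (ler_normD _ _)); apply: ltrD; last exact: hh.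
  by rewrite distrC; exact: hh.
have [w vw] : exists w : E, v @ \oo --> w by exists (lim (v @ \oo)); exact: cv.
have Fw : F = jv s w.
  apply/eqP; rewrite -subr_eq0 -normr_le0.
  have c2 : (fun n : nat => n.+1%:R^-1 + `|v n - w|) @ \oo --> (0 + 0 : Cplx R).
    apply: cvgDC; first exact: cn.
    apply/cvgrPdist_lt => e e0.
    have /cvgrPdist_lt/(_ e e0) := vw; apply: filterS => n h.
    by rewrite sub0r normrN normr_id distrC.
  have c3 : (fun=> `|F - jv s w|) @ \oo --> (`|F - jv s w| : Cplx R) by exact: cvg_cstC.
  rewrite addr0 in c2; apply: (cvg_leC c3 c2); apply: nearW => n.
  rewrite -(subrK (jv s (v n)) F) -addrA.
  by apply: (le_trans (ler_normD _ _)); apply: lerD; [exact: hv|rewrite jn].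
exists w => u; rewrite -[LHS]conjCK -[(f u)^*]/(F u) Fw jvE.
by rewrite [s w u]hs_ipC conjCK.
Qed.

Section TransferKernel.
Variables (R : realType) (G : semigroupoid) (Psi : set {ptws G -> Cplx R}).
Hypothesis tPsi : test_functions Psi.
Hypothesis cPsi : compact Psi.
Local Notation C := (Cplx R).
Variable Sigma : colligation Psi.
Local Notation E := (col_space Sigma).
Local Notation A := (@colA _ _ _ Sigma).
Local Notation B := (@colB _ _ _ Sigma).
Local Notation Cc := (@colC _ _ _ Sigma).
Local Notation D := (@colD _ _ _ Sigma).
Local Notation U := (col_U Sigma).
Local Notation rho := (col_rep Sigma).
Local Notation rE := (@rhoE R G Psi cPsi Sigma).
Local Notation ip := (hs_inner E).
Local Notation T := (star_inv (@resolvent R G Psi cPsi Sigma)).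

Let Rr : G -> E -> E := opstar rE T.

Lemma bop_Rr x : bop (Rr x).
Proof.
have [Tb _ _] := resolvent_inv tPsi cPsi Sigma.
have -> : Rr x = (fun v => \sum_(p <- fac x) rE p.1 (T p.2 v)).
  by apply/funext => v; rewrite /Rr opstarE.
by apply: bop_sum => p; apply: bop_comp; [exact: bop_rep|exact: Tb].
Qed.

(** Multiply [R = rho(E) * T] by the function whose star-inverse is [T]. *)
Lemma Rr_fix x v : Rr x v = rE x v + \sum_(p <- fac x) Rr p.1 (A (rE p.2 v)).
Proof.
have [Tb ST TS] := resolvent_inv tPsi cPsi Sigma.
have h : opstar Rr (@resolvent R G Psi cPsi Sigma) = rE.
  rewrite /Rr opstarA => [|y X r u]; last exact: (bop_sumE _ _ _ (bop_rep _ _)).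
  rewrite TS; apply: opstar_deltar => y; exact: (bop0 (bop_rep _ _)).
rewrite -[in rE x v]h opstarE.
have -> : \sum_(p <- fac x) Rr p.1 (@resolvent R G Psi cPsi Sigma p.2 v) =
    opstar Rr (@opdelta R G E) x v - \sum_(p <- fac x) Rr p.1 (A (rE p.2 v)).
  by rewrite opstarE -sumrB; apply: eq_bigr => p _; rewrite -bopB//; exact: bop_Rr.
rewrite opstar_deltar ?subrK// => y; exact: (bop0 (bop_Rr y)).
Qed.

Lemma transferE x : transfer cPsi Sigma x = delta R x * D 1 + Cc (Rr x (B 1)).
Proof.
rewrite /transfer; congr (_ + Cc _); rewrite opstarE.
transitivity (opstar Rr (@opdelta R G E) x (B 1)).
  rewrite opstarE; apply: eq_bigr => p _; congr (Rr _ _).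
rewrite opstar_deltar// => y; exact: (bop0 (bop_Rr y)).
Qed.

(** The row [(Cc (Rr x), delta x)] is represented by a vector, by [riesz]; its
    product with [U] is then represented by the preimage of that vector. *)
Lemma row_vectors : exists (c l : G -> E), [/\
  forall x v, Cc (Rr x v) = ip v (c x),
  forall x v, Cc (Rr x (A v)) + delta R x * Cc v = ip v (l x) &
  forall x y, ip (l x) (l y) + (transfer cPsi Sigma x)^* * transfer cPsi Sigma y =
    ip (c x) (c y) + delta R x * delta R y].
Proof.
have [uS uI] := col_unitary Sigma.
have cex x : exists w, forall v, Cc (Rr x v) = ip v w.
  have [Rl [M M0 RM]] := bop_Rr x.
  apply: (@riesz R E (fun v => Cc (Rr x v)) M) => [a v w||v] //.
    by rewrite Rl colC_lin.
  exact: le_trans (colC_le _) (RM _).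
have [c hc] := choice cex.
have dr x : (delta R x)^* = delta R x by rewrite /delta conjC_nat.
have lex x : exists w, U w = (c x, delta R x) by exact: uS.
have [w hw] := choice lex.
have key x v z : Cc (Rr x (A v + B z)) + delta R x * (Cc v + D z) =
    ip v (w x).1 + z * ((w x).2)^*.
  have := uI (v, z) (w x); rewrite hw col_UE /dsum_inner /= dr => <-.
  by rewrite -hc [_ * delta R x]mulrC.
have w2 x : ((w x).2)^* = transfer cPsi Sigma x.
  have := key x 0 1.
  rewrite (bop0 (bop_colA Sigma)) add0r hs_ip0l add0r mul1r => <-.
  rewrite transferE addrC; congr (_ * _ + _).
  have := colC_lin (Sigma := Sigma) (-1) 0 0.
  by rewrite scaler0 addr0 mulN1r addNr => ->; rewrite add0r.
have B0 : B 0 = 0 by rewrite colBE scale0r.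
have D0 : D 0 = 0 by rewrite colDE mul0r.
exists c, (fun x => (w x).1); split=> // [x v|x y].
  by have := key x v 0; rewrite B0 D0 !addr0 mul0r addr0.
rewrite -!w2 conjCK; have := uI (w x) (w y).
by rewrite !hw /dsum_inner /= dr => ->.
Qed.

(** By [row_vectors] and [Rr_fix], [c] is the star product of [l] with the
    adjoint of [rho(E)], so that [[1] - phi phi^*] is the sum [defect] of the
    values of [rho] at [[1] - E E^*] between the vectors [l].  Reassociating,
    its product with [k] contains the function-valued matrix [K], positive at
    each test function. *)
Lemma transfer_kernel : kernel_condition Psi (transfer cPsi Sigma).
Proof.
have [c [l [hc hl hcl]]] := row_vectors.
set phi := transfer cPsi Sigma in hcl *.
have cE x : c x = \sum_(p <- fac x) rho (cb_conj (evalB cPsi p.2)) (l p.1).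
  apply: hs_extr => v; rewrite hs_ip_sumr -hc Rr_fix.
  rewrite [RHS](eq_bigr (fun p => Cc (Rr p.1 (A (rE p.2 v))) + delta R p.1 * Cc (rE p.2 v)));
    last by move=> p _; rewrite rep_conjr cb_conjK -hl.
  rewrite big_split /= addrC; have := colC_lin (Sigma := Sigma) 1 (rE x v).
  move=> /(_ (\sum_(p <- fac x) Rr p.1 (A (rE p.2 v)))).
  rewrite scale1r mul1r => ->; congr (_ + _).
    under eq_bigr do rewrite {1}/delta mulr_natl mulrb.
    by rewrite -big_mkcond (fac_lunit x (fun p => Cc (rE p.2 v))).
  apply: (big_morph Cc) => [u u'|].
    by have := colC_lin (Sigma := Sigma) 1 u u'; rewrite scale1r mul1r.
  by have := colC_lin (Sigma := Sigma) (-1) 0 0; rewrite scaler0 addr0 mulN1r addNr.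
have defect a b : (@kone R G - kself phi) a b =
    \sum_(p <- fac a) \sum_(q <- fac b) ip (rho (oneEE cPsi p.2 q.2) (l q.1)) (l p.1).
  have e (p q : G * G) : ip (rho (oneEE cPsi p.2 q.2) (l q.1)) (l p.1) =
      delta R p.2 * (delta R q.2 * ip (l q.1) (l p.1)) -
      ip (rho (cb_conj (evalB cPsi q.2)) (l q.1)) (rho (cb_conj (evalB cPsi p.2)) (l p.1)).
    rewrite /oneEE repB linearBl /= repZ hs_ipZl rep_unit koneE mulrA; congr (_ - _).
    by rewrite /EE rep_mul rep_conj.
  under eq_bigr => p _ do [under eq_bigr => q _ do rewrite e; rewrite sumrB].
  rewrite sumrB.
  have -> : \sum_(p <- fac a) \sum_(q <- fac b)
      delta R p.2 * (delta R q.2 * ip (l q.1) (l p.1)) = ip (l b) (l a).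
    under eq_bigr => p _.
      rewrite -mulr_sumr.
      under eq_bigr do rewrite {1}/delta mulr_natl mulrb.
      rewrite -big_mkcond (fac_runit b (fun q => ip (l q.1) (l p.1))) /= /delta mulr_natl mulrb.
      over.
    by rewrite -big_mkcond (fac_runit a (fun p => ip (l b) (l p.1))).
  have -> : \sum_(p <- fac a) \sum_(q <- fac b)
      ip (rho (cb_conj (evalB cPsi q.2)) (l q.1)) (rho (cb_conj (evalB cPsi p.2)) (l p.1)) =
      ip (c b) (c a).
    rewrite (cE b) (cE a) hs_ip_sumr; apply: eq_bigr => p _.
    by rewrite hs_ip_suml.
  transitivity (kone R a b - phi a * (phi b)^*); first by [].
  rewrite koneE; have := hcl b a.
  have alg (x y z t u v : C) : x + y * z = t + u * v -> v * u - z * y = x - t.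
    by move=> h; rewrite -[x](addrK (y * z)) h; ring.
  exact: alg.
move=> k [kp kpsi]; apply: kpos_pos_kernel.
pose K (x y : G) : Cb R (set_type Psi) :=
  \sum_(p <- fac x) \sum_(q <- fac y) k p.2 q.2 *: oneEE cPsi p.1 q.1.
have KE x y t : K x y t = kstar (@kone R G - kself (\val t)) k x y.
  rewrite /K cb_sumE kstarE; apply: eq_bigr => p _.
  rewrite cb_sumE; apply: eq_bigr => q _.
  transitivity (k p.2 q.2 *
    (kone R p.1 q.1 * 1 - (\val t : G -> C) p.1 * ((\val t : G -> C) q.1)^*)); first by [].
  by rewrite mulr1 mulrC.
have Kk t : kpos (fun x y => K x y t).
  have -> : (fun x y => K x y t) = kstar (@kone R G - kself (\val t)) k.
    by apply/funext => x; apply/funext => y; exact: KE.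
  by apply: pos_kernel_kpos; apply: kpsi; exact: set_valP.
have main x y : kstar (@kone R G - kself phi) k x y =
    \sum_(p <- fac x) \sum_(q <- fac y) ip (rho (K p.2 q.2) (l q.1)) (l p.1).
  rewrite kstarE.
  pose H a b d := \sum_(q <- fac y) \sum_(q' <- fac q.1)
    ip (rho (oneEE cPsi b q'.2) (l q'.1)) (l a) * k d q.2.
  transitivity (\sum_(p <- fac x) \sum_(p' <- fac p.1) H p'.1 p'.2 p.2).
    apply: eq_bigr => p _; rewrite /H exchange_big /=; apply: eq_bigr => q _.
    rewrite defect mulr_suml; apply: eq_bigr => p' _.
    by rewrite mulr_suml.
  rewrite (fac_assoc x H); apply: eq_bigr => p _.
  rewrite /H; under eq_bigr => p' _ do
    rewrite (fac_assoc y (fun a b d =>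
      ip (rho (oneEE cPsi p'.1 b) (l a)) (l p.1) * k p'.2 d)).
  rewrite exchange_big /=; apply: eq_bigr => q _.
  have rsum (I : Type) (r : seq I) (f : I -> Cb R (set_type Psi)) v :
      rho (\sum_(i <- r) f i) v = \sum_(i <- r) rho (f i) v.
    by apply: (big_morph (fun b => rho b v)) => [b b'|]; [exact: repD|exact: rep0].
  rewrite /K rsum hs_ip_suml; apply: eq_bigr => p' _.
  rewrite rsum hs_ip_suml; apply: eq_bigr => q' _.
  by rewrite repZ hs_ipZl mulrC.
move=> L.
pose L3 : seq (G * E) := flatten [seq [seq (p.2, a.1 *: l p.1) | p <- fac a.2] | a <- L].
have := @pos_matrix _ _ _ _ rho _ L3 (fun s t => K s.1 t.1) (fun s => s.2).
have Kk3 t : kpos (fun s s' : G * E => K s.1 s'.1 t).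
  move=> m; have := Kk t [seq (p.1, p.2.1) | p <- m].
  congr (0 <= _); rewrite /sform /ev /comb big_map; apply: eq_bigr => p _.
  by rewrite big_map.
move=> /(_ Kk3); congr (0 <= _).
rewrite /L3 big_flatten big_map; apply: eq_bigr => a _.
rewrite big_map /comb mulr_sumr.
under eq_bigr => p _ do rewrite big_flatten big_map.
rewrite exchange_big /=; apply: eq_bigr => b _.
rewrite main mulr_sumr mulr_sumr; apply: eq_bigr => p _.
rewrite big_map mulr_sumr mulr_sumr; apply: eq_bigr => q _ /=.
have -> : rho (K p.2 q.2) (b.1 *: l q.1) = b.1 *: rho (K p.2 q.2) (l q.1) by exact: linearZ.
by rewrite hs_ipZl hs_ipZr mulrCA.
Qed.

End TransferKernel.

(** * The equivalence *)
Section Exhaustion.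
Variables (R : realType) (G : semigroupoid) (Psi : set {ptws G -> Cplx R}).
Variables (tPsi : test_functions Psi) (cPsi : compact Psi).
Local Notation C := (Cplx R).
Local Notation B := (Cb R (set_type Psi)).

(** Eventually means: for all large finite sets and all large integers, the
    integers measuring accuracy. *)
Definition exhaust : set_system ({fset G} * nat) :=
  [set P | exists A N, forall F n, (A `<=` F)%fset -> (N <= n)%N -> P (F, n)].

Instance exhaust_proper : ProperFilter exhaust.
Proof.
split=> [[A [N h]]|]; first exact: (h A N).
split=> [|P Q [A [N h]] [A' [N' h']]|P Q PQ [A [N h]]].
- by exists fset0, 0%N.
- exists (A `|` A')%fset, (maxn N N') => F n; rewrite fsubUset geq_max.
  by move=> /andP[AF AF'] /andP[Nn Nn']; split; [exact: h|exact: h'].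
- by exists A, N => F n AF Nn; apply: PQ; exact: h.
Qed.

Lemma exhaust_pair (x y : G) (Q : {fset G} * nat -> Prop) (N : nat) :
  (forall F n, x \in F -> y \in F -> (N <= n)%N -> Q (F, n)) -> \forall i \near exhaust, Q i.
Proof.
move=> h; exists [fset x; y]%fset, N => F n /fsubsetP xyF; apply: h.
  by apply: xyF; rewrite !inE eqxx.
by apply: xyF; rewrite !inE eqxx orbT.
Qed.

Lemma kernel_condition_decomposition (phi : G -> C) : kernel_condition Psi phi ->
  exists2 Gam : G -> G -> dual B, dual_pos_kernel setT Gam &
  forall x y, kone R x y - kself phi x y = hatstar Gam (oneEE cPsi) x y.
Proof.
move=> hphi.
have ap (i : {fset G} * nat) : exists Gam : G -> G -> dual B, dual_pos_kernel setT Gam /\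
    forall x y, x \in i.1 -> y \in i.1 ->
      `|kone R x y - kself phi x y - hatstar Gam (oneEE cPsi) x y| <= i.2.+1%:R^-1.
  have e0 : 0 < i.2.+1%:R^-1 :> C by rewrite invr_gt0 ltr0n.
  have [Gam Gp h] := approx_decomp tPsi cPsi (@lower_closure_lower G i.1) hphi e0.
  exists Gam; split=> // x y xi yi.
  by apply: h; apply: (fsubsetP (sub_lower_closure i.1)).
have [Gam hGam] := choice ap.
apply: (@limit_kernel R G Psi tPsi cPsi _ exhaust exhaust_proper Gam
  (fun x y => kone R x y - kself phi x y) (fun i => (hGam i).1)) => x y.
apply/cvgrPdist_lt => e e0.
have cn : (fun n : nat => n.+1%:R^-1 : C) @ \oo --> (0 : C) by exact: harmonicC.
have /cvgrPdist_lt/(_ e e0)[N _ hN] := cn.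
apply: (@exhaust_pair x y _ N) => F n xF yF Nn.
apply: le_lt_trans ((hGam (F, n)).2 x y xF yF) _.
by have := hN n Nn; rewrite /= sub0r normrN ger0_norm.
Qed.

(** The factors of the elements of a lower set belong to it, so that the values
    outside do not enter the products. *)
Lemma zero_extension (A : {fset G}) (Gam : G -> G -> dual B) :
  lower [set` A] -> dual_pos_kernel [set` A] Gam ->
  exists2 Gam' : G -> G -> dual B, dual_pos_kernel setT Gam' &
  forall x y, x \in A -> y \in A ->
    hatstar Gam' (oneEE cPsi) x y = hatstar Gam (oneEE cPsi) x y.
Proof.
move=> lA Gp.
have [Z hZ] : exists Z : dual B, forall b, Z b = 0.
  by apply: (@dual_ex R G Psi (fun=> 0) 0) => [a b c|b]; rewrite ?mulr0 ?addr0// normr0 mul0r.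
pose Gam' x y : dual B := if (x \in A) && (y \in A) then Gam x y else Z.
exists Gam' => [D f _|x y xA yA].
  have := Gp [fset x in D | x \in A]%fset f.
  have sA : [set` [fset x in D | x \in A]%fset] `<=` [set` A].
    by move=> x /=; rewrite !inE => /andP[].
  move=> /(_ sA); congr (0 <= _).
  rewrite big_fset /= [LHS]big_mkcond; apply: eq_bigr => x _.
  rewrite /Gam'; case: (x \in A) => /=; last by rewrite big1.
  rewrite big_fset /= big_mkcond; apply: eq_bigr => y _.
  by case: (y \in A).
have right p x' : x' \in A -> p \in fac x' -> p.2 \in A.
  move=> x'A /facP px; apply: (lA x') => //.
  exact: sg_le_fac2 px.
rewrite !hatstarE; apply: eq_big_seq => p px; apply: eq_big_seq => q qy.
by rewrite /Gam' (right p x)// (right q y).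
Qed.

Lemma decomposition_exhaustion (K : G -> G -> C) :
  (forall F : {fset G}, lower [set` F] ->
     exists2 Gam : G -> G -> dual B, dual_pos_kernel [set` F] Gam &
     forall x y, x \in F -> y \in F -> K x y = hatstar Gam (oneEE cPsi) x y) ->
  exists2 Gam : G -> G -> dual B, dual_pos_kernel setT Gam &
  forall x y, K x y = hatstar Gam (oneEE cPsi) x y.
Proof.
move=> h.
have ex (i : {fset G} * nat) : exists Gam : G -> G -> dual B, dual_pos_kernel setT Gam /\
    forall x y, x \in i.1 -> y \in i.1 -> K x y = hatstar Gam (oneEE cPsi) x y.
  have lA := @lower_closure_lower G i.1.
  have [Gam Gp hK] := h _ lA.
  have [Gam' Gp' e] := zero_extension lA Gp.
  exists Gam'; split=> // x y xi yi.
  have xA := fsubsetP (sub_lower_closure i.1) x xi.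
  have yA := fsubsetP (sub_lower_closure i.1) y yi.
  by rewrite e// hK.
have [Gam hGam] := choice ex.
apply: (@limit_kernel R G Psi tPsi cPsi _ exhaust exhaust_proper Gam K
  (fun i => (hGam i).1)) => x y.
apply/cvgrPdist_lt => e e0.
apply: (@exhaust_pair x y _ 0%N) => F n xF yF _.
by rewrite ((hGam (F, n)).2 x y xF yF) subrr normr0.
Qed.

End Exhaustion.

Theorem theorem1p3 (R : realType) (G : semigroupoid)
    (Psi : set {ptws G -> Cplx R})
    (tPsi : test_functions Psi) (cPsi : compact Psi)
    (phi : G -> Cplx R) :
  [<-> Hinf Psi phi /\ Hinf_norm Psi phi <= 1;
       forall F : {fset G}, lower [set` F] ->
         exists2 Gam : G -> G -> dual (Cb R (set_type Psi)),
           dual_pos_kernel [set` F] Gam &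
           forall x y, x \in F -> y \in F ->
             kone R x y - kself phi x y = hatstar Gam (oneEE cPsi) x y;
       exists2 Gam : G -> G -> dual (Cb R (set_type Psi)),
         dual_pos_kernel setT Gam &
         forall x y, kone R x y - kself phi x y = hatstar Gam (oneEE cPsi) x y;
       exists Sigma : colligation Psi, phi = transfer cPsi Sigma].
Proof.
tfae.
- move=> /Hinf_norm_le1P /(kernel_condition_decomposition tPsi cPsi)[Gam Gp hGam] F lF.
  by exists Gam => // A f _; exact: Gp.
- exact: decomposition_exhaustion.
- by case=> Gam Gp hGam; exact: kernel_transfer Gp hGam.
- by case=> Sigma ->; apply/Hinf_norm_le1P; exact: transfer_kernel.
Qed.
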